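(* Let $(X,\mu)$ be a probability space, let $1\le p_0<\infty$, and let $\rho^{p_0}$ be a strongly continuous representation of a locally compact Hausdorff group $G$ on $\mathrm{L}^{p_0}(X,\mu)$ as isometric lattice automorphisms that leave the constants fixed, so that $G$ acts naturally in a similar fashion on $\mathrm{L}^p(X,\mu)$ for all $1\le p<\infty$. Then there exist (1) a topological dynamical system $(G,K)$, where $K$ is a compact Hausdorff space; (2) a $G$-invariant regular Borel probability measure $\widetilde\mu$ on $K$ with $\mathrm{supp}\,\widetilde\mu=K$; (3) a family $\{\Phi_p\}_{1\le p<\infty}$ of isometric lattice isomorphisms $\Phi_p:\mathrm{L}^p(X,\mu)\to\mathrm{L}^p(K,\widetilde\mu)$ that (a) send $\mathbf{1}_X$ to $\mathbf{1}_K$; (b) are compatible with the inclusions between $\mathrm{L}^p$-spaces (that is, for $1\le p\le q<\infty$, the restriction of $\Phi_p$ to $\mathrm{L}^q(X,\mu)\subseteq\mathrm{L}^p(X,\mu)$ is $\Phi_q$); (c) intertwine the strongly continuous representations of $G$ on the spaces $\mathrm{L}^p(X,\mu)$ with the canonical strongly continuous representations of $G$ on the spaces $\mathrm{L}^p(K,\widetilde\mu)$. If $\mu$ is separable, and $G$ is $\sigma$-compact, then $K$ can be taken to be metrizable.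
   Context: All spaces are real; functions equal almost everywhere are identified. Strongly continuous means that $g\mapsto\rho(g)f$ is norm-continuous for every $f$ in the representation space. A topological dynamical system $(G,K)$ consists of a topological group $G$ acting as homeomorphisms on a topological space $K$ such that $(g,x)\mapsto gx$ is continuous from $G\times K$ to $K$. Natural action on all $\mathrm{L}^p$: if $G$ acts on $\mathrm{L}^{p_0}(X,\mu)$ as isometric lattice automorphisms that leave the constants fixed, then each $\rho^{p_0}(g)$ leaves $\mathrm{L}^\infty(X,\mu)$ invariant, and for each $1\le p<\infty$ its restriction to $\mathrm{L}^\infty(X,\mu)$ extends uniquely to an isometric lattice automorphism $\rho^p(g)$ of $\mathrm{L}^p(X,\mu)$ that leaves the constants fixed; this gives a (strongly continuous) representation $\rho^p$ of $G$ on $\mathrm{L}^p(X,\mu)$, and these are the representations of $G$ on the spaces $\mathrm{L}^p(X,\mu)$ in the statement. For a $G$-invariant measure $\widetilde\mu$ on $K$, the canonical representation of $G$ on $\mathrm{L}^p(K,\widetilde\mu)$ is $(gf)(x)=f(g^{-1}x)$. A Borel probability measure $\widetilde\mu$ on a compact Hausdorff space is regular if $\widetilde\mu(Y)=\inf\{\widetilde\mu(W):Y\subseteq W,\ W\text{ open}\}$ for all Borel $Y$ and $\widetilde\mu(W)=\sup\{\widetilde\mu(C):C\subseteq W,\ C\text{ compact}\}$ for all open $W$. The measure $\mu$ is separable if its measure algebra is separable in the metric $(Y_1,Y_2)\mapsto\mu(Y_1\mathbin{\Delta}Y_2)$; equivalently, $\mathrm{L}^p(X,\mu)$ is separable for some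 (equivalently all) $1\le p<\infty$. *)

(* Defs.v *)
From HB Require Import structures.
From mathcomp Require Import all_boot all_order all_algebra.
From mathcomp Require Import all_classical all_reals all_analysis.
From mathcomp Require Import measurable_realfun ess_sup_inf.

Set Implicit Arguments.
Unset Strict Implicit.
Unset Printing Implicit Defensive.

Import Order.TTheory GRing.Theory Num.Theory.
Import numFieldNormedType.Exports.

Local Open Scope classical_set_scope.
Local Open Scope ring_scope.

(* The library's [LspaceType mu p1] is the set of almost everywhere classes of
   p-integrable functions, without algebraic, normed or order structure; these
   are added here, all operations being computed pointwise on representatives. *)

Section Lclass.
Context d (T : measurableType d) (R : realType).
Variables (mu : {measure set T -> \bar R}) (p : \bar R) (p1 : (1 <= p)%E).

Local Notation Mf := {mfun T >-> measurableTypeR R}.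
Local Notation Q := {mfun_ mu, T >-> measurableTypeR R}.

Lemma Lnorm_ae (f g : T -> R) :
  measurable_fun setT f -> measurable_fun setT g ->
  f = g %[ae mu] -> Lnorm mu p (EFin \o f) = Lnorm mu p (EFin \o g).
Proof.
move=> mf mg fg.
case: p p1 => [r r1| _|//]; rewrite unlock /Lnorm.
  congr (_ `^ _)%E; apply: ae_eq_integral => //.
  - apply/measurable_EFinP.
    apply: (@measurableT_comp _ _ _ _ _ _ (@powR R ^~ r)) => //.
    exact: measurableT_comp.
  - apply/measurable_EFinP.
    apply: (@measurableT_comp _ _ _ _ _ _ (@powR R ^~ r)) => //.
    exact: measurableT_comp.
  by apply: filterS fg => x /= + _ => ->.
case: ifPn => // mu0; apply: eq_ess_sup.
by apply: filterS fg => x /= ->.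
Qed.

Lemma measurable_aeEqMfun (F : Q) : measurable_fun setT (F : T -> R).
Proof. exact: (@measurable_funPT _ _ T (measurableTypeR R) (repr F)). Qed.

Lemma pi_ae (f : Mf) : ((\pi_Q%qT f : Q) : T -> R) = f %[ae mu].
Proof.
have /eqP := reprK (\pi_Q%qT f : Q).
by rewrite eqmodE => /asboolP.
Qed.

Section Lpi.
Variable f : LfunType mu p1.

(* [R] and [measurableTypeR R] have the same measurable sets, but different
   displays. *)
Let f_measurable : measurable_fun setT (f : T -> measurableTypeR R).
Proof. exact: (@measurable_funPT _ _ _ _ f). Qed.

Let fM : Mf := @mfun_Sub _ _ T (measurableTypeR R) f (mem_set f_measurable).

Let pi_finite_norm : finite_norm mu p (\pi_Q%qT fM : Q).
Proof.
rewrite /finite_norm (@Lnorm_ae _ f)//; last exact: pi_ae.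
- exact: Lfunction_finite.
- exact: measurable_aeEqMfun.
Qed.

#[local] HB.instance Definition _ :=
  isFinLebesgue.Build d T R mu p p1 (\pi_Q%qT fM : Q) pi_finite_norm.

Definition Lpi : LspaceType mu p1 := [the LspaceType mu p1 of (\pi_Q%qT fM : Q)].

Lemma Lpi_ae : Lpi = f %[ae mu].
Proof. exact: pi_ae. Qed.
End Lpi.

(* The class of an arbitrary function [f]; the value [0] is returned when [f]
   is not measurable or not p-integrable. *)
Definition Lclass (f : T -> R) : LspaceType mu p1 :=
  Lpi (insubd (0 : LfunType mu p1) f).

Lemma LclassE (f : T -> R) : f \in Lfun mu p -> Lclass f = f %[ae mu].
Proof.
move=> fL.
have := Lpi_ae (insubd (0 : LfunType mu p1) f).
have -> : (insubd (0 : LfunType mu p1) f : T -> R) = f := insubdK _ fL.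
by [].
Qed.

Lemma LspaceP (F : LspaceType mu p1) : (F : T -> R) \in Lfun mu p.
Proof.
rewrite inE; apply/andP; split; first by rewrite inE/=; exact: measurable_aeEqMfun.
by rewrite inE /=; exact: Lebesgue_finite.
Qed.

Lemma Lspace_eq (F G : LspaceType mu p1) : F = G %[ae mu] -> F = G.
Proof.
move=> /ae_eqP; rewrite !reprK => /eqP.
case: F G => [F [[Fm]]] [G [[Gm]]] /= FG; subst G.
by rewrite (bool_irrelevance Fm Gm).
Qed.

Lemma LclassK (F : LspaceType mu p1) : Lclass F = F.
Proof. by apply: Lspace_eq; apply: LclassE; exact: LspaceP. Qed.

Lemma Lclass_eq (f g : T -> R) : f \in Lfun mu p -> g \in Lfun mu p ->
  f = g %[ae mu] -> Lclass f = Lclass g.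
Proof.
move=> fL gL fg; apply: Lspace_eq.
by apply: filterS3 (LclassE fL) (LclassE gL) fg => x + + + _ => -> // -> // ->.
Qed.

End Lclass.

Section Lfun_closed.
Context d (T : measurableType d) (R : realType).
Variables (mu : {measure set T -> \bar R}) (p : \bar R) (p1 : (1 <= p)%E).
Implicit Types f g : T -> R.

Lemma LfunD f g : f \in Lfun mu p -> g \in Lfun mu p -> f \+ g \in Lfun mu p.
Proof. by have [_ h] := Lfun_addr_closed mu p1; exact: h. Qed.

Lemma LfunN f : f \in Lfun mu p -> \- f \in Lfun mu p.
Proof. exact: Lfun_oppr_closed. Qed.

Lemma LfunZ a f : f \in Lfun mu p -> a \*: f \in Lfun mu p.
Proof.
move=> fL; have [L0 L] := Lfun_submod_closed mu p1.
by have := L a f 0 fL L0; rewrite addr0.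
Qed.

Lemma Lfun_abs f : f \in Lfun mu p -> (fun x => `|f x|) \in Lfun mu p.
Proof.
case/andP; rewrite !inE/= => mf finf; apply/andP; split.
  by rewrite inE/=; exact: measurableT_comp.
rewrite inE/= /finite_norm.
rewrite [X in (X < _)%E](_ : _ = Lnorm mu p (abse \o (EFin \o f)))//.
by rewrite Lnorm_abse.
Qed.

Lemma Lfun_max f g : f \in Lfun mu p -> g \in Lfun mu p ->
  (fun x => Num.max (f x) (g x)) \in Lfun mu p.
Proof.
move=> fL gL.
rewrite [X in X \in _](_ : _ =
  2^-1 \*: ((f \+ g) \+ (fun x => `|(f \+ \- g) x|))).
  by apply/LfunZ/LfunD; [exact: LfunD|exact/Lfun_abs/LfunD/LfunN].
by apply/funext => x /=; rewrite maxr_absE mulrC.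
Qed.

Lemma Lfun_min f g : f \in Lfun mu p -> g \in Lfun mu p ->
  (fun x => Num.min (f x) (g x)) \in Lfun mu p.
Proof.
move=> fL gL.
rewrite [X in X \in _](_ : _ =
  2^-1 \*: ((f \+ g) \+ \- (fun x => `|(f \+ \- g) x|))).
  by apply/LfunZ/LfunD; [exact: LfunD|exact/LfunN/Lfun_abs/LfunD/LfunN].
by apply/funext => x /=; rewrite minr_absE mulrC.
Qed.

Lemma Lfun0 : cst 0 \in Lfun mu p.
Proof. by have [] := Lfun_addr_closed mu p1. Qed.

End Lfun_closed.

Fact Lspace_display : Order.disp_t. Proof. exact: Order.Disp tt tt. Qed.

Section Lspace_normed_lattice.
Context d (T : measurableType d) (R : realType).
Variables (mu : {measure set T -> \bar R}) (p : \bar R) (p1 : (1 <= p)%E).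

Local Notation L := (LspaceType mu p1).
Local Notation "'cl' f" := (Lclass mu p1 f) (at level 10).
Implicit Types (F G H : L) (a b : R).

HB.instance Definition _ := gen_eqMixin L.
HB.instance Definition _ := gen_choiceMixin L.

Definition Lspace_zero : L := cl (cst 0).
Definition Lspace_opp F : L := cl (fun x => - F x).
Definition Lspace_add F G : L := cl (fun x => F x + G x).
Definition Lspace_scale a F : L := cl (fun x => a * F x).
Definition Lspace_norm F : R := fine (Lnorm mu p (EFin \o F)).
Definition Lspace_le F G : bool := `[< \forall x \ae mu, F x <= G x >].
Definition Lspace_meet F G : L := cl (fun x => Num.min (F x) (G x)).
Definition Lspace_join F G : L := cl (fun x => Num.max (F x) (G x)).

Lemma Lspace_zeroE : \forall x \ae mu, Lspace_zero x = 0.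
Proof.
have /= := LclassE p1 (Lfun0 mu p1).
by apply: filterS => x; apply.
Qed.

Lemma Lspace_oppE F : \forall x \ae mu, Lspace_opp F x = - F x.
Proof.
by have := LclassE p1 (LfunN (LspaceP F)); apply: filterS => x; apply.
Qed.

Lemma Lspace_addE F G : \forall x \ae mu, Lspace_add F G x = F x + G x.
Proof.
by have := LclassE p1 (LfunD p1 (LspaceP F) (LspaceP G)); apply: filterS => x; apply.
Qed.

Lemma Lspace_scaleE a F : \forall x \ae mu, Lspace_scale a F x = a * F x.
Proof.
by have := LclassE p1 (LfunZ p1 a (LspaceP F)); apply: filterS => x; apply.
Qed.

Lemma Lspace_meetE F G :
  \forall x \ae mu, Lspace_meet F G x = Num.min (F x) (G x).
Proof.
by have := LclassE p1 (Lfun_min p1 (LspaceP F) (LspaceP G));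
  apply: filterS => x; apply.
Qed.

Lemma Lspace_joinE F G :
  \forall x \ae mu, Lspace_join F G x = Num.max (F x) (G x).
Proof.
by have := LclassE p1 (Lfun_max p1 (LspaceP F) (LspaceP G));
  apply: filterS => x; apply.
Qed.

Lemma Lspace_aeP F G : (\forall x \ae mu, F x = G x) -> F = G.
Proof. by move=> FG; apply: Lspace_eq; apply: filterS FG. Qed.

Let addA : associative Lspace_add.
Proof.
move=> F G H; apply: Lspace_aeP; near=> x.
rewrite (near (Lspace_addE F (Lspace_add G H)) x)//.
rewrite (near (Lspace_addE (Lspace_add F G) H) x)//.
rewrite (near (Lspace_addE F G) x)// (near (Lspace_addE G H) x)//.
exact: addrA.
Unshelve. all: by end_near. Qed.

Let addC : commutative Lspace_add.
Proof.
move=> F G; apply: Lspace_aeP; near=> x.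
rewrite (near (Lspace_addE F G) x)// (near (Lspace_addE G F) x)//.
exact: addrC.
Unshelve. all: by end_near. Qed.

Let add0 : left_id Lspace_zero Lspace_add.
Proof.
move=> F; apply: Lspace_aeP; near=> x.
rewrite (near (Lspace_addE Lspace_zero F) x)// (near Lspace_zeroE x)//.
exact: add0r.
Unshelve. all: by end_near. Qed.

Let addN : left_inverse Lspace_zero Lspace_opp Lspace_add.
Proof.
move=> F; apply: Lspace_aeP; near=> x.
rewrite (near (Lspace_addE (Lspace_opp F) F) x)// (near Lspace_zeroE x)//.
rewrite (near (Lspace_oppE F) x)//.
exact: addNr.
Unshelve. all: by end_near. Qed.

HB.instance Definition _ := GRing.isZmodule.Build L addA addC add0 addN.

Let scaleA a b F :
  Lspace_scale a (Lspace_scale b F) = Lspace_scale (a * b) F.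
Proof.
apply: Lspace_aeP; near=> x.
rewrite (near (Lspace_scaleE a (Lspace_scale b F)) x)//.
rewrite (near (Lspace_scaleE (a * b) F) x)// (near (Lspace_scaleE b F) x)//.
exact: mulrA.
Unshelve. all: by end_near. Qed.

Let scale1 : left_id 1 Lspace_scale.
Proof.
move=> F; apply: Lspace_aeP; near=> x.
rewrite (near (Lspace_scaleE 1 F) x)//; exact: mul1r.
Unshelve. all: by end_near. Qed.

Let scaleDr : right_distributive Lspace_scale +%R.
Proof.
move=> a F G; apply: Lspace_aeP; near=> x.
rewrite (near (Lspace_scaleE a (Lspace_add F G)) x)//.
rewrite (near (Lspace_addE (Lspace_scale a F) (Lspace_scale a G)) x)//.
rewrite (near (Lspace_scaleE a F) x)// (near (Lspace_scaleE a G) x)//.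
rewrite (near (Lspace_addE F G) x)//; exact: mulrDr.
Unshelve. all: by end_near. Qed.

Let scaleDl F : {morph Lspace_scale^~ F : a b / a + b}.
Proof.
move=> a b; apply: Lspace_aeP; near=> x.
rewrite (near (Lspace_scaleE (a + b) F) x)//.
rewrite (near (Lspace_addE (Lspace_scale a F) (Lspace_scale b F)) x)//.
rewrite (near (Lspace_scaleE a F) x)// (near (Lspace_scaleE b F) x)//.
exact: mulrDl.
Unshelve. all: by end_near. Qed.

HB.instance Definition _ :=
  GRing.Zmodule_isLmodule.Build R L scaleA scale1 scaleDr scaleDl.

Let Lf F : LfunType mu p1 := Lfun_Sub p1 (LspaceP F).

Lemma Lspace_normE F : (Lspace_norm F)%:E = Lnorm mu p (EFin \o F).
Proof. exact: (finite_norm_fine (Lf F)). Qed.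

Let mL F : measurable_fun setT (F : T -> R).
Proof. exact: measurable_aeEqMfun. Qed.

Let normD F G : Lspace_norm (F + G) <= Lspace_norm F + Lspace_norm G.
Proof.
rewrite -lee_fin EFinD !Lspace_normE.
rewrite (@Lnorm_ae _ _ _ _ _ p1 _ ((F : T -> R) \+ G))//.
- rewrite [leLHS](_ : _ = Lnorm mu p (EFin \o ((F : T -> R) \+ G)))//.
  exact: eminkowski.
- exact: measurable_funD.
- by apply: filterS (Lspace_addE F G).
Qed.

Let normZ a F : Lspace_norm (a *: F) = `|a| * Lspace_norm F.
Proof.
apply: EFin_inj; rewrite EFinM !Lspace_normE.
rewrite -(LnormZ (Lf F) a); apply: Lnorm_ae => //.
- exact: measurable_funM.
- by apply: filterS (Lspace_scaleE a F).
Qed.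

Let norm_eq0 F : Lspace_norm F = 0 -> F = 0.
Proof.
move=> F0; apply: Lspace_aeP.
have := @fine_Lnormr_eq0 _ _ _ mu p p1 (Lf F) F0.
apply: filterS2 Lspace_zeroE => x x0 /(_ I) Fx.
exact: etrans Fx (esym x0).
Qed.

HB.instance Definition _ :=
  Lmodule_isNormed.Build R L normD normZ norm_eq0.

Let lexx' : reflexive Lspace_le.
Proof. by move=> F; apply/asboolP; apply: aeW => x. Qed.

Let le_anti' : antisymmetric Lspace_le.
Proof.
move=> F G /andP[/asboolP FG /asboolP GF]; apply: Lspace_aeP.
by apply: filterS2 FG GF => x FG GF; apply/eqP; rewrite eq_le FG.
Qed.

Let le_trans' : transitive Lspace_le.
Proof.
move=> G F H /asboolP FG /asboolP GH; apply/asboolP.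
by apply: filterS2 FG GH => x; exact: le_trans.
Qed.

HB.instance Definition _ :=
  Order.Le_isPOrder.Build Lspace_display L lexx' le_anti' le_trans'.

Let meetP' F G H :
  Lspace_le F (Lspace_meet G H) = Lspace_le F G && Lspace_le F H.
Proof.
apply/idP/andP => [/asboolP FGH|[/asboolP FG /asboolP FH]].
  split; apply/asboolP; apply: filterS2 FGH (Lspace_meetE G H) => x + E;
  by rewrite E le_min => /andP[].
apply/asboolP; apply: filterS3 FG FH (Lspace_meetE G H) => x FG FH ->.
by rewrite le_min FG.
Qed.

Let joinP' F G H :
  Lspace_le (Lspace_join F G) H = Lspace_le F H && Lspace_le G H.
Proof.
apply/idP/andP => [/asboolP FGH|[/asboolP FH /asboolP GH]].
  split; apply/asboolP; apply: filterS2 FGH (Lspace_joinE F G) => x + E;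
  by rewrite E ge_max => /andP[].
apply/asboolP; apply: filterS3 FH GH (Lspace_joinE F G) => x FH GH ->.
by rewrite ge_max FH.
Qed.

HB.instance Definition _ := Order.POrder_MeetJoin_isLattice.Build
  Lspace_display L meetP' joinP'.

End Lspace_normed_lattice.

Section Loperators.
Context d (T : measurableType d) (R : realType).
Variable mu : {measure set T -> \bar R}.

Definition Lcst (p : \bar R) (p1 : (1 <= p)%E) (c : R) : LspaceType mu p1 :=
  Lclass mu p1 (cst c).

(* The inclusion of L^q in L^p, meaningful for a finite measure and p <= q. *)
Definition Lincl (p q : \bar R) (p1 : (1 <= p)%E) (q1 : (1 <= q)%E)
  (F : LspaceType mu q1) : LspaceType mu p1 := Lclass mu p1 F.

Lemma Lincl_ae (p q : \bar R) (p1 : (1 <= p)%E) (q1 : (1 <= q)%E)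
    (F : LspaceType mu q1) :
  mu [set: T] \is a fin_num -> (p <= q)%E -> Lincl p1 F = F %[ae mu].
Proof.
move=> mufin pq; apply: LclassE.
exact: (Lfun_subset p1 q1 mufin pq (LspaceP F)).
Qed.

End Loperators.

Lemma Lcst_ae d (T : measurableType d) (R : realType)
    (mu : {finite_measure set T -> \bar R}) (p : R) (p1 : (1 <= p%:E)%E) (c : R) :
  Lcst mu p1 c = cst c %[ae mu].
Proof. by apply: LclassE; exact: Lfun_cst. Qed.

Definition isometric_lattice_iso d d' (T : measurableType d)
    (T' : measurableType d') (R : realType) (mu : {measure set T -> \bar R})
    (nu : {measure set T' -> \bar R}) (p q : \bar R) (p1 : (1 <= p)%E)
    (q1 : (1 <= q)%E) (S : LspaceType mu p1 -> LspaceType nu q1) : Prop :=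
  [/\ linear S, forall F, `|S F| = `|F|, bijective S,
      Order.meet_morphism S & Order.join_morphism S].

Section natural_extension.
Context d (T : measurableType d) (R : realType).
Variable mu : {measure set T -> \bar R}.

Definition isometric_lattice_aut_cst (p : \bar R) (p1 : (1 <= p)%E)
    (S : LspaceType mu p1 -> LspaceType mu p1) : Prop :=
  isometric_lattice_iso S /\ forall c : R, S (Lcst mu p1 c) = Lcst mu p1 c.

(* [S0] leaves L^oo invariant, and [S] extends its restriction to L^oo. *)
Definition extends_restriction_to_Linfty (p0 p : \bar R) (p01 : (1 <= p0)%E)
    (p1 : (1 <= p)%E) (S0 : LspaceType mu p01 -> LspaceType mu p01)
    (S : LspaceType mu p1 -> LspaceType mu p1) : Prop :=
  forall F : LspaceType mu (leey 1), exists H : LspaceType mu (leey 1),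
    S0 (Lincl p01 F) = Lincl p01 H /\ S (Lincl p1 F) = Lincl p1 H.

Definition natural_extension (p0 p : \bar R) (p01 : (1 <= p0)%E)
    (p1 : (1 <= p)%E) (S0 : LspaceType mu p01 -> LspaceType mu p01)
    (S : LspaceType mu p1 -> LspaceType mu p1) : Prop :=
  isometric_lattice_aut_cst S /\ extends_restriction_to_Linfty S0 S.

(* [rho p p1 g] is the unique natural extension of [rho0 g] to L^p; in
   particular, [rho p0 p01 = rho0]. *)
Definition natural_action (G : Type) (p0 : R) (p01 : (1 <= p0%:E)%E)
    (rho0 : G -> LspaceType mu p01 -> LspaceType mu p01)
    (rho : forall (p : R) (p1 : (1 <= p%:E)%E),
       G -> LspaceType mu p1 -> LspaceType mu p1) : Prop :=
  forall p p1 g, unique (natural_extension (p1 := p1) (rho0 g)) (rho p p1 g).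

End natural_extension.

HB.mixin Record isTopologicalGroup G & Topological G & Group G := {
  mulg_continuous : continuous (fun x : G * G => (x.1 * x.2)%g) ;
  invg_continuous : continuous (fun x : G => (x^-1)%g)
}.

#[short(type="topologicalGroupType")]
HB.structure Definition TopologicalGroup :=
  {G of Topological G & Group G & isTopologicalGroup G}.

Definition sigma_compact (T : topologicalType) : Prop :=
  exists C : (set T)^nat, (forall n, compact (C n)) /\ \bigcup_n C n = [set: T].

(* [sc] stands for strongly continuous. *)
Definition sc_isometric_lattice_rep d (T : measurableType d) (R : realType)
    (mu : {measure set T -> \bar R}) (p : \bar R) (p1 : (1 <= p)%E)
    (G : topologicalGroupType)
    (rho : G -> LspaceType mu p1 -> LspaceType mu p1) : Prop :=
  [/\ forall F, rho 1%g F = F,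
      forall g h F, rho (g * h)%g F = rho g (rho h F),
      forall g, isometric_lattice_aut_cst (rho g)
    & forall F, continuous (rho^~ F)].

(* Each [act g] is a homeomorphism, with inverse [act g^-1]. *)
Definition topological_dynamical_system (G : topologicalGroupType)
    (K : topologicalType) (act : G -> K -> K) : Prop :=
  [/\ forall x, act 1%g x = x,
      forall g h x, act (g * h)%g x = act g (act h x)
    & continuous (fun z : G * K => act z.1 z.2)].

Notation borel K := (g_sigma_algebraType (@open K)).

Section borel_measure.
Context (K : ptopologicalType) (R : realType).
Variable nu : {measure set (borel K) -> \bar R}.

Definition invariant_measure (G : Type) (act : G -> K -> K) : Prop :=
  forall g (Y : set (borel K)), measurable Y -> nu (act g @^-1` Y) = nu Y.

Definition regular_measure : Prop :=
  (forall Y : set (borel K), measurable Y ->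
     nu Y = ereal_inf [set nu W | W in [set W : set K | open W /\ Y `<=` W]]) /\
  (forall W : set K, open W ->
     nu W = ereal_sup [set nu C | C in [set C : set K | compact C /\ C `<=` W]]).

Definition measure_support : set K :=
  [set x | forall U : set K, open U -> U x -> (0 < nu U)%E].

End borel_measure.

(* (g F)(x) = F (g^-1 x) *)
Definition canonical_rep (G : topologicalGroupType) (K : ptopologicalType)
    (R : realType) (nu : {measure set (borel K) -> \bar R}) (act : G -> K -> K)
    (p : \bar R) (p1 : (1 <= p)%E) (g : G) (F : LspaceType nu p1) :
    LspaceType nu p1 :=
  Lclass nu p1 (fun x => F (act g^-1%g x)).
Arguments canonical_rep {G K R} nu act {p} p1 g F.

Section canonical_rep_ae.
Context (G : topologicalGroupType) (K : ptopologicalType) (R : realType).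
Variables (nu : {measure set (borel K) -> \bar R}) (act : G -> K -> K).
Hypothesis actP : topological_dynamical_system act.
Hypothesis nu_inv : invariant_measure nu act.

Let act_measurable g : measurable_fun setT (act g : borel K -> borel K).
Proof.
apply: (@measurability _ _ (borel K) (borel K) setT (act g) (@open K)) => //.
move=> _ [U oU <-]; rewrite setTI; apply: sub_sigma_algebra.
apply: open_comp => // x _.
have [_ _ /(_ (g, x)) ac] := actP.
apply: (@continuous_comp _ _ _ (fun y => (g, y)) (fun z : G * K => act z.1 z.2)).
  by apply: cvg_pair; [exact: cvg_cst|exact: cvg_id].
exact: ac.
Qed.

Lemma canonical_rep_ae (p : R) (p1 : (1 <= p%:E)%E) (g : G)
    (F : LspaceType nu p1) :
  canonical_rep nu act p1 g F = (fun x => F (act g^-1%g x)) %[ae nu].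
Proof.
apply: LclassE; have /andP[] := LspaceP F; rewrite !inE /= => mF FL.
have mFg : @measurable_fun _ _ (borel K) R setT (fun x => F (act g^-1%g x)).
  exact: (measurableT_comp mF (act_measurable g^-1%g)).
apply/andP; split; first by rewrite inE.
rewrite inE /=; move: FL; rewrite /finite_norm unlock /Lnorm.
set I := (\int[nu]_x _)%E; set J := (\int[nu]_x _)%E.
suff -> : I = J by [].
pose h (x : borel K) := (`|(F x)%:E| `^ p)%E.
have mh : measurable_fun setT h.
  apply/measurable_EFinP.
  apply: (@measurableT_comp _ _ _ _ _ _ (@powR R ^~ p)) => //.
  exact: measurableT_comp.
have := @ge0_integral_pushforward _ _ _ _ _ _ (act_measurable g^-1%g) nu setT h.
rewrite preimage_setT => /(_ measurableT mh (fun _ _ => poweR_ge0 _ _)) E.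
rewrite [J](_ : _ = \int[nu]_x (h \o act g^-1%g) x)%E// -E.
apply: eq_measure_integral => A mA _.
by rewrite /= /pushforward nu_inv.
Qed.

End canonical_rep_ae.

Definition separable_measure d (T : measurableType d) (R : realType)
    (mu : {measure set T -> \bar R}) : Prop :=
  exists D : (set T)^nat, (forall n, measurable (D n)) /\
    forall Y, measurable Y -> forall e : R, 0 < e ->
      exists n, (mu (Y `+` D n) < e%:E)%E.

Definition metrizable (R : realType) (K : topologicalType) : Prop :=
  exists (M : metricType R) (f : K -> M) (f' : M -> K),
    [/\ cancel f f', cancel f' f, continuous f & continuous f'].

(* Main.v *)
From HB Require Import structures.
Require Import Defs.
From mathcomp Require Import all_boot all_order all_algebra.
From mathcomp Require Import all_classical all_reals all_analysis.
From mathcomp Require Import measurable_realfun ess_sup_inf ring lra.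

Set Implicit Arguments.
Unset Strict Implicit.
Unset Printing Implicit Defensive.

Import Order.TTheory GRing.Theory Num.Theory.
Import numFieldNormedType.Exports.

Local Open Scope classical_set_scope.
Local Open Scope ring_scope.

(** Everything takes place in the measure algebra of [mu], that is, for sets and
    functions up to null sets.

    From L^p to the measure algebra. Indicators are the components of the constant
    function 1, and super-level sets are suprema of lattice expressions; so a
    lattice automorphism that fixes the constants amounts to a measure-preserving
    morphism of the measure algebra ([indic_image_morphism], [S_indic]). Such a
    morphism transports functions ([transports], [push]) and acts isometrically on
    all the spaces L^p at once ([push_Lp]); this yields the unique natural
    extensions ([natural_extension_push]). The representation becomes a continuous
    action of [G] on the measure algebra ([rep_algebra_action]), and any such
    action gives strongly continuous representations ([algebra_action_rep]).

    Uniformly continuous functions. The space [K] has to come from functions on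
    [X] whose orbit is continuous for the sup norm, and these must be numerous.
    For a measurable set [Y] and a bump function [phi] near the identity, the mean
    of [mu (gY `&` B)] over [g] with weight [phi], as a function of [B], is a content
    dominated by [mu] and has a density [a] between 0 and 1. Translating [a] amounts
    to translating [phi], whence sup norm continuity, and [a] is close to the
    indicator of [Y] ([uniformly_continuous_dense]). The mean is taken with a left
    invariant functional, constructed from covering numbers and additive on
    continuous functions of compact support ([haar_functional_exists]).

    The space. [K] is the joint essential range, in a power of the unit interval,
    of all translates of such a family of functions ([essential_range]): it is
    compact, and it plays the part of the spectrum of the algebra that they
    generate. In general there is no measurable map of points from [X] to [K], but
    there is an inverse-image map: for an open set [W], the largest set of which the
    joint distribution is carried by [W] ([open_part]); for any other set, an outer
    approximation ([inverse_part]). On Borel sets it is a morphism of measure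
    algebras, and the image measure is regular, with support [K], by construction.
    As the family generates the measure algebra of [mu], the morphism is onto up to
    null sets ([inverse_part_surj]), and its inverse induces the isomorphisms of the
    L^p-spaces ([dynamical_model]). The group acts on [K] by permuting the
    coordinates, and uniform continuity of the family makes the action jointly
    continuous ([point_act_continuous]).

    Metrizability. For separable [mu] a countable family is enough, and for
    sigma-compact [G] countably many of its translates approximate all the others
    uniformly; so countably many coordinates separate the points of [K]
    ([model_metrizable]). *)

(** * Inclusion and equality of sets up to null sets *)

Section ae_sets.
Context d (T : measurableType d) (R : realType) (mu : {measure set T -> \bar R}).
Implicit Types A B C : set T.

Definition ae_sub A B := \forall x \ae mu, A x -> B x.
Definition ae_same A B := \forall x \ae mu, A x <-> B x.

Lemma ae_same_refl A : ae_same A A.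
Proof. by apply: aeW => x. Qed.

Lemma ae_same_sym A B : ae_same A B -> ae_same B A.
Proof. by rewrite /ae_same; apply: filterS => x [? ?]; split. Qed.

Lemma ae_same_trans A B C : ae_same A B -> ae_same B C -> ae_same A C.
Proof. by rewrite /ae_same; apply: filterS2 => x -> ->. Qed.

Lemma ae_same_sub A B : ae_same A B -> ae_sub A B.
Proof. by rewrite /ae_same; apply: filterS => x []. Qed.

Lemma subset_ae_sub A B : A `<=` B -> ae_sub A B.
Proof. by move=> AB; apply: aeW. Qed.

Lemma ae_sub_trans A B C : ae_sub A B -> ae_sub B C -> ae_sub A C.
Proof. by rewrite /ae_sub; apply: filterS2 => x AB BC /AB. Qed.

Lemma ae_sub_anti A B : ae_sub A B -> ae_sub B A -> ae_same A B.
Proof. by rewrite /ae_sub /ae_same; apply: filterS2 => x. Qed.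

Lemma ae_sameC A B : ae_same A B -> ae_same (~` A) (~` B).
Proof.
by rewrite /ae_same; apply: filterS => x [AB BA]; split=> h ?; apply: h; auto.
Qed.

Lemma ae_sameI A B C D : ae_same A B -> ae_same C D ->
  ae_same (A `&` C) (B `&` D).
Proof.
by rewrite /ae_same; apply: filterS2 => x [? ?] [? ?]; split => -[]; split; auto.
Qed.

Lemma ae_sameU A B C D : ae_same A B -> ae_same C D ->
  ae_same (A `|` C) (B `|` D).
Proof.
rewrite /ae_same; apply: filterS2 => x [? ?] [? ?].
by split => -[?|?]; by [left; auto|right; auto].
Qed.

Lemma ae_same_bigcup (A B : (set T)^nat) : (forall n, ae_same (A n) (B n)) ->
  ae_same (\bigcup_n A n) (\bigcup_n B n).
Proof.
move=> AB; apply: filterS (ae_foralln AB) => x h.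
by split=> -[n _ hn]; exists n => //; apply/(h n).
Qed.

Lemma ae_forall_countable (I : countType) (P : I -> T -> Prop) :
  (forall i, \forall x \ae mu, P i x) -> \forall x \ae mu, forall i, P i x.
Proof.
move=> hP; pose Q n x := if unpickle n is Some i then P i x else True.
have hQ n : \forall x \ae mu, Q n x.
  by rewrite /Q; case: unpickle => [i|]; [exact: hP|exact: aeW].
by apply: filterS (ae_foralln hQ) => x h i; have := h (pickle i); rewrite /Q pickleK.
Qed.

Lemma measurable_null A : measurable A -> mu A = 0%E <-> \forall x \ae mu, ~ A x.
Proof.
move=> mA; rewrite -(negligibleP _ mA).
by rewrite -[in X in X <-> _](setCK A).
Qed.

Lemma measure_ae_sub A B : measurable A -> measurable B -> ae_sub A B ->
  (mu A <= mu B)%E.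
Proof.
move=> mA mB AB; have mAB := measurableD mA mB.
rewrite (measureDI mu mA mB) [X in (X + _)%E](_ : _ = 0%E) ?add0e; last first.
  apply/(measurable_null mAB).
  by move: AB; rewrite /ae_sub; apply: filterS => x h [/h].
by apply: le_measure; rewrite ?inE//; exact: measurableI.
Qed.

Lemma measure_ae_same A B : measurable A -> measurable B -> ae_same A B ->
  mu A = mu B.
Proof.
move=> mA mB AB; apply/eqP; rewrite eq_le.
by rewrite !measure_ae_sub//; apply: ae_same_sub => //; exact: ae_same_sym.
Qed.

Lemma ae_sub_measureD A B : measurable A -> measurable B ->
  mu (A `\` B) = 0%E <-> ae_sub A B.
Proof.
move=> mA mB; rewrite measurable_null; last exact: measurableD.
split; rewrite /ae_sub; apply: filterS => x.
  by move=> h Ax; apply: contrapT => nB; apply: h.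
by move=> h [/h].
Qed.

End ae_sets.

(** * Morphisms of measure algebras *)

Section set_morphism.
Context d (T : measurableType d) d' (X : measurableType d') (R : realType).
Variables (nu : {measure set T -> \bar R}) (mu : {measure set X -> \bar R}).
Implicit Types A B : set T.

(** A measure-preserving homomorphism from the measure algebra of [nu] to that of
    [mu], defined on representatives and respecting the operations up to null
    sets. No underlying map of points need exist. *)
Record set_morphism (s : set T -> set X) : Prop := SetMorphism {
  sm_measurable : forall A, measurable A -> measurable (s A) ;
  sm_measure : forall A, measurable A -> mu (s A) = nu A ;
  sm_C : forall A, measurable A -> ae_same mu (s (~` A)) (~` s A) ;
  sm_bigcup : forall A : (set T)^nat, (forall n, measurable (A n)) ->
    ae_same mu (s (\bigcup_n A n)) (\bigcup_n s (A n)) }.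

Variables (s : set T -> set X) (sP : set_morphism s).

Lemma sm_U A B : measurable A -> measurable B ->
  ae_same mu (s (A `|` B)) (s A `|` s B).
Proof.
move=> mA mB; pose F n := if n is 0%N then A else B.
have mF n : measurable (F n) by case: n.
have := sm_bigcup sP mF.
have E Y (G : set T -> set Y) : \bigcup_n G (F n) = G A `|` G B.
  apply/seteqP; split => [x [[|n] _ ?]|x [?|?]]; first by left.
  - by right.
  - by exists 0%N.
  - by exists 1%N.
by rewrite (E _ s) (E _ id).
Qed.

Lemma sm_I A B : measurable A -> measurable B ->
  ae_same mu (s (A `&` B)) (s A `&` s B).
Proof.
move=> mA mB; have mCA := measurableC mA; have mCB := measurableC mB.
have mU : measurable (~` A `|` ~` B) by exact: measurableU.
have -> : A `&` B = ~` (~` A `|` ~` B) by rewrite setCU !setCK.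
apply: ae_same_trans (sm_C sP mU) _.
rewrite -[X in ae_same mu _ X]setCK; apply: ae_sameC; rewrite setCI.
apply: ae_same_trans (sm_U mCA mCB) _.
by apply: ae_sameU; exact: sm_C.
Qed.

Lemma sm_D A B : measurable A -> measurable B ->
  ae_same mu (s (A `\` B)) (s A `\` s B).
Proof.
move=> mA mB; rewrite setDE; apply: ae_same_trans (sm_I mA (measurableC mB)) _.
by rewrite setDE; apply: ae_sameI; [exact: ae_same_refl|exact: sm_C].
Qed.

Lemma sm_null A : measurable A -> (\forall x \ae nu, ~ A x) ->
  \forall x \ae mu, ~ s A x.
Proof.
move=> mA /(measurable_null _ mA) A0.
by apply/measurable_null; rewrite ?sm_measure//; exact: sm_measurable.
Qed.

Lemma sm_ae_sub A B : measurable A -> measurable B -> ae_sub nu A B ->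
  ae_sub mu (s A) (s B).
Proof.
move=> mA mB /(ae_sub_measureD _ mA mB) AB0; have mD := measurableD mA mB.
apply/ae_sub_measureD; [exact: sm_measurable..|].
rewrite -[RHS]AB0 -(sm_measure sP)//; apply: measure_ae_same.
- by apply: measurableD; exact: sm_measurable.
- exact: sm_measurable.
- exact/ae_same_sym/sm_D.
Qed.

Lemma sm_ae_same A B : measurable A -> measurable B -> ae_same nu A B ->
  ae_same mu (s A) (s B).
Proof.
move=> mA mB AB; apply: ae_sub_anti; apply: sm_ae_sub => //.
- exact: ae_same_sub.
- exact/ae_same_sub/ae_same_sym.
Qed.

(** A measure-preserving morphism detects null sets, hence inclusions. *)
Lemma sm_ae_sub_inj A B : measurable A -> measurable B ->
  ae_sub mu (s A) (s B) -> ae_sub nu A B.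
Proof.
move=> mA mB /(ae_sub_measureD mu (sm_measurable sP mA) (sm_measurable sP mB)) E.
have mD := measurableD mA mB; apply/ae_sub_measureD => //.
rewrite -[RHS]E -(sm_measure sP)//; apply: measure_ae_same.
- exact: sm_measurable.
- by apply: measurableD; exact: sm_measurable.
- exact: sm_D.
Qed.

Lemma sm_ae_same_inj A B : measurable A -> measurable B ->
  ae_same mu (s A) (s B) -> ae_same nu A B.
Proof.
move=> mA mB AB; apply: ae_sub_anti; apply: sm_ae_sub_inj => //.
- exact: ae_same_sub.
- exact/ae_same_sub/ae_same_sym.
Qed.

Lemma sm_bigcap (A : (set T)^nat) : (forall n, measurable (A n)) ->
  ae_same mu (s (\bigcap_n A n)) (\bigcap_n s (A n)).
Proof.
move=> mA; have mCA n := measurableC (mA n).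
rewrite -[\bigcap_n A n]setCK setC_bigcap -[\bigcap_n s (A n)]setCK setC_bigcap.
apply: ae_same_trans (sm_C sP (bigcupT_measurable _ mCA)) _.
apply: ae_sameC; apply: ae_same_trans (sm_bigcup sP mCA) _.
by apply: ae_same_bigcup => n; exact: sm_C.
Qed.

Lemma sm_set0 : \forall x \ae mu, ~ s set0 x.
Proof. by apply: (@sm_null set0 measurable0); apply: aeW => x []. Qed.

Lemma sm_setT : \forall x \ae mu, s setT x.
Proof.
have := sm_C sP measurable0; rewrite setC0 /ae_same.
by apply: filterS2 sm_set0 => x h [_]; exact.
Qed.

Lemma sm_bigcup_countable (I : countType) (A : I -> set T) :
  (forall q, measurable (A q)) ->
  ae_same mu (s (\bigcup_q A q)) (\bigcup_q s (A q)).
Proof.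
move=> mA; pose F n := if unpickle n is Some q then A q else set0.
have mF n : measurable (F n) by rewrite /F; case: unpickle.
have -> : \bigcup_q A q = \bigcup_n F n.
  apply/seteqP; split => [x [q _ Ax]|x [n _]].
    by exists (pickle q) => //; rewrite /F pickleK.
  by rewrite /F; case: unpickle => // q Ax; exists q.
have := sm_bigcup sP mF; rewrite /ae_same; apply: filterS2 sm_set0 => x s0 ->.
split => [[n _]|[q _ sA]]; last by exists (pickle q) => //; rewrite /F pickleK.
by rewrite /F; case: unpickle => [q sA|/s0//]; exists q.
Qed.

End set_morphism.

(** * Images of functions under a set morphism *)

Section transports.
Context d (T : measurableType d) d' (X : measurableType d') (R : realType).
Variables (nu : {measure set T -> \bar R}) (mu : {measure set X -> \bar R}).
Variable s : set T -> set X.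

(** The function [h] on [X] is the image of [f] under the set morphism [s]: this
    is how a morphism of measure algebras acts on functions that are only known
    up to null sets. *)
Definition transports dz (Z : measurableType dz) (f : T -> Z) (h : X -> Z) :=
  forall B, measurable B -> ae_same mu (h @^-1` B) (s (f @^-1` B)).

Hypothesis sP : set_morphism nu mu s.

Lemma transports_gen dz (Z : measurableType dz) (G : set (set Z)) f h :
  measurable = <<s G >> -> measurable_fun setT f -> measurable_fun setT h ->
  (forall B, G B -> ae_same mu (h @^-1` B) (s (f @^-1` B))) -> transports f h.
Proof.
move=> GE mf mh fh.
have mpf B : measurable B -> measurable (f @^-1` B).
  by move=> mB; rewrite -[_ @^-1` _]setTI; exact: mf.
pose H := [set B | measurable B /\ ae_same mu (h @^-1` B) (s (f @^-1` B))].
suff HH : measurable `<=` H by move=> B /HH[].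
rewrite GE; apply: smallest_sub; last first.
  by move=> B GB; split; [rewrite GE; exact: sub_sigma_algebra|exact: fh].
split.
- split => //; rewrite !preimage_set0; rewrite /ae_same; apply: filterS (sm_set0 sP) => x s0.
  by split.
- move=> B [mB sB]; rewrite setTD; split; first exact: measurableC.
  rewrite -2!preimage_setC; apply: ae_same_trans (ae_sameC sB) _.
  exact/ae_same_sym/(sm_C sP)/mpf.
- move=> F HF; have [mF sF] := all_and2 HF.
  split; first exact: bigcupT_measurable.
  rewrite !preimage_bigcup; apply: ae_same_trans (ae_same_bigcup sF) _.
  by apply/ae_same_sym/(sm_bigcup sP) => n; exact: mpf.
Qed.

Lemma transports_comp dz (Z : measurableType dz) dy (Y : measurableType dy)
    (j : Z -> Y) f h :
  measurable_fun setT j -> transports f h -> transports (j \o f) (j \o h).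
Proof.
move=> mj fh B mB; apply: (fh (j @^-1` B)).
by rewrite -[_ @^-1` _]setTI; exact: mj.
Qed.

Lemma transports_pair dz (Z : measurableType dz) dy (Y : measurableType dy)
    (f : T -> Z) (h : X -> Z) (g : T -> Y) (k : X -> Y) :
  measurable_fun setT f -> measurable_fun setT h ->
  measurable_fun setT g -> measurable_fun setT k ->
  transports f h -> transports g k ->
  transports (fun t => (f t, g t)) (fun x => (h x, k x)).
Proof.
move=> mf mh mg mk fh gk.
apply: (transports_gen (measurable_prod_measurableType Z Y)).
- exact: measurable_fun_pair.
- exact: measurable_fun_pair.
move=> _ [B mB [C mC <-]].
have E (V : Type) (u : V -> Z) (v : V -> Y) :
    (fun x => (u x, v x)) @^-1` (B `*` C) = (u @^-1` B) `&` (v @^-1` C) by [].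
rewrite !E; apply: ae_same_sym; apply: ae_same_trans (sm_I sP _ _) _.
- by rewrite -[_ @^-1` _]setTI; exact: mf.
- by rewrite -[_ @^-1` _]setTI; exact: mg.
by apply: ae_sameI; apply: ae_same_sym; [exact: fh|exact: gk].
Qed.

Lemma transports_ae_eq dz (Z : measurableType dz) (f f' : T -> Z) (h h' : X -> Z) :
  measurable_fun setT f -> measurable_fun setT f' ->
  (\forall t \ae nu, f t = f' t) -> (\forall x \ae mu, h x = h' x) ->
  transports f h -> transports f' h'.
Proof.
move=> mf mf' ff' hh' fh B mB; apply: (@ae_same_trans _ _ _ _ _ (h @^-1` B)).
  by rewrite /ae_same; apply: filterS hh' => x /= ->.
apply: ae_same_trans (fh _ mB) _; apply: (sm_ae_same sP).
- by rewrite -[_ @^-1` _]setTI; exact: mf.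
- by rewrite -[_ @^-1` _]setTI; exact: mf'.
- by rewrite /ae_same; apply: filterS ff' => t /= ->.
Qed.

Lemma transports_cst dz (Z : measurableType dz) (c : Z) :
  transports (cst c) (cst c).
Proof.
move=> B mB; rewrite !preimage_cst; case: ifPn => _.
  by rewrite /ae_same; apply: filterS (sm_setT sP) => x.
by rewrite /ae_same; apply: filterS (sm_set0 sP) => x.
Qed.


Lemma transports_rays (f : T -> R) (h : X -> R) :
  measurable_fun setT f -> measurable_fun setT h ->
  (forall r, ae_same mu [set x | r < h x] (s [set t | r < f t])) ->
  transports f h.
Proof.
move=> mf mh fh; apply: (transports_gen (RGenOInfty.measurableE R)) => //.
move=> _ [r ->].
have E V (u : V -> R) : u @^-1` `]r, +oo[%classic = [set x | r < u x].
  by apply/seteqP; split => x /=; rewrite in_itv/= andbT.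
by rewrite !E.
Qed.

End transports.

Lemma measurable_gt d (T : measurableType d) (R : realType) (u : T -> R) (r : R) :
  measurable_fun setT u -> measurable [set x | r < u x].
Proof.
move=> mu_; rewrite (_ : mkset _ = setT `&` u @^-1` `]r, +oo[%classic).
  by apply: mu_ => //; exact: measurable_itv.
by rewrite setTI; apply/seteqP; split => x /=; rewrite in_itv/= andbT.
Qed.

Lemma transports_gt d (T : measurableType d) d' (X : measurableType d')
    (R : realType) (mu : {measure set X -> \bar R}) (s : set T -> set X)
    (f : T -> R) (h : X -> R) :
  transports mu s f h ->
  forall r, ae_same mu [set x | r < h x] (s [set t | r < f t]).
Proof.
move=> fh r; have E V (u : V -> R) : [set x | r < u x] = u @^-1` `]r, +oo[%classic.
  by apply/seteqP; split => x /=; rewrite in_itv/= andbT.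
by rewrite (E X h) (E T f); apply: fh; exact: measurable_itv.
Qed.

Section transport_real.
Context d (T : measurableType d) d' (X : measurableType d') (R : realType).
Variables (nu : {measure set T -> \bar R}) (mu : {measure set X -> \bar R}).
Variable s : set T -> set X.
Hypothesis sP : set_morphism nu mu s.
Implicit Types (f g : T -> R) (h k : X -> R).

Lemma rat_gt_eq (a b : R) : (forall q : rat, (ratr q < a) <-> (ratr q < b)) -> a = b.
Proof.
wlog ab : a b / a < b.
  move=> wlg E; have [ab|ba|//] := ltgtP a b; first exact: wlg.
  by apply/esym; apply: wlg => // q; split => /E.
move=> E; have [q] := rat_in_itvoo ab; rewrite in_itv/= => /andP[aq qb].
by have := (E q).2 qb; rewrite ltNge (ltW aq).
Qed.

(** A function is determined almost everywhere by countably many of its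
    super-level sets. *)
Lemma transports_uniq f h k :
  transports mu s f h -> transports mu s f k -> \forall x \ae mu, h x = k x.
Proof.
move=> fh fk.
have : \forall x \ae mu, forall q : rat, (ratr q < h x) <-> (ratr q < k x).
  apply: ae_forall_countable => q.
  exact: ae_same_trans (transports_gt fh _) (ae_same_sym (transports_gt fk _)).
by apply: filterS => x /rat_gt_eq.
Qed.

(** The layer-cake formula: [f] is rebuilt from its super-level sets at rational
    heights, so that only countably many null sets are involved. *)
Definition push f (x : X) : R :=
  fine (ereal_sup [set (ratr q)%:E | q in [set q : rat | s [set t | ratr q < f t] x]]).

Section push.
Variable f : T -> R.
Hypothesis mf : measurable_fun setT f.

Let P x : \bar R := ereal_sup [set (ratr q)%:E | q in [set q : rat | s [set t | ratr q < f t] x]].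

Let msup r : measurable [set t | r < f t].
Proof. exact: measurable_gt. Qed.

Let P_gt (r : R) : [set x | (r%:E < P x)%E] =
  \bigcup_q (if r < ratr q then s [set t | ratr q < f t] else set0).
Proof.
apply/seteqP; split => [x /= /ereal_sup_gt[_ [q /= sq <-]]|x [q _]].
  by rewrite lte_fin => rq; exists q => //; rewrite rq.
case: ifPn => // rq sq; apply: (@lt_le_trans _ _ (ratr q)%:E).
  by rewrite lte_fin.
by apply: ereal_sup_ubound; exists q.
Qed.

Let mP : measurable_fun setT P.
Proof.
apply: (measurability _ (ErealGenOInfty.measurableE R)) => // _ [_ [r ->] <-].
rewrite setTI (_ : _ @^-1` _ = [set x | (r%:E < P x)%E]).
  rewrite P_gt; apply: bigcupT_measurable_rat => q; case: ifPn => // _.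
  exact: (sm_measurable sP).
by apply/seteqP; split => x /=; rewrite in_itv/= andbT.
Qed.

Lemma measurable_push : measurable_fun setT (push f).
Proof. by apply: measurableT_comp => //; exact: measurable_fun_fine. Qed.

Let P_ae r : ae_same mu [set x | (r%:E < P x)%E] (s [set t | r < f t]).
Proof.
have -> : [set t | r < f t] =
    \bigcup_q (if r < ratr q then [set t | ratr q < f t] else set0).
  apply/seteqP; split => [t /= rt|t [q _]].
    have [q] := rat_in_itvoo rt; rewrite in_itv/= => /andP[rq qt].
    by exists q => //; rewrite rq.
  by case: ifPn => //= rq; exact: lt_trans.
apply: ae_same_trans (ae_same_sym (sm_bigcup_countable sP _)); last first.
  by move=> q; case: ifPn.
rewrite P_gt; have := sm_set0 sP; rewrite /ae_same; apply: filterS => x s0.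
by split => -[q _ h]; exists q => //; case: ifPn h => // _ /s0.
Qed.

Let P_fin : \forall x \ae mu, P x \is a fin_num.
Proof.
have up : \forall x \ae mu, ~ forall n : nat, (n%:R%:E < P x)%E.
  have E : \bigcap_n [set t | n%:R < f t] = set0.
    rewrite -subset0 => t /= h; have := h (Num.bound `|f t|) I.
    by rewrite /= ltNge => /negP; apply; rewrite (le_trans (ler_norm _))// ltW// archi_boundP.
  have := sm_bigcap sP (fun n => msup n%:R); rewrite E.
  have := ae_foralln (fun n => P_ae n%:R); rewrite /ae_same.
  apply: filterS3 (sm_set0 sP) => x s0 Pn sn h; apply/s0/sn => n _.
  exact/(Pn n)/h.
have lo : \forall x \ae mu, exists n : nat, ((- n%:R)%:E < P x)%E.
  have E : \bigcup_n [set t | - n%:R < f t] = setT.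
    rewrite -subTset => t /= _; exists (Num.bound `|f t|) => //=.
    rewrite ltrNl (le_lt_trans _ (archi_boundP (normr_ge0 _)))//.
    by rewrite (le_trans (ler_norm _))// normrN.
  have := sm_bigcup sP (fun n => msup (- n%:R)); rewrite E.
  have := ae_foralln (fun n => P_ae (- n%:R)); rewrite /ae_same.
  apply: filterS3 (sm_setT sP) => x sT Pn sn; have [n _ ?] := sn.1 sT.
  by exists n; apply/(Pn n).
apply: filterS2 up lo => x up [n lo]; rewrite fin_numE; apply/andP; split.
  by rewrite gt_eqF// (lt_trans _ lo)// ltNyr.
by apply/negP => /eqP Py; apply: up => m; rewrite Py ltry.
Qed.

Lemma transports_push : transports mu s f (push f).
Proof.
apply: (transports_rays sP) => //; first exact: measurable_push.
move=> r; apply: ae_same_trans (P_ae r); rewrite /ae_same.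
by apply: filterS P_fin => x Px /=; rewrite -lte_fin /push fineK.
Qed.

End push.
End transport_real.

Section transports_Lnorm.
Context d (T : measurableType d) d' (X : measurableType d') (R : realType).
Variables (nu : {measure set T -> \bar R}) (mu : {measure set X -> \bar R}).
Variable s : set T -> set X.
Hypothesis sP : set_morphism nu mu s.

(** [f] and its image [h] have the same distribution. *)
Lemma transports_integral (f : T -> R) (h : X -> R) (k : R -> \bar R) :
  measurable_fun setT f -> measurable_fun setT h -> transports mu s f h ->
  measurable_fun setT k -> (forall y, 0 <= k y)%E ->
  (\int[mu]_x k (h x) = \int[nu]_t k (f t))%E.
Proof.
move=> mf mh fh mk k0.
have := ge0_integral_pushforward mh mu measurableT mk (fun y _ => k0 y).
have := ge0_integral_pushforward mf nu measurableT mk (fun y _ => k0 y).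
rewrite !preimage_setT => <- <-; apply: eq_measure_integral => B mB _.
rewrite /= /pushforward -(sm_measure sP); last first.
  by rewrite -[_ @^-1` _]setTI; exact: mf.
apply: measure_ae_same; last exact: fh.
  by rewrite -[_ @^-1` _]setTI; exact: mh.
by apply: (sm_measurable sP); rewrite -[_ @^-1` _]setTI; exact: mf.
Qed.

Lemma transports_Lnorm (p : R) (f : T -> R) (h : X -> R) :
  measurable_fun setT f -> measurable_fun setT h -> transports mu s f h ->
  Lnorm mu p%:E (EFin \o h) = Lnorm nu p%:E (EFin \o f).
Proof.
move=> mf mh fh; rewrite unlock /Lnorm; congr (_ `^ _)%E.
apply: (@transports_integral f h (fun y => `|y%:E| `^ p)%E) => //.
  apply/measurable_EFinP.
  by apply: (@measurableT_comp _ _ _ _ _ _ (@powR R ^~ p)) => //; exact: measurableT_comp.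
by move=> y; exact: poweR_ge0.
Qed.

Lemma transports_Lfun (p : R) (f : T -> R) (h : X -> R) :
  f \in Lfun nu p%:E -> measurable_fun setT h -> transports mu s f h ->
  h \in Lfun mu p%:E.
Proof.
move=> /andP[]; rewrite !inE /= => mf ff mh fh; apply/andP; rewrite !inE.
by split => //=; rewrite /finite_norm (@transports_Lnorm _ f).
Qed.

End transports_Lnorm.

(** A set morphism is injective up to null sets because it preserves the measure,
    so that any choice of preimages is automatically a morphism. *)
Lemma set_morphism_inverse d (T : measurableType d) d' (X : measurableType d')
    (R : realType) (nu : {measure set T -> \bar R}) (mu : {measure set X -> \bar R})
    (s : set T -> set X) : set_morphism nu mu s ->
  (forall B, measurable B -> exists2 A, measurable A & ae_same mu (s A) B) ->
  exists t, set_morphism mu nu t /\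
    forall B, measurable B -> ae_same mu (s (t B)) B.
Proof.
move=> sP surj.
have /choice[t tP] : forall B, exists A, measurable B ->
    measurable A /\ ae_same mu (s A) B.
  move=> B; have [mB|nB] := pselect (measurable B); last by exists set0.
  by have [A mA sA] := surj B mB; exists A.
have mt B (mB : measurable B) : measurable (t B) := (tP B mB).1.
have st B (mB : measurable B) : ae_same mu (s (t B)) B := (tP B mB).2.
exists t; split => //; split; first exact: mt.
- move=> B mB; have mtB := mt B mB; rewrite -(sm_measure sP)//.
  by apply: measure_ae_same; [exact: (sm_measurable sP)| |exact: st].
- move=> B mB; have mCB := measurableC mB; have mtB := mt B mB.
  apply: (sm_ae_same_inj sP (mt _ mCB) (measurableC mtB)).
  apply: ae_same_trans (st _ mCB) _; apply: ae_same_sym.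
  by apply: ae_same_trans (sm_C sP mtB) _; apply: ae_sameC; exact: st.
- move=> B mB; have mtB n := mt _ (mB n).
  have mUB := bigcupT_measurable _ mB.
  apply: (sm_ae_same_inj sP (mt _ mUB) (bigcupT_measurable _ mtB)).
  apply: ae_same_trans (st _ mUB) _; apply: ae_same_sym.
  by apply: ae_same_trans (sm_bigcup sP mtB) _; apply: ae_same_bigcup => n; exact: st.
Qed.

(** * Set morphisms acting on L^p *)

Section push_Lp.
Context d (T : measurableType d) d' (X : measurableType d') (R : realType).
Variables (nu : probability T R) (mu : probability X R).
Variable s : set T -> set X.
Hypothesis sP : set_morphism nu mu s.
Variables (p : R) (p1 : (1 <= p%:E)%E).
Implicit Types F G H : LspaceType nu p1.

Definition push_Lp F : LspaceType mu p1 := Lclass mu p1 (push s F).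

Lemma push_LpE F : \forall x \ae mu, push_Lp F x = push s F x.
Proof.
have mF := measurable_aeEqMfun F.
have := @LclassE _ _ _ mu _ p1 (push s F)
  (transports_Lfun sP (LspaceP F) (measurable_push sP mF) (transports_push sP mF)).
by apply: filterS => x /(_ I).
Qed.

Lemma push_Lp_transports F : transports mu s F (push_Lp F).
Proof.
have mF := measurable_aeEqMfun F.
apply: (transports_ae_eq sP mF mF _ _ (transports_push sP mF)); first exact: aeW.
by apply: filterS (push_LpE F) => x ->.
Qed.

(** The tool for every identity below: to compute the image of [F] it suffices to
    exhibit a function with the right inverse images. *)
Lemma push_Lp_uniq F (H : LspaceType mu p1) : transports mu s F H -> push_Lp F = H.
Proof.
by move=> FH; apply: Lspace_aeP; exact: transports_uniq (push_Lp_transports F) FH.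
Qed.

(** Covers the linear and the lattice operations at once, as all are computed
    pointwise. *)
Lemma push_Lp_binary (j : R * R -> R) F G H :
  measurable_fun setT j -> (\forall t \ae nu, H t = j (F t, G t)) ->
  \forall x \ae mu, push_Lp H x = j (push_Lp F x, push_Lp G x).
Proof.
move=> mj HFG.
have [mF mG mH] := And3 (measurable_aeEqMfun F) (measurable_aeEqMfun G) (measurable_aeEqMfun H).
have [mF' mG'] := conj (measurable_aeEqMfun (push_Lp F)) (measurable_aeEqMfun (push_Lp G)).
apply: (transports_uniq (push_Lp_transports H)).
apply: (transports_ae_eq sP (f := fun t => j (F t, G t))
                            (h := fun x => j (push_Lp F x, push_Lp G x))) => //.
- by apply: measurableT_comp => //; exact: measurable_fun_pair.
- by apply: filterS HFG.
- exact: aeW.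
apply: (transports_comp (j := j) mj).
by apply: (transports_pair sP) => //; exact: push_Lp_transports.
Qed.

Lemma push_Lp_norm F : `|push_Lp F| = `|F|.
Proof.
apply: EFin_inj; rewrite [LHS]Lspace_normE [RHS]Lspace_normE.
apply: (transports_Lnorm sP); [exact: measurable_aeEqMfun..|].
exact: push_Lp_transports.
Qed.

Lemma push_Lp_linear : linear push_Lp.
Proof.
move=> a F G; apply: Lspace_aeP.
apply: filterS3 (@push_Lp_binary (fun z => a * z.1 + z.2) F G (a *: F + G) _ _)
  (Lspace_addE (a *: push_Lp F) (push_Lp G)) (Lspace_scaleE a (push_Lp F)).
- by move=> x /= -> -> ->.
- apply: measurable_funD => //; apply: measurable_funM => //.
- apply: filterS2 (Lspace_addE (a *: F) G) (Lspace_scaleE a F).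
  by move=> x /= -> ->.
Qed.

Lemma push_Lp_meet : Order.meet_morphism push_Lp.
Proof.
move=> F G; apply: Lspace_aeP.
apply: filterS2 (@push_Lp_binary (fun z => Num.min z.1 z.2) F G (F `&` G)%O _ _)
  (Lspace_meetE (push_Lp F) (push_Lp G)).
- by move=> x /= -> ->.
- exact: measurable_minr.
- by apply: filterS (Lspace_meetE F G) => x /= ->.
Qed.

Lemma push_Lp_join : Order.join_morphism push_Lp.
Proof.
move=> F G; apply: Lspace_aeP.
apply: filterS2 (@push_Lp_binary (fun z => Num.max z.1 z.2) F G (F `|` G)%O _ _)
  (Lspace_joinE (push_Lp F) (push_Lp G)).
- by move=> x /= -> ->.
- exact: measurable_maxr.
- by apply: filterS (Lspace_joinE F G) => x /= ->.
Qed.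

Lemma push_Lp_cst c : push_Lp (Lcst nu p1 c) = Lcst mu p1 c.
Proof.
apply: push_Lp_uniq.
apply: (transports_ae_eq sP (f := cst c) (h := cst c)).
- exact: measurable_cst.
- exact: measurable_aeEqMfun.
- by apply: filterS (Lcst_ae nu p1 c) => t /(_ I) ->.
- by apply: filterS (Lcst_ae mu p1 c) => t /(_ I) ->.
exact: (transports_cst sP).
Qed.

Lemma push_Lp_inj : injective push_Lp.
Proof.
move=> F G FG; apply/eqP; rewrite -subr_eq0 -normr_eq0 -push_Lp_norm.
have -> : push_Lp (F - G) = push_Lp F - push_Lp G.
  by rewrite -scaleN1r addrC push_Lp_linear scaleN1r addrC.
by rewrite FG subrr normr0.
Qed.

Lemma push_Lp_iso :
  (forall B, measurable B -> exists2 A, measurable A & ae_same mu (s A) B) ->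
  isometric_lattice_iso push_Lp.
Proof.
move=> surj; split.
- exact: push_Lp_linear.
- exact: push_Lp_norm.
- have [t [tP st]] := set_morphism_inverse sP surj.
  have preim (H : LspaceType mu p1) : exists F, push_Lp F = H.
    have mH := measurable_aeEqMfun H.
    have mt := measurable_push tP mH.
    have Ht := transports_push tP mH.
    have tL := transports_Lfun tP (LspaceP H) mt Ht.
    exists (Lclass nu p1 (push t H)); apply: push_Lp_uniq.
    apply: (transports_ae_eq sP (f := push t H) (h := H)) => //.
    + exact: measurable_aeEqMfun.
    + by apply: filterS (LclassE p1 tL) => x /(_ I) ->.
    + exact: aeW.
    move=> B mB; have mHB : measurable ((H : X -> R) @^-1` B).
      by rewrite -[_ @^-1` _]setTI; exact: mH.
    apply: ae_same_trans (ae_same_sym (st _ mHB)) _; apply: (sm_ae_same sP).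
    * exact: (sm_measurable tP).
    * by rewrite -[_ @^-1` _]setTI; exact: mt.
    * exact/ae_same_sym/Ht.
  have [g gP] := choice preim; exists g => //.
  by move=> F; apply: push_Lp_inj.
- exact: push_Lp_meet.
- exact: push_Lp_join.
Qed.

End push_Lp.

Lemma push_Lp_Lincl d (T : measurableType d) d' (X : measurableType d')
    (R : realType) (nu : probability T R) (mu : probability X R) s (p q : R)
    (p1 : (1 <= p%:E)%E) (q1 : (1 <= q%:E)%E) (F : LspaceType nu q1) :
  set_morphism nu mu s -> p <= q ->
  push_Lp mu s (Lincl p1 F) = Lincl p1 (push_Lp mu s F).
Proof.
move=> sP pq; apply: (push_Lp_uniq sP).
apply: (transports_ae_eq sP (f := F) (h := push_Lp mu s F)).
- exact: measurable_aeEqMfun.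
- exact: measurable_aeEqMfun.
- have := @Lincl_ae _ _ _ nu _ _ p1 q1 F (fin_num_measure _ _ measurableT) _.
  by rewrite lee_fin => /(_ pq); apply: filterS => x /(_ I) ->.
- have := @Lincl_ae _ _ _ mu _ _ p1 q1 (push_Lp mu s F) (fin_num_measure _ _ measurableT) _.
  by rewrite lee_fin => /(_ pq); apply: filterS => x /(_ I) ->.
exact: push_Lp_transports.
Qed.

(** * Essentially bounded functions *)

Section bounded_functions.
Context d (X : measurableType d) (R : realType) (mu : probability X R).
Implicit Types f : X -> R.

Let mu_gt0 : (0 < mu [set: X])%E.
Proof. by rewrite probability_setT lte01. Qed.

Lemma Linfty_bounded f c : measurable_fun setT f ->
  (\forall x \ae mu, `|f x| <= c) -> f \in Lfun mu +oo%E.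
Proof.
move=> mf fc; apply/andP; rewrite !inE; split => //=.
rewrite /finite_norm unlock /Lnorm ifT; last exact: mu_gt0.
rewrite ess_supEae.
apply: (@le_lt_trans _ _ c%:E); last exact: ltry.
by apply: ereal_inf_lbound => /=; apply: filterS fc => x; rewrite lee_fin.
Qed.

Lemma bounded_Linfty f : f \in Lfun mu +oo%E ->
  exists c, \forall x \ae mu, `|f x| <= c.
Proof.
move=> /andP[_]; rewrite inE /=.
rewrite /finite_norm unlock /Lnorm ifT; last exact: mu_gt0.
rewrite ess_supEae.
move=> /ereal_inf_lt[[r| |]//= fr _]; first by exists r; apply: filterS fr => x; rewrite lee_fin.
by exists 0; apply: filterS fr => x; rewrite leeNy_eq.
Qed.

Lemma Lfun_bounded f c p : (1 <= p%:E)%E -> measurable_fun setT f ->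
  (\forall x \ae mu, `|f x| <= c) -> f \in Lfun mu p%:E.
Proof.
move=> p1 mf fc.
have := @Lfun_subset _ _ _ mu p%:E +oo%E p1 (leey 1) (fin_num_measure _ _ measurableT) (leey _).
by apply; exact: Linfty_bounded fc.
Qed.

End bounded_functions.

(** * The set morphism of a lattice automorphism *)

Section Lindic.
Context d (X : measurableType d) (R : realType) (mu : probability X R).
Variables (p : R) (p1 : (1 <= p%:E)%E).
Implicit Types A B : set X.

Definition Lindic A : LspaceType mu p1 := Lclass mu p1 \1_A.

Lemma Lindic_ae A : measurable A -> \forall x \ae mu, Lindic A x = \1_A x.
Proof.
move=> mA; have : (\1_A : X -> R) \in Lfun mu p%:E.
  apply: (@Lfun_bounded _ _ _ _ _ 1) => //.
  by apply: aeW => x; rewrite indicE; case: (_ \in _); rewrite ?normr1 ?normr0.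
by move=> /(LclassE p1); apply: filterS => x /(_ I).
Qed.

Lemma Lcst_aeE c : \forall x \ae mu, Lcst mu p1 c x = c.
Proof. by apply: filterS (Lcst_ae mu p1 c) => x /(_ I). Qed.

Lemma Lspace_subE (F G : LspaceType mu p1) : \forall x \ae mu, (F - G) x = F x - G x.
Proof.
by apply: filterS2 (Lspace_addE F (- G)) (Lspace_oppE G) => x -> ->.
Qed.

Lemma Lindic_inj A B : measurable A -> measurable B ->
  Lindic A = Lindic B -> ae_same mu A B.
Proof.
move=> mA mB AB; rewrite /ae_same.
apply: filterS2 (Lindic_ae mA) (Lindic_ae mB) => x; rewrite AB => ->.
rewrite !indicE => /eqP; rewrite eqr_nat.
case: (pselect (A x)) => Ax; case: (pselect (B x)) => Bx.
- by [].
- by rewrite (memNset Bx) (mem_set Ax).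
- by rewrite (memNset Ax) (mem_set Bx).
- by [].
Qed.

Lemma Lindic_norm A : measurable A -> mu A = (`|Lindic A|%:E `^ p)%E.
Proof.
move=> mA; have p0 : p != 0 by rewrite gt_eqF// (lt_le_trans ltr01)// -lee_fin.
rewrite [`|_|%:E]Lspace_normE powR_Lnorm//.
have mI : measurable_fun setT (Lindic A : X -> R) by exact: measurable_aeEqMfun.
transitivity (\int[mu]_x (\1_A x)%:E)%E; first by rewrite integral_indic// setIT.
apply: ae_eq_integral => //.
- by apply/measurable_EFinP.
- apply/measurable_EFinP.
  by apply: (@measurableT_comp _ _ _ _ _ _ (@powR R ^~ p)) => //; exact: measurableT_comp.
apply: filterS (Lindic_ae mA) => x E _ /=; rewrite E indicE.
by case: (_ \in _); rewrite /= ?normr1 ?powR1// normr0 powR0.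
Qed.

(** Stated pointwise; as the two lemmas below show, the suprema in question are
    determined by the order, hence preserved by lattice automorphisms. *)
Definition is_aesup (u : nat -> LspaceType mu p1) (w : LspaceType mu p1) :=
  \forall x \ae mu, (forall n, u n x <= w x) /\
    forall e, 0 < e -> exists n, w x - e < u n x.

Lemma aesup_le u w : is_aesup u w -> forall n, (u n <= w)%O.
Proof. by move=> uw n; apply/asboolP; apply: filterS uw => x []. Qed.

Lemma aesup_least u w z : is_aesup u w -> (forall n, (u n <= z)%O) -> (w <= z)%O.
Proof.
move=> uw uz; apply/asboolP.
have : \forall x \ae mu, forall n, u n x <= z x.
  by apply: ae_foralln => n; exact/asboolP/uz.
apply: filterS2 uw => x [_ h] uzx; apply/ler_addgt0Pr => e /h[n].
by rewrite ltrBlDr => /ltW/le_trans; apply; rewrite lerD2r.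
Qed.

Definition ramp (F : LspaceType mu p1) r n : LspaceType mu p1 :=
  Order.meet (Lcst mu p1 1)
    (Order.join (0 : LspaceType mu p1) (n%:R *: (F - Lcst mu p1 r))).

(** Super-level sets are suprema of lattice expressions in the function, which
    is why lattice automorphisms act on them. *)
Lemma aesup_gt (F : LspaceType mu p1) r :
  is_aesup (ramp F r) (Lindic [set x | r < F x]).
Proof.
have mF := measurable_gt r (measurable_aeEqMfun F).
pose u := ramp F r.
have uE n : \forall x \ae mu, u n x = Num.min 1 (Num.max 0 (n%:R * (F x - r))).
  pose z : LspaceType mu p1 := 0; pose v : LspaceType mu p1 := n%:R *: (F - Lcst mu p1 r); near=> x.
  rewrite (near (Lspace_meetE (Lcst mu p1 1) (Order.join z v)) x)//.
  rewrite (near (Lcst_aeE 1) x)// (near (Lspace_joinE z v) x)//.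
  rewrite (near (Lspace_zeroE mu p1) x)// (near (Lspace_scaleE n%:R (F - Lcst mu p1 r)) x)//.
  by rewrite (near (Lspace_subE F (Lcst mu p1 r)) x)// (near (Lcst_aeE r) x).
apply: filterS2 (ae_foralln uE) (Lindic_ae mF) => x; rewrite /u => uEx ->.
rewrite indicE.
have [rF|rF] := ltP r (F x); last first.
  rewrite memNset /=; last by rewrite ltNge rF.
  split=> [n|e e0].
    rewrite uEx (max_idPl _) ?ge_min ?lexx ?orbT//.
    by rewrite mulr_ge0_le0// subr_le0.
  by exists 0%N; rewrite uEx mul0r maxxx min_r// sub0r oppr_lt0.
rewrite mem_set//=; split=> [n|e e0]; first by rewrite uEx ge_min lexx.
have Fr0 : 0 < F x - r by rewrite subr_gt0.
exists (Num.bound (F x - r)^-1); rewrite uEx min_l ?ltrBlDr ?ltrDl//.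
rewrite le_max; apply/orP; right; rewrite -ler_pdivrMr// mul1r ltW//.
by rewrite archi_boundP// invr_ge0 ltW.
Unshelve. all: by end_near. Qed.

End Lindic.

Section automorphism.
Context d (X : measurableType d) (R : realType) (mu : probability X R).
Variables (p : R) (p1 : (1 <= p%:E)%E).
Variable S : LspaceType mu p1 -> LspaceType mu p1.
Hypothesis SP : isometric_lattice_aut_cst S.
Local Notation ind := (@Lindic _ _ _ mu p p1).
Local Notation cc := (@Lcst _ _ _ mu p%:E p1).

Let Slin : linear S. Proof. by have [[]] := SP. Qed.
Let Sinj : injective S. Proof. by have [[_ _ /bij_inj]] := SP. Qed.
Let Smeet : Order.meet_morphism S. Proof. by have [[]] := SP. Qed.
Let Sjoin : Order.join_morphism S. Proof. by have [[]] := SP. Qed.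
Let Scst c : S (cc c) = cc c. Proof. by have [_] := SP. Qed.

Let S0 : S 0 = 0.
Proof. by have := Slin (-1) 0 0; rewrite scaleN1r oppr0 addr0 scaleN1r addNr. Qed.

Let SB F G : S (F - G) = S F - S G.
Proof. by rewrite -scaleN1r addrC Slin scaleN1r addrC. Qed.

Let SZ a F : S (a *: F) = a *: S F.
Proof. by rewrite -[a *: F]addr0 Slin S0 addr0. Qed.

Let Sle F G : (S F <= S G)%O = (F <= G)%O.
Proof. by rewrite !leEmeet -Smeet (inj_eq Sinj). Qed.

Let S_aesup u w v : is_aesup u w -> is_aesup (S \o u) v -> S w = v.
Proof.
move=> uw uv; have [[_ _ [S' _ SK] _ _] _] := SP.
apply/le_anti/andP; split.
  rewrite -[v]SK Sle; apply: (aesup_least uw) => n.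
  by rewrite -Sle SK; exact: (aesup_le uv).
by apply: (aesup_least uv) => n /=; rewrite Sle; exact: (aesup_le uw).
Qed.

(* Any threshold in ]0, 1[ would do, the function being an indicator. *)
Definition indic_image (A : set X) : set X := [set x | 2^-1 < S (ind A) x].

Lemma measurable_indic_image A : measurable (indic_image A).
Proof. by apply: measurable_gt; exact: measurable_aeEqMfun. Qed.

(** Indicators are the components of the constant function 1, a notion that only
    involves the lattice operations and the constants. *)
Lemma S_indic A : measurable A -> S (ind A) = ind (indic_image A).
Proof.
move=> mA; have E : (ind A `&` (cc 1 - ind A))%O = 0.
  apply: Lspace_aeP; near=> x.
  rewrite (near (Lspace_meetE (ind A) (cc 1 - ind A)) x)//.
  rewrite (near (Lspace_zeroE mu p1) x)// (near (Lspace_subE (cc 1) (ind A)) x)//.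
  rewrite (near (Lcst_aeE mu p1 1) x)// (near (Lindic_ae mu p1 mA) x)// indicE.
  by case: (_ \in _); rewrite /= ?subrr ?subr0 /Num.min ?ltr10 ?ltr01.
have : (S (ind A) `&` (cc 1 - S (ind A)))%O = 0 by rewrite -(Scst 1) -SB -Smeet E S0.
move=> E1; apply: Lspace_aeP; near=> x.
have : Num.min (S (ind A) x) (1 - S (ind A) x) = 0.
  rewrite -[X in Num.min _ (X - _)](near (Lcst_aeE mu p1 1) x)//.
  rewrite -(near (Lspace_subE (cc 1) (S (ind A))) x)//.
  rewrite -(near (Lspace_meetE (S (ind A)) (cc 1 - S (ind A))) x)//.
  rewrite (_ : Lspace_meet _ _ = 0); last exact: E1.
  by rewrite (near (Lspace_zeroE mu p1) x).
rewrite (near (Lindic_ae mu p1 (measurable_indic_image A)) x)// indicE.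
rewrite /Num.min; case: ifPn => _ h.
  have nA : ~ indic_image A x.
    by rewrite /indic_image /= h; apply/negP; rewrite -leNgt invr_ge0 ler0n.
  by rewrite h memNset.
have {}h : S (ind A) x = 1 by apply/esym/eqP; rewrite -subr_eq0 h.
have Ax : indic_image A x by rewrite /indic_image /= h invf_lt1 ?ltr1n.
by rewrite h mem_set.
Unshelve. all: by end_near. Qed.

Lemma indic_image_gt F r :
  ae_same mu [set x | r < S F x] (indic_image [set x | r < F x]).
Proof.
have mF := measurable_aeEqMfun F; have mSF := measurable_aeEqMfun (S F).
apply: (@Lindic_inj _ _ _ mu p p1); [exact: measurable_gt|exact: measurable_indic_image|].
rewrite -S_indic; last exact: measurable_gt.
apply/esym/(S_aesup (aesup_gt F r)).
have -> : S \o ramp F r = ramp (S F) r.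
  by apply/funext => n; rewrite /ramp /= Smeet Sjoin SZ SB S0 !Scst.
exact: aesup_gt.
Qed.

Lemma indic_image_morphism : set_morphism mu mu indic_image.
Proof.
split => [A mA|A mA|A mA|A mA].
- exact: measurable_indic_image.
- have [[_ Siso _ _ _] _] := SP.
  have mi := measurable_indic_image A.
  apply: etrans (esym (Lindic_norm mu p1 mA)); rewrite -Siso S_indic//.
  exact: (Lindic_norm mu p1 mi).
- have mCA := measurableC mA.
  apply: (@Lindic_inj _ _ _ mu p p1); first exact: measurable_indic_image.
    exact/measurableC/measurable_indic_image.
  have E B : measurable B -> ind (~` B) = cc 1 - ind B.
    move=> mB; have mCB := measurableC mB; apply: Lspace_aeP; near=> x.
    rewrite (near (Lspace_subE (cc 1) (ind B)) x)// (near (Lcst_aeE mu p1 1) x)//.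
    rewrite (near (Lindic_ae mu p1 mB) x)// (near (Lindic_ae mu p1 mCB) x)//.
    by rewrite !indicE in_setC; case: (x \in B); rewrite /= ?subrr ?subr0.
  rewrite -S_indic// !E//; last exact: measurable_indic_image.
  by rewrite SB Scst -S_indic.
- have mU := bigcupT_measurable _ mA.
  have mi n := measurable_indic_image (A n).
  apply: (@Lindic_inj _ _ _ mu p p1); first exact: measurable_indic_image.
    exact: bigcupT_measurable.
  rewrite -S_indic//.
  have sup_ind (B : (set X)^nat) : (forall n, measurable (B n)) ->
      is_aesup (fun n => ind (B n)) (ind (\bigcup_n B n)).
    move=> mB; have mUB := bigcupT_measurable _ mB.
    apply: filterS2 (ae_foralln (fun n => Lindic_ae mu p1 (mB n))) (Lindic_ae mu p1 mUB).
    move=> x Bx ->; split=> [n|e e0]; rewrite ?Bx !indicE.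
      have [Bnx|nBnx] := pselect (B n x); last by rewrite (memNset nBnx) ler0n.
      by rewrite [_ \in \bigcup__ _]mem_set ?ler_nat ?leq_b1//; exists n.
    have [[n _ Bnx]|nUx] := pselect ((\bigcup_n B n) x).
      exists n; rewrite Bx indicE (mem_set Bnx) mem_set; last by exists n.
      by rewrite ltrBlDr ltrDl.
    exists 0%N; rewrite Bx indicE (memNset nUx) sub0r (lt_le_trans (y := 0))//.
    by rewrite oppr_lt0.
  apply: (S_aesup (sup_ind _ mA)).
  rewrite (_ : S \o _ = fun n => ind (indic_image (A n))); first exact: sup_ind.
  by apply/funext => n /=; rewrite S_indic.
Unshelve. all: by end_near. Qed.

Lemma indic_image_transports (F : LspaceType mu p1) : transports mu indic_image F (S F).
Proof.
apply: (transports_rays indic_image_morphism).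
- exact: measurable_aeEqMfun.
- exact: measurable_aeEqMfun.
- exact: indic_image_gt.
Qed.

Lemma indic_image_surj B : measurable B ->
  exists2 A, measurable A & ae_same mu (indic_image A) B.
Proof.
move=> mB; have [[_ _ [S' _ SK] _ _] _] := SP.
have mA := measurable_gt 2^-1 (measurable_aeEqMfun (S' (ind B))).
exists [set x | 2^-1 < S' (ind B) x] => //.
apply: ae_same_trans (ae_same_sym (indic_image_gt _ _)) _; rewrite SK /ae_same.
apply: filterS (Lindic_ae mu p1 mB) => x /= ->; rewrite indicE.
have [Bx|nBx] := pselect (B x).
  by rewrite mem_set// invf_lt1 ?ltr1n.
by rewrite memNset//; split => //; rewrite ltNge invr_ge0 ler0n.
Qed.

End automorphism.

(** * Natural extensions to all L^p *)

Section natural_extension_exists.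
Context d (X : measurableType d) (R : realType) (mu : probability X R).
Variables (p0 : R) (p01 : (1 <= p0%:E)%E).
Variable S0 : LspaceType mu p01 -> LspaceType mu p01.
Hypothesis S0P : isometric_lattice_aut_cst S0.

(** The same bounded function represents all the images, whatever the exponent. *)
Lemma push_Lp_Linfty s (F : LspaceType mu (leey 1)) : set_morphism mu mu s ->
  exists H : LspaceType mu (leey 1), forall (p : R) (p1 : (1 <= p%:E)%E),
    push_Lp mu s (Lincl p1 F) = Lincl p1 H.
Proof.
move=> sP; have [c Fc] := bounded_Linfty (LspaceP F).
have mF := measurable_aeEqMfun F; have mh := measurable_push sP mF.
have Fh := transports_push sP mF.
have hc : \forall x \ae mu, `|push s F x| <= c.
  pose nrm (r : R) : R := `|r|.
  have mabs : measurable_fun setT nrm by exact: normr_measurable.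
  have mnF : measurable_fun setT (nrm \o F) by exact: measurableT_comp.
  have := transports_gt (transports_comp mabs Fh) c.
  have N : \forall x \ae mu, ~ [set x | c < `|F x|] x.
    by apply: filterS Fc => x; rewrite /= leNgt => /negP.
  have := sm_null sP (measurable_gt c mnF) N; apply: filterS2 => x sx E.
  by rewrite leNgt; apply/negP => /E.
have hL := Linfty_bounded mh hc.
exists (Lclass mu (leey 1) (push s F)) => p p1; apply: (push_Lp_uniq sP).
have hLp := Lfun_bounded p1 mh hc.
have FLp := Lfun_bounded p1 mF Fc.
apply: (transports_ae_eq sP (f := F) (h := push s F)) => //.
- by apply: filterS (LclassE p1 FLp) => x /(_ I) ->.
have kL : (Lclass mu (leey 1) (push s F) : X -> R) \in Lfun mu p%:E.
  apply: (Lfun_bounded (c := c)) => //; first exact: measurable_aeEqMfun.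
  by apply: filterS2 (LclassE (leey 1) hL) hc => x /(_ I) ->.
by apply: filterS2 (LclassE p1 kL) (LclassE (leey 1) hL) => x /(_ I) -> /(_ I) ->.
Qed.

(** An isometric lattice automorphism fixing the constants is determined by its
    set morphism, which it shares with all its natural extensions. *)
Lemma natural_extension_push (p : R) (p1 : (1 <= p%:E)%E) :
  unique (natural_extension S0 (p1 := p1)) (push_Lp mu (indic_image S0) (p1 := p1)).
Proof.
have sP := indic_image_morphism S0P; split.
  split; first split.
  - exact: (push_Lp_iso sP p1 (indic_image_surj S0P)).
  - exact: push_Lp_cst.
  - move=> F; have [H HP] := push_Lp_Linfty F sP; exists H; split; last exact: HP.
    by rewrite -HP; apply/esym/(push_Lp_uniq sP)/indic_image_transports.
move=> S [SP ext]; apply/funext => F; apply: (push_Lp_uniq sP).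
have same A : measurable A -> ae_same mu (indic_image S A) (indic_image S0 A).
  move=> mA.
  have mI : measurable_fun setT (\1_A : X -> R) by [].
  have bI : \forall x \ae mu, `|\1_A x : R| <= 1.
    by apply: aeW => x; rewrite indicE; case: (_ \in _); rewrite ?normr1 ?normr0.
  have iL := Linfty_bounded mI bI.
  pose J := Lclass mu (leey 1) \1_A.
  have JE (q : R) (q1 : (1 <= q%:E)%E) : Lincl q1 J = Lindic mu q1 A.
    apply: Lspace_aeP.
    have JL : (J : X -> R) \in Lfun mu q%:E.
      apply: (Lfun_bounded (c := 1)) => //; first exact: measurable_aeEqMfun.
      by apply: filterS2 (LclassE (leey 1) iL) bI => x /(_ I) ->.
    apply: filterS3 (LclassE q1 JL) (LclassE (leey 1) iL) (Lindic_ae mu q1 mA).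
    by move=> x /(_ I) -> /(_ I) -> ->.
  have [H []] := ext J; rewrite !JE !S_indic// => E0 E.
  have [c Hc] := bounded_Linfty (LspaceP H).
  have HL (q : R) (q1 : (1 <= q%:E)%E) : \forall x \ae mu, Lincl q1 H x = H x.
    have := Lfun_bounded q1 (measurable_aeEqMfun H) Hc.
    by move=> /(LclassE q1); apply: filterS => x /(_ I).
  have m0 := measurable_indic_image S0 A; have m1 := measurable_indic_image S A.
  apply: (@Lindic_inj _ _ _ mu p p1) => //; rewrite E; apply: Lspace_aeP.
  near=> x; rewrite (near (HL p p1) x)// (near (Lindic_ae mu p1 m0) x)//.
  rewrite -(near (Lindic_ae mu p01 m0) x)// E0.
  by rewrite (near (HL p0 p01) x).
move=> B mB; have mFB : measurable ((F : X -> R) @^-1` B).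
  by rewrite -[_ @^-1` _]setTI; exact: measurable_aeEqMfun.
exact: ae_same_trans (indic_image_transports SP F mB) (same _ mFB).
Unshelve. all: by end_near. Qed.

End natural_extension_exists.

Import HBNNSimple.

(** * Density of the indicators in L^p *)

Section Lp_density.
Context d (X : measurableType d) (R : realType) (mu : probability X R).
Variables (p : R) (p1 : (1 <= p%:E)%E).

Let p_ge1 : 1 <= p. Proof. by rewrite -lee_fin. Qed.
Let p_neq0 : p != 0. Proof. by rewrite gt_eqF// (lt_le_trans ltr01). Qed.
Let p_ge0 : 0 <= p. Proof. exact: le_trans ler01 p_ge1. Qed.

Lemma Lspace_norm_powR (F : LspaceType mu p1) :
  (`|F| `^ p)%:E = (\int[mu]_x (`|F x| `^ p)%:E)%E.
Proof.
have := powR_Lnorm mu (EFin \o F) p_neq0.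
by rewrite -(Lspace_normE F).
Qed.

Lemma Lspace_norm_lt (F : LspaceType mu p1) e : 0 < e ->
  (\int[mu]_x (`|F x| `^ p)%:E < (e `^ p)%:E)%E -> `|F| < e.
Proof.
move=> e0; rewrite -Lspace_norm_powR lte_fin; apply: contraTT; rewrite -!leNgt.
by move=> eF; apply: ge0_ler_powR => //; rewrite nnegrE// ltW.
Qed.

Variable C : set (LspaceType mu p1).
Hypothesis C_indic : forall A, measurable A -> C (Lindic mu p1 A).
Hypothesis C_linear : forall a F G, C F -> C G -> C (a *: F + G).
Hypothesis C_closed : forall F,
  (forall e, 0 < e -> exists2 G, C G & `|F - G| < e) -> C F.

Let C0 : C 0.
Proof.
have := C_linear (-1) (C_indic measurable0) (C_indic measurable0).
by rewrite scaleN1r addNr.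
Qed.

Let LclassEp (f : X -> R) (c : R) : measurable_fun setT f -> (forall x, `|f x| <= c) ->
  \forall x \ae mu, Lclass mu p1 f x = f x.
Proof.
move=> mf fc; have := Lfun_bounded p1 mf (aeW mu fc).
by move=> /(LclassE p1); apply: filterS => x /(_ I).
Qed.

Let C_sum (a : nat -> R) (B : nat -> set X) n : (forall i, measurable (B i)) ->
  C (Lclass mu p1 (fun x => \sum_(i < n) a i * \1_(B i) x)).
Proof.
move=> mB; elim: n => [|n IH].
  by under eq_fun do rewrite big_ord0; exact: C0.
pose g x : R := \sum_(i < n) a i * \1_(B i) x.
have mg : measurable_fun setT g.
  by apply: measurable_sum => i; apply: measurable_funM => //; exact/measurable_indicP/mB.
have ind1 i x : `|\1_(B i) x : R| <= 1.
  by rewrite indicE; case: (_ \in _); rewrite ?normr1 ?normr0.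
have bsum m x : `|\sum_(i < m) a i * \1_(B i) x| <= \sum_(i < m) `|a i|.
  apply: (le_trans (ler_norm_sum _ _ _)); apply: ler_sum => i _.
  by rewrite normrM ler_piMr.
rewrite (_ : Lclass _ _ _ = a n *: Lindic mu p1 (B n) + Lclass mu p1 g).
  by apply: C_linear => //; exact: C_indic.
have mh : measurable_fun setT (fun x => \sum_(i < n.+1) a i * \1_(B i) x).
  by apply: measurable_sum => i; apply: measurable_funM => //; exact/measurable_indicP/mB.
have ZE : \forall x \ae mu, (a n *: Lindic mu p1 (B n)) x = a n * \1_(B n) x.
  apply: filterS2 (Lspace_scaleE (a n) (Lindic mu p1 (B n))) (Lindic_ae mu p1 (mB n)).
  by move=> x -> ->.
have DE : \forall x \ae mu, (a n *: Lindic mu p1 (B n) + Lclass mu p1 g) x =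
    a n * \1_(B n) x + g x.
  apply: filterS3 (Lspace_addE (a n *: Lindic mu p1 (B n)) (Lclass mu p1 g)) ZE
    (LclassEp mg (bsum n)).
  by move=> x -> -> ->.
apply: Lspace_aeP; apply: filterS2 (LclassEp mh (bsum n.+1)) DE => x -> ->.
by rewrite big_ord_recr addrC.
Qed.

Let C_sfun (f : {nnsfun X >-> R}) : C (Lclass mu p1 f).
Proof.
pose a := nth 0 (finmap.enum_fset (fset_set (range f))).
have -> : (f : X -> R) = fun x => \sum_(i < size (finmap.enum_fset (fset_set (range f))))
   a i * \1_(f @^-1` [set a i]) x.
  by apply/funext => x; exact: fimfunEord.
by apply: (@C_sum a (fun i => f @^-1` [set a i])) => i; exact: measurable_funPTI.
Qed.

(* Simple functions increase to [f]; dominated convergence applied to the p-th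
   powers of the differences gives convergence in norm. *)
Let C_nonneg (f : X -> R) : f \in Lfun mu p%:E -> (forall x, 0 <= f x) ->
  C (Lclass mu p1 f).
Proof.
move=> fL f0; have /andP[] := fL; rewrite inE /= => mf _.
have mEf : measurable_fun setT (EFin \o f) by exact/measurable_EFinP.
pose g n : X -> R := nnsfun_approx measurableT mEf n.
have mg n : measurable_fun setT (g n) by [].
have g0 n x : 0 <= g n x by [].
have gf x : g n x @[n --> \oo] --> f x.
  have := cvg_nnsfun_approx measurableT mEf (fun x _ => f0 x) (I : setT x).
  by move=> /fine_cvgP[].
have ndg x : nondecreasing_seq (g ^~ x).
  by move=> m n mn; have /lefP := nd_nnsfun_approx measurableT mEf mn; exact.
have g_le n x : g n x <= f x.
  rewrite -(cvg_lim _ (gf x))//; apply: nondecreasing_cvgn_le => //.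
  by apply/cvg_ex; exists (f x).
pose D n x : R := `|f x - g n x| `^ p.
have mD n : measurable_fun setT (D n).
  apply: (@measurableT_comp _ _ _ _ _ _ (@powR R ^~ p)) => //.
  by apply: measurableT_comp => //; exact: measurable_funB.
have D0 x : (D n x)%:E @[n --> \oo] --> 0%:E.
  apply/cvg_EFin; first by exact: nearW.
  apply/cvgrPdist_lt => e e0; have /cvgrPdist_lt := gf x.
  have e1 : 0 < Num.min 1 e by rewrite lt_min ltr01.
  move=> /(_ _ e1); apply: filterS => n /=; rewrite lt_min => /andP[y1 ye].
  rewrite sub0r normrN ger0_norm ?powR_ge0//.
  have [y0|y0] := eqVneq `|f x - g n x| 0; first by rewrite /D y0 powR0.
  apply: le_lt_trans ye; apply: ge1r_powR => //.
  by rewrite lt_neqAle eq_sym y0 normr_ge0 ltW.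
have bD : \forall x \ae mu, forall n, setT x -> (`|(D n x)%:E| <= (`|f x| `^ p)%:E)%E.
  apply: aeW => x n _; rewrite lee_fin ger0_norm ?powR_ge0//.
  apply: ge0_ler_powR; rewrite ?nnegrE//.
  by rewrite !ger0_norm ?subr_ge0// lerBlDr lerDl.
have [_ cv _] := @dominated_convergence _ _ _ mu setT measurableT
  (fun n x => (D n x)%:E) (cst 0%:E) (fun x => (`|f x| `^ p)%:E)
  (fun n => (measurable_EFinP _ _).2 (mD n)) (measurable_cst _)
  (aeW mu (fun x _ => D0 x)) (Lfun_integrable p_ge1 fL) bD.
apply: C_closed => e e0.
have ep : (0 < (e `^ p)%:E)%E by rewrite lte_fin powR_gt0.
have : \forall n \near \oo, (\int[mu]_x `|(D n x)%:E - cst 0%:E x| < (e `^ p)%:E)%E.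
  exact: (cv _ (open_ereal_lt' ep)).
move=> [N _ /(_ N (leqnn N)) /=].
have -> : (\int[mu]_x `|(D N x)%:E - cst 0%:E x| = \int[mu]_x (D N x)%:E)%E.
  by apply: eq_integral => x _; rewrite /= oppr0 addr0 ger0_norm// powR_ge0.
move=> HN.
exists (Lclass mu p1 (g N)); first exact: C_sfun.
apply: (Lspace_norm_lt e0); apply: (le_lt_trans _ HN).
rewrite le_eqVlt; apply/orP; left; apply/eqP; apply: ae_eq_integral => //.
- apply/measurable_EFinP; apply: (@measurableT_comp _ _ _ _ _ _ (@powR R ^~ p)) => //.
  by apply: measurableT_comp => //; exact: measurable_aeEqMfun.
- exact/measurable_EFinP.
have [M [_ /(_ (M + 1))]] := simple_bounded (nnsfun_approx measurableT mEf N).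
rewrite ltrDl ltr01 => /(_ isT) gM.
have fE : \forall x \ae mu, Lclass mu p1 f x = f x.
  by apply: filterS (LclassE p1 fL) => y /(_ I).
apply: filterS3 (Lspace_subE (Lclass mu p1 f) (Lclass mu p1 (g N)))
  (LclassEp (mg N) (fun x => gM x I)) fE => x E1 E2 E3 _.
by rewrite E1 E2 E3.
Qed.

(** Indicators are total: a norm-closed subspace that contains them is everything. *)
Lemma Lp_indic_dense F : C F.
Proof.
have FL := LspaceP F.
have pos : C (Lclass mu p1 (fun x => Num.max (F x) 0)).
  apply: C_nonneg => [|x]; last by rewrite le_max lexx orbT.
  exact: (Lfun_max p1 FL (Lfun0 mu p1)).
have neg : C (Lclass mu p1 (fun x => Num.max (- F x) 0)).
  apply: C_nonneg => [|x]; last by rewrite le_max lexx orbT.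
  exact: (Lfun_max p1 (LfunN FL) (Lfun0 mu p1)).
have -> : F = - 1 *: Lclass mu p1 (fun x => Num.max (- F x) 0)
              + Lclass mu p1 (fun x => Num.max (F x) 0); last exact: C_linear.
set P := Lclass mu p1 _; set N := Lclass mu p1 _.
have PE : \forall x \ae mu, P x = Num.max (- F x) 0.
  apply: filterS (LclassE p1 (Lfun_max p1 (LfunN FL) (Lfun0 mu p1))).
  by move=> y /(_ I).
have NE : \forall x \ae mu, N x = Num.max (F x) 0.
  by apply: filterS (LclassE p1 (Lfun_max p1 FL (Lfun0 mu p1))) => y /(_ I).
have PN : \forall x \ae mu, (-1 *: P + N) x = - Num.max (- F x) 0 + Num.max (F x) 0.
  have QE : \forall x \ae mu, (-1 *: P) x = - Num.max (- F x) 0.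
    by apply: filterS2 (Lspace_scaleE (-1) P) PE => x -> ->; rewrite mulN1r.
  by apply: filterS3 (Lspace_addE (-1 *: P) N) QE NE => x -> -> ->.
apply: Lspace_aeP; apply: filterS PN => x ->.
have [F0|F0] := leP (F x) 0.
  by rewrite max_l ?oppr_ge0// opprK addr0.
by rewrite max_r ?oppr_le0 1?ltW// oppr0 add0r.
Qed.

End Lp_density.

(** * Continuous actions on the measure algebra *)

Section topological_group_lemmas.
Context (G : topologicalGroupType).
Implicit Types g h k : G.
Local Open Scope group_scope.

Lemma mulgl_continuous h : continuous (fun g : G => h * g).
Proof.
move=> g; apply: (@continuous_comp _ _ _ (fun g => (h, g)) (fun z : G * G => z.1 * z.2)).
  by apply: cvg_pair; [exact: cvg_cst|exact: cvg_id].
exact: mulg_continuous.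
Qed.

Lemma mulgr_continuous h : continuous (fun g : G => g * h).
Proof.
move=> g; apply: (@continuous_comp _ _ _ (fun g => (g, h)) (fun z : G * G => z.1 * z.2)).
  by apply: cvg_pair; [exact: cvg_id|exact: cvg_cst].
exact: mulg_continuous.
Qed.

Lemma near_mulVg (P : G -> Prop) g : (\forall k \near nbhs (1 : G), P k) ->
  \forall h \near nbhs g, P (g^-1 * h).
Proof.
move=> P1; apply: (@mulgl_continuous g^-1 g P).
by rewrite mulVg.
Qed.

Lemma near_invg (P : G -> Prop) : (\forall k \near nbhs (1 : G), P k) ->
  \forall h \near nbhs (1 : G), P h^-1.
Proof. by move=> P1; apply: (@invg_continuous G 1 P); rewrite invg1. Qed.

End topological_group_lemmas.

Section transports_indic.
Context d (T : measurableType d) d' (X : measurableType d') (R : realType).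
Variables (nu : {measure set T -> \bar R}) (mu : {measure set X -> \bar R}).
Variables (s : set T -> set X) (sP : set_morphism nu mu s).

Lemma transports_indic (A : set T) : measurable A ->
  transports mu s (\1_A : T -> R) (\1_(s A) : X -> R).
Proof.
move=> mA; have msA := sm_measurable sP mA.
apply: (transports_rays sP) => // r.
have E V (B : set V) : [set x | r < (\1_B x : R)] =
    if r < 0 then setT else if r < 1 then B else set0.
  apply/seteqP; split => x /=; rewrite indicE.
    case: ifPn => // r0; case: (pselect (B x)) => Bx.
      by rewrite (mem_set Bx) /= => ->.
    by rewrite (memNset Bx) /= (negbTE r0).
  case: ifPn => [r0 _|r0].
    by rewrite (lt_le_trans r0).
  by case: ifPn => // r1 Bx; rewrite (mem_set Bx).
rewrite !E; case: ifPn => _.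
  by rewrite /ae_same; apply: filterS (sm_setT sP).
case: ifPn => _; first exact: ae_same_refl.
by rewrite /ae_same; apply: filterS (sm_set0 sP).
Qed.

End transports_indic.

(** An action of [G] by automorphisms of the measure algebra, continuous for the
    metric of the measure of the symmetric difference; this is the part of a
    representation on L^p that does not depend on [p]. *)
Record algebra_action d (X : measurableType d) (R : realType)
    (mu : probability X R) (G : topologicalGroupType) (sg : G -> set X -> set X)
    : Prop := AlgebraAction {
  aa_morphism : forall g, set_morphism mu mu (sg g) ;
  aa_1 : forall A, measurable A -> ae_same mu (sg 1%g A) A ;
  aa_M : forall g h A, measurable A ->
    ae_same mu (sg (g * h)%g A) (sg g (sg h A)) ;
  aa_continuous : forall A, measurable A -> forall e : R, 0 < e ->
    \forall g \near nbhs (1%g : G), (mu (sg g A `+` A) < e%:E)%E }.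

Lemma algebra_action_invK d (X : measurableType d) (R : realType)
    (mu : probability X R) (G : topologicalGroupType) (sg : G -> set X -> set X) g A :
  algebra_action mu sg -> measurable A -> ae_same mu (sg g (sg g^-1%g A)) A.
Proof.
move=> sgP mA; apply: ae_same_trans (ae_same_sym (aa_M sgP g g^-1%g mA)) _.
by rewrite mulgV; exact: aa_1.
Qed.

Lemma subr_split (V : zmodType) (a b c e : V) : a - b = (a - c) + ((c - e) - (b - e)).
Proof. by rewrite opprB !addrA !subrK. Qed.

Section strong_continuity.
Context d (X : measurableType d) (R : realType) (mu : probability X R).
Variables (G : topologicalGroupType).

Section Lp.
Variables (p : R) (p1 : (1 <= p%:E)%E).

Let p_gt0 : 0 < p. Proof. by rewrite (lt_le_trans ltr01)// -lee_fin. Qed.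

(** The metric of the measure algebra is the distance of indicators in L^p, up to
    a power: continuity on the algebra and strong continuity correspond. *)
Lemma Lindic_dist A B : measurable A -> measurable B ->
  (mu (A `+` B) = (`|Lindic mu p1 A - Lindic mu p1 B| `^ p)%:E)%E.
Proof.
move=> mA mB; have mAB : measurable (A `+` B).
  by apply: measurableU; exact: measurableD.
rewrite Lspace_norm_powR.
transitivity (\int[mu]_x (\1_(A `+` B) x)%:E)%E; first by rewrite integral_indic// setIT.
apply: ae_eq_integral => //.
- by apply/measurable_EFinP/measurable_indicP.
- apply/measurable_EFinP.
  apply: (@measurableT_comp _ _ _ _ _ _ (@powR R ^~ p)) => //.
  by apply: measurableT_comp => //; exact: measurable_aeEqMfun.
apply: filterS3 (Lspace_subE (Lindic mu p1 A) (Lindic mu p1 B)) (Lindic_ae mu p1 mA)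
  (Lindic_ae mu p1 mB) => x -> -> -> _; rewrite !indicE.
have p0 : p != 0 by rewrite gt_eqF.
case: (pselect (A x)) => Ax; case: (pselect (B x)) => Bx.
- rewrite (mem_set Ax) (mem_set Bx) (memNset (A := A `+` B)); last by case=> -[].
  by rewrite subrr normr0 powR0.
- rewrite (mem_set Ax) (memNset Bx) (mem_set (A := A `+` B)); last by left.
  by rewrite subr0 normr1 powR1.
- rewrite (memNset Ax) (mem_set Bx) (mem_set (A := A `+` B)); last by right.
  by rewrite sub0r normrN normr1 powR1.
- rewrite (memNset Ax) (memNset Bx) (memNset (A := A `+` B)); last by case=> -[].
  by rewrite subrr normr0 powR0.
Qed.

Lemma push_Lp_indic s A : set_morphism mu mu s -> measurable A ->
  push_Lp mu s (Lindic mu p1 A) = Lindic mu p1 (s A).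
Proof.
move=> sP mA; have msA := sm_measurable sP mA; apply: (push_Lp_uniq sP).
apply: (transports_ae_eq sP (f := \1_A : X -> R) (h := \1_(s A) : X -> R)).
- exact/measurable_indicP.
- exact: measurable_aeEqMfun.
- by apply: filterS (Lindic_ae mu p1 mA) => x ->.
- by apply: filterS (Lindic_ae mu p1 msA) => x ->.
exact: (transports_indic sP mA).
Qed.

Lemma rep_algebra_action (rho : G -> LspaceType mu p1 -> LspaceType mu p1) :
  sc_isometric_lattice_rep rho -> algebra_action mu (fun g => indic_image (rho g)).
Proof.
move=> [rho1 rhoM rhoP rhoC]; split.
- by move=> g; exact: (indic_image_morphism (rhoP g)).
- move=> A mA; apply: (@Lindic_inj _ _ _ mu p p1) => //; first exact: measurable_indic_image.
  by rewrite -(S_indic (rhoP 1%g)).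
- move=> g h A mA; have m := measurable_indic_image.
  apply: (@Lindic_inj _ _ _ mu p p1); [exact: m|exact: m|].
  rewrite -(S_indic (rhoP _))// -(S_indic (rhoP g)); last exact: m.
  by rewrite -(S_indic (rhoP h)).
- move=> A mA e e0; pose r := e `^ p^-1.
  have r0 : 0 < r by exact: powR_gt0.
  have /cvgrPdist_lt/(_ _ r0) := rhoC (Lindic mu p1 A) 1%g.
  apply: filterS => g; rewrite rho1 distrC => gr.
  rewrite Lindic_dist//; last exact: measurable_indic_image.
  rewrite -(S_indic (rhoP g))// lte_fin.
  rewrite (_ : e = r `^ p).
    by rewrite gt0_ltr_powR// nnegrE// ltW.
  by rewrite /r -powRrM mulVf ?powRr1 ?ltW// gt_eqF.
Qed.

Variable sg : G -> set X -> set X.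
Hypothesis sgP : algebra_action mu sg.

Let U g (F : LspaceType mu p1) := push_Lp mu (sg g) F.

Let mpre (F : LspaceType mu p1) B : measurable B -> measurable ((F : X -> R) @^-1` B).
Proof. by move=> mB; rewrite -[_ @^-1` _]setTI; exact: measurable_aeEqMfun. Qed.

Lemma algebra_action_push1 F : U 1%g F = F.
Proof.
apply: (push_Lp_uniq (aa_morphism sgP _)) => B mB.
exact/ae_same_sym/(aa_1 sgP)/mpre.
Qed.

Lemma algebra_action_pushM g h F : U (g * h)%g F = U g (U h F).
Proof.
apply: (push_Lp_uniq (aa_morphism sgP _)) => B mB.
apply: ae_same_trans (push_Lp_transports (aa_morphism sgP g) (U h F) mB) _.
apply: ae_same_trans (ae_same_sym (aa_M sgP g h (mpre F mB))).
apply: (sm_ae_same (aa_morphism sgP g)); first exact: mpre.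
  exact/(sm_measurable (aa_morphism sgP h))/mpre.
exact: (push_Lp_transports (aa_morphism sgP h) F mB).
Qed.

Lemma algebra_action_surj g B : measurable B ->
  exists2 A, measurable A & ae_same mu (sg g A) B.
Proof.
move=> mB; exists (sg g^-1%g B); first exact: (sm_measurable (aa_morphism sgP _)).
exact: algebra_action_invK.
Qed.

Let U_dist g h F : `|U g F - U h F| = `|U (g^-1 * h)%g F - F|.
Proof.
have lin k : linear (U k) := push_Lp_linear (aa_morphism sgP k) (p1 := p1).
rewrite -(push_Lp_norm (aa_morphism sgP g) (U (g^-1 * h)%g F - F)).
have -> : push_Lp mu (sg g) (U (g^-1 * h)%g F - F) = U g (U (g^-1 * h)%g F) - U g F.
  by rewrite -scaleN1r addrC [LHS]lin scaleN1r addrC.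
by rewrite -algebra_action_pushM mulVKg; exact: distrC.
Qed.

(** The vectors with a continuous orbit form a closed subspace, as the operators
    are isometries, and contain the indicators. *)
Lemma algebra_action_push_continuous F : continuous (U ^~ F).
Proof.
pose C : set (LspaceType mu p1) := [set F | forall e, 0 < e ->
  \forall g \near nbhs (1%g : G), `|U g F - F| < e].
suff CF : C F.
  move=> g; apply/cvgrPdist_lt => e e0.
  have := near_mulVg g (CF e e0); apply: filterS => h gh.
  by apply: le_lt_trans gh; rewrite -U_dist; exact: lexx.
have lin k : linear (U k) := push_Lp_linear (aa_morphism sgP k) (p1 := p1).
have UB k F1 F2 : U k (F1 - F2) = U k F1 - U k F2.
  by rewrite -scaleN1r addrC lin scaleN1r addrC.
apply: (Lp_indic_dense (C := C)) => {F}.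
- move=> A mA e e0; have ep : 0 < e `^ p by exact: powR_gt0.
  have := aa_continuous sgP mA ep; apply: filterS => g.
  have gP := aa_morphism sgP g.
  rewrite Lindic_dist//; last exact: (sm_measurable gP).
  rewrite /U push_Lp_indic// lte_fin; apply: contraTT; rewrite -!leNgt => h.
  by apply: ge0_ler_powR; rewrite ?nnegrE// ltW.
- move=> a F H CF CH e e0.
  have a0 : 0 < `|a| + 1 by rewrite ltr_wpDl.
  have e1 : 0 < e / 2 / (`|a| + 1) by rewrite !divr_gt0.
  have e2 : 0 < e / 2 by rewrite divr_gt0.
  apply: filterS2 (CF _ e1) (CH _ e2) => g gF gH.
  rewrite lin opprD addrACA -scalerBr.
  apply: le_lt_trans (ler_normD _ _) _; rewrite [ltRHS]splitr.
  apply: ler_ltD gH; rewrite normrZ.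
  apply: (@le_trans _ _ ((`|a| + 1) * `|U g F - F|)).
    by rewrite ler_wpM2r// lerDl.
  by rewrite -ler_pdivlMl// mulrC ltW.
- move=> F CF e e0; have e3 : 0 < e / 3 by rewrite divr_gt0.
  have [H CH FH] := CF _ e3.
  apply: filterS (CH _ e3) => g gH.
  have -> : U g F - F = U g (F - H) + ((U g H - H) - (F - H)).
    by rewrite UB; exact: subr_split.
  apply: le_lt_trans (ler_normD _ _) _; rewrite (push_Lp_norm (aa_morphism sgP g)).
  apply: (@lt_le_trans _ _ (e / 3 + (e / 3 + e / 3))); last first.
    by lra.
  apply: ltrD => //; apply: le_lt_trans (ler_normB _ _) _; exact: ltrD.
Qed.

Lemma algebra_action_rep :
  sc_isometric_lattice_rep (fun g => push_Lp mu (sg g) (p1 := p1)).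
Proof.
split.
- exact: algebra_action_push1.
- exact: algebra_action_pushM.
- move=> g; split; last exact: (push_Lp_cst (aa_morphism sgP g)).
  exact: (push_Lp_iso (aa_morphism sgP g) p1 (@algebra_action_surj g)).
- exact: algebra_action_push_continuous.
Qed.

End Lp.
End strong_continuity.

(** * A left invariant Haar functional *)

Section haar.
Context (R : realType) (G : topologicalGroupType).
Implicit Types (f : G -> R) (V W K : set G) (g h x : G).
Local Notation e := (1%g : G).

Definition compactly_bounded f := exists K (M : R),
  [/\ compact K, forall x, 0 <= f x <= M & forall x, ~ K x -> f x = 0].

(** A positive functional on the nonnegative bounded functions that vanish off a
    compact set, which is only required to be additive on the continuous ones: this is what
    the quotients of covering numbers give directly, and it spares the extension
    to a measure.  Monotonicity and subadditivity on the larger class allow the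
    comparison with indicators of compact sets. *)
Record haar_functional (I : (G -> R) -> R) : Prop := HaarFunctional {
  haar_ge0 : forall f, compactly_bounded f -> 0 <= I f ;
  haar_le : forall f1 f2, compactly_bounded f1 -> compactly_bounded f2 ->
    (forall x, f1 x <= f2 x) -> I f1 <= I f2 ;
  haar_subadditive : forall f1 f2, compactly_bounded f1 -> compactly_bounded f2 ->
    I (fun x => f1 x + f2 x) <= I f1 + I f2 ;
  haarZ : forall (c : R) f, compactly_bounded f -> 0 <= c ->
    I (fun x => c * f x) = c * I f ;
  haar_invariant : forall h f, compactly_bounded f ->
    I (fun x => f (h * x)%g) = I f ;
  haar_additive : forall f1 f2, compactly_bounded f1 -> compactly_bounded f2 ->
    continuous f1 -> continuous f2 -> I (fun x => f1 x + f2 x) = I f1 + I f2 ;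
  haar_gt0 : forall f, compactly_bounded f -> continuous f -> 0 < f e -> 0 < I f }.

Lemma compactly_boundedD f1 f2 : compactly_bounded f1 -> compactly_bounded f2 ->
  compactly_bounded (fun x => f1 x + f2 x).
Proof.
move=> [K1 [M1 [cK1 b1 z1]]] [K2 [M2 [cK2 b2 z2]]]; exists (K1 `|` K2), (M1 + M2); split.
- exact: compactU.
- by move=> x; have := b1 x; have := b2 x; lra.
- by move=> x nK; rewrite z1 ?z2 ?addr0// => h; apply: nK; [right|left].
Qed.

Lemma compactly_boundedZ c f : 0 <= c -> compactly_bounded f ->
  compactly_bounded (fun x => c * f x).
Proof.
move=> c0 [K [M [cK b z]]]; exists K, (c * M); split => //.
  by move=> x; have /andP[f0 fM] := b x; rewrite mulr_ge0//= ler_wpM2l.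
by move=> x /z ->; rewrite mulr0.
Qed.

Lemma compactly_bounded_le f1 f2 : compactly_bounded f2 ->
  (forall x, 0 <= f1 x <= f2 x) -> compactly_bounded f1.
Proof.
move=> [K [M [cK b z]]] f12; exists K, M; split => // x; have := f12 x.
  by have := b x; lra.
by move=> h /z zx; move: h; rewrite zx; lra.
Qed.

Lemma compactly_bounded_translate h f : compactly_bounded f ->
  compactly_bounded (fun x => f (h * x)%g).
Proof.
move=> [K [M [cK b z]]]; exists [set (h^-1 * x)%g | x in K], M; split => //.
- apply: continuous_compact => //; apply: continuous_subspaceT.
  exact: mulgl_continuous.
- move=> x nK; apply: z => Kx; apply: nK; exists (h * x)%g => //.
  by rewrite mulKg.
Qed.

Lemma compactly_bounded_indic K : compact K -> compactly_bounded (\1_K : G -> R).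
Proof.
move=> cK; exists K, 1; split => // x; last by move=> nK; rewrite indicE memNset.
by rewrite indicE; case: (_ \in _); rewrite ?lexx ?ler01.
Qed.

Lemma compactly_bounded0 : compactly_bounded (fun=> 0).
Proof. by exists set0, 0; split => //; [exact: compact0|move=> x; rewrite lexx]. Qed.

(** The compact set is finite up to translates of [V]; the near-covering form of
    compactness gives the finite list without choosing a subcover. *)
Lemma compact_translates K V : compact K -> nbhs e V ->
  exists t : seq G, forall x, K x -> exists2 g, g \in t & V (g^-1 * x)%g.
Proof.
move=> /compact_near_coveringP cK nV.
pose F : set_system (seq G) := filter_from setT (fun t : seq G => [set u : seq G | {subset t <= u}]).
have FF : Filter F.
  apply: filter_from_filter; first by exists [::].
  move=> t u _ _; exists (t ++ u) => // w tuw; split => x xt; apply: tuw;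
  by rewrite mem_cat xt ?orbT.
have := cK (seq G) F (fun t x => exists2 g, g \in t & V (g^-1 * x)%g) FF.
case=> [x Kx|t _ /(_ t) h]; last by exists t; exact: h.
exists ([set y | V (x^-1 * y)%g], [set u : seq G | {subset [:: x] <= u}]) => /=.
  by split; [exact: near_mulVg|exists [:: x]].
by move=> [y u] [/= Vy xu]; exists x => //; apply: xu; rewrite inE.
Qed.

Definition covering V f (s : seq (R * G)) :=
  all (fun cg => 0 <= cg.1) s /\
  forall x, f x <= \sum_(cg <- s) cg.1 * \1_V (cg.2^-1 * x)%g.

Definition weight (s : seq (R * G)) : R := \sum_(cg <- s) cg.1.

(** Haar's covering number of [f] by translates of the indicator of [V]. *)
Definition covering_number V f : R := inf [set weight s | s in covering V f].
Local Notation N := covering_number.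

Lemma weight_ge0 s : all (fun cg => 0 <= cg.1) s -> 0 <= weight s.
Proof. by move=> /allP s0; rewrite /weight big_seq sumr_ge0. Qed.

Lemma covering_number_le V f s : covering V f s -> N V f <= weight s.
Proof.
move=> sf; apply: ge_inf; last by exists s.
by exists 0 => _ [s' [s0 _] <-]; exact: weight_ge0.
Qed.

Lemma covering_exists V f : nbhs e V -> compactly_bounded f ->
  exists s, covering V f s.
Proof.
move=> nV [K [M [cK b z]]]; have [t tP] := compact_translates cK nV.
have M0 : 0 <= M by have := b e; lra.
exists [seq (M, g) | g <- t]; split; first by apply/allP => _ /mapP[g _ ->].
move=> x; rewrite big_map /=.
have ge0 s : 0 <= \sum_(j <- s) M * \1_V (j^-1 * x)%g.
  by apply: sumr_ge0 => j _; rewrite mulr_ge0// indicE.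
have [/tP[g gt Vg]|/z ->//] := pselect (K x).
have /andP[_ fM] := b x; apply: (le_trans fM).
elim: t gt {tP} => // h t IH; rewrite inE big_cons => /orP[/eqP <-|/IH ht].
  by rewrite indicE mem_set// mulr1 lerDl.
by apply: (le_trans ht); rewrite lerDr mulr_ge0// indicE.
Qed.

Lemma covering_number_ge V f (b : R) : nbhs e V -> compactly_bounded f ->
  (forall s, covering V f s -> b <= weight s) -> b <= N V f.
Proof.
move=> nV bf h; apply: lb_le_inf; last by move=> _ [s /h ? <-].
by have [s sf] := covering_exists nV bf; exists (weight s), s.
Qed.

Lemma covering_number_ge0 V f : nbhs e V -> compactly_bounded f -> 0 <= N V f.
Proof.
by move=> nV bf; apply: covering_number_ge => // s [s0 _]; exact: weight_ge0.
Qed.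

Lemma covering_number_mono V f1 f2 : nbhs e V -> compactly_bounded f2 ->
  (forall x, f1 x <= f2 x) -> N V f1 <= N V f2.
Proof.
move=> nV bf f12; apply: covering_number_ge => // s [s0 sf].
by apply: covering_number_le; split => // x; exact: le_trans (sf x).
Qed.

Lemma covering_numberD V f1 f2 : nbhs e V ->
  compactly_bounded f1 -> compactly_bounded f2 ->
  N V (fun x => f1 x + f2 x) <= N V f1 + N V f2.
Proof.
move=> nV b1 b2; rewrite -lerBlDr; apply: covering_number_ge => // s1 [s10 s1f].
rewrite lerBlDr -lerBlDl; apply: covering_number_ge => // s2 [s20 s2f].
rewrite lerBlDl; have -> : weight s1 + weight s2 = weight (s1 ++ s2).
  by rewrite /weight big_cat.
apply: covering_number_le; split; first by rewrite all_cat s10.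
by move=> x; rewrite big_cat lerD.
Qed.

Lemma covering_numberZ_le V c f : nbhs e V -> compactly_bounded f -> 0 < c ->
  N V (fun x => c * f x) <= c * N V f.
Proof.
move=> nV bf c0; rewrite -ler_pdivrMl//; apply: covering_number_ge => // s [s0 sf].
rewrite ler_pdivrMl//; have -> : c * weight s = weight [seq (c * cg.1, cg.2) | cg <- s].
  by rewrite /weight big_map mulr_sumr.
apply: covering_number_le; split.
  by apply/allP => _ /mapP[cg cgs ->] /=; rewrite mulr_ge0 ?(allP s0)// ltW.
move=> x; rewrite big_map /=; under eq_bigr do rewrite -mulrA.
by rewrite -mulr_sumr ler_wpM2l// ltW.
Qed.

Lemma covering_number0 V : nbhs e V -> N V (fun=> 0) = 0.
Proof.
move=> nV; apply/eqP; rewrite eq_le covering_number_ge0// ?andbT; last exact: compactly_bounded0.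
rewrite [leRHS](_ : 0 = weight [::]); last by rewrite /weight big_nil.
by apply: covering_number_le; split => // x; rewrite big_nil.
Qed.

Lemma covering_numberZ V c f : nbhs e V -> compactly_bounded f -> 0 <= c ->
  N V (fun x => c * f x) = c * N V f.
Proof.
move=> nV bf; rewrite le_eqVlt => /orP[/eqP <-|c0].
  by under eq_fun do rewrite mul0r; rewrite covering_number0// mul0r.
apply/eqP; rewrite eq_le covering_numberZ_le//=.
rewrite -ler_pdivlMl//; have cV : 0 < c^-1 by rewrite invr_gt0.
have := covering_numberZ_le nV (compactly_boundedZ (ltW c0) bf) cV.
by under eq_fun do rewrite mulKf ?gt_eqF//.
Qed.

Lemma covering_number_translate_le V h f : nbhs e V -> compactly_bounded f ->
  N V (fun x => f (h * x)%g) <= N V f.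
Proof.
move=> nV bf; apply: covering_number_ge => // s [s0 sf].
have -> : weight s = weight [seq (cg.1, (h^-1 * cg.2)%g) | cg <- s].
  by rewrite /weight big_map.
apply: covering_number_le; split.
  by apply/allP => _ /mapP[cg cgs ->] /=; rewrite (allP s0).
move=> x; rewrite big_map /=; apply: le_trans (sf _) _.
by rewrite le_eqVlt; under [eqbRHS]eq_bigr do rewrite invgM invgK -mulgA; rewrite eqxx.
Qed.

Lemma covering_number_translate V h f : nbhs e V -> compactly_bounded f ->
  N V (fun x => f (h * x)%g) = N V f.
Proof.
move=> nV bf; apply/eqP; rewrite eq_le covering_number_translate_le//=.
have := covering_number_translate_le h^-1%g nV (compactly_bounded_translate h bf).
by under eq_fun do rewrite mulVKg.
Qed.

Lemma covering_number_ge_value V f x : nbhs e V -> compactly_bounded f ->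
  f x <= N V f.
Proof.
move=> nV bf; apply: covering_number_ge => // s [s0 sf].
apply: (le_trans (sf x)); rewrite /weight big_seq [leRHS]big_seq; apply: ler_sum => cg cgs.
by rewrite ler_piMr ?(allP s0)// indicE; case: (_ \in _).
Qed.

(** A covering of [f] by translates of [f0] does not involve [V], so the quotients
    of the two covering numbers stay in a compact interval when [V] shrinks. *)
Lemma covering_number_compare f f0 V0 (c : R) : compactly_bounded f ->
  compactly_bounded f0 -> nbhs e V0 -> 0 < c -> (forall x, V0 x -> c <= f0 x) ->
  exists2 C, 0 <= C & forall V, nbhs e V -> N V f <= C * N V f0.
Proof.
move=> bf bf0 nV0 c0 f0c; have [K [M [cK b z]]] := bf.
have [t tP] := compact_translates cK nV0.
have M0 : 0 <= M by have := b e; lra.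
have Mc0 : 0 <= M / c by rewrite divr_ge0// ltW.
exists ((size t)%:R * (M / c)); first by rewrite mulr_ge0.
move=> V nV.
have bsum (u : seq G) : compactly_bounded (fun x => \sum_(g <- u) (M / c) * f0 (g^-1 * x)%g).
  elim: u => [|g u IH]; first by under eq_fun do rewrite big_nil; exact: compactly_bounded0.
  under eq_fun do rewrite big_cons; apply: compactly_boundedD => //.
  by apply: compactly_boundedZ => //; exact: compactly_bounded_translate.
have f00 x : 0 <= f0 x by have [? [? [_ /(_ x)/andP[]]]] := bf0.
apply: (@le_trans _ _ (N V (fun x => \sum_(g <- t) (M / c) * f0 (g^-1 * x)%g))).
  apply: covering_number_mono => // x.
  have [/tP[g gt Vg]|/z ->] := pselect (K x); last first.
    by apply: sumr_ge0 => g _; exact: mulr_ge0.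
  have /andP[_ fM] := b x; apply: (le_trans fM).
  elim: t gt {tP bsum} => // h t IH; rewrite inE big_cons => /orP[/eqP <-|/IH ht].
    apply: (@le_trans _ _ (M / c * f0 (g^-1 * x)%g)).
      by rewrite -[leLHS](@divfK _ c) ?gt_eqF// ler_wpM2l// f0c.
    by rewrite lerDl; apply: sumr_ge0 => j _; exact: mulr_ge0.
  by apply: (le_trans ht); rewrite lerDr; exact: mulr_ge0.
elim: t {tP} => [|g t IH].
  by under eq_fun do rewrite big_nil; rewrite covering_number0// !mul0r.
under eq_fun do rewrite big_cons.
have bt := compactly_bounded_translate g^-1%g bf0.
apply: le_trans (covering_numberD nV (compactly_boundedZ Mc0 bt) (bsum t)) _.
rewrite covering_numberZ// covering_number_translate//.
by rewrite /= -(addn1 (size t)) natrD addrC !mulrDl mul1r lerD2r.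
Qed.

End haar.

Section haar_existence.
Context (R : realType) (G : topologicalGroupType).
Implicit Types (f : G -> R) (V W K : set G) (g h x : G).
Local Notation e := (1%g : G).
Local Notation N := (@covering_number R G).

Let near_covering_unif (Q : G -> G -> R) K (eta : R) : compact K -> 0 < eta ->
  continuous (fun z : G * G => Q z.1 z.2) -> (forall x, Q x e = 0) ->
  \forall w \near nbhs e, forall s, K s -> `|Q s w| < eta.
Proof.
move=> /compact_near_coveringP cK eta0 cQ Q0.
apply: (cK G (nbhs e) (fun w s => `|Q s w| < eta)) => x Kx.
have /cvgrPdist_lt/(_ _ eta0) := cQ (x, e).
by apply: filterS => -[s w] /=; rewrite Q0 sub0r normrN.
Qed.

Let continuous_mulg2 f (a b : G * G -> G) : continuous f -> continuous a -> continuous b ->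
  continuous (fun z : G * G => f (a z * b z)%g).
Proof.
move=> cf ca cb z; apply: (@continuous_comp _ _ _ (fun z => (a z * b z)%g) f).
  apply: (@continuous_comp _ _ _ (fun z => (a z, b z)) (fun z : G * G => (z.1 * z.2)%g)).
    by apply: cvg_pair; [exact: ca|exact: cb].
  exact: mulg_continuous.
exact: cf.
Qed.

Let fst_c : continuous (fst : G * G -> G). Proof. by move=> z; exact: cvg_fst. Qed.
Let snd_c : continuous (snd : G * G -> G). Proof. by move=> z; exact: cvg_snd. Qed.

Lemma right_unif_continuous f (eta : R) : compactly_bounded f -> continuous f ->
  0 < eta -> \forall w \near nbhs e, forall s, `|f s - f (s * w)%g| < eta.
Proof.
move=> [K [M [cK b z]]] cf eta0.
have cQ : continuous (fun y : G * G => f y.1 - f (y.1 * y.2)%g).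
  move=> y; apply: cvgB; last exact: (continuous_mulg2 cf fst_c snd_c).
  by apply: (@continuous_comp _ _ _ fst f); [exact: fst_c|exact: cf].
have Q0 x : f x - f (x * e)%g = 0 by rewrite mulg1 subrr.
have nK := near_covering_unif (Q := fun s w => f s - f (s * w)%g) cK eta0 cQ Q0.
apply: filterS2 nK (near_invg nK) => w wK wVK s.
have [/wK//|nKs] := pselect (K s).
have [/wVK|nKsw] := pselect (K (s * w)%g); first by rewrite mulgK distrC.
by rewrite !z// subrr normr0.
Qed.

Lemma left_unif_continuous f (eta : R) : compactly_bounded f -> continuous f ->
  0 < eta -> \forall h \near nbhs e, forall g, `|f (h * g)%g - f g| < eta.
Proof.
move=> [K [M [cK b z]]] cf eta0.
have cQ : continuous (fun y : G * G => f (y.2 * y.1)%g - f y.1).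
  move=> y; apply: cvgB; first exact: (continuous_mulg2 cf snd_c fst_c).
  by apply: (@continuous_comp _ _ _ fst f); [exact: fst_c|exact: cf].
have Q0 x : f (e * x)%g - f x = 0 by rewrite mul1g subrr.
have nK := near_covering_unif (Q := fun s w => f (w * s)%g - f s) cK eta0 cQ Q0.
apply: filterS2 nK (near_invg nK) => w wK wVK s.
have [/wK//|nKs] := pselect (K s).
have [/wVK|nKsw] := pselect (K (w * s)%g); first by rewrite mulKg distrC.
by rewrite !z// subrr normr0.
Qed.

Hypothesis lcG : locally_compact [set: G].

Lemma compact_nbhs1 : exists2 U0 : set G, nbhs e U0 & compact U0.
Proof.
have [U nU [cU _]] := lcG (I : [set: G] e).
exists U => //.
have nU1 : \forall x \near nbhs e, [set: G] x -> U x by exact: nU.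
by apply: filterS nU1 => x; apply.
Qed.

(** Covering numbers are additive in the limit: a covering of [f1 + f2] by small
    translates becomes a covering of [fi] if the weight of [gV] is multiplied by
    the value at [g] of the almost constant ratio [fi / (f1 + f2)].  The small
    multiple of an indicator keeps the denominator away from 0. *)
Lemma covering_number_near_additive f1 f2 :
  compactly_bounded f1 -> compactly_bounded f2 -> continuous f1 -> continuous f2 ->
  exists2 C, compact C & forall eps delta : R, 0 < eps -> 0 < delta ->
    exists2 W, nbhs e W & forall V, nbhs e V -> V `<=` W ->
      N V f1 + N V f2 <=
        (1 + 2 * eps) * (N V (fun x => f1 x + f2 x) + delta * N V (\1_C)).
Proof.
move=> b1 b2 c1 c2.
have [K1 [M1 [cK1 B1 z1]]] := b1; have [K2 [M2 [cK2 B2 z2]]] := b2.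
have [U0 nU0 cU0] := compact_nbhs1.
pose C := [set (z.1 * z.2)%g | z in (K1 `|` K2) `*` U0].
have cC : compact C.
  apply: continuous_compact; last exact: compact_setX (compactU cK1 cK2) cU0.
  by apply: continuous_subspaceT; exact: mulg_continuous.
exists C => // eps delta eps0 delta0.
pose eta := eps * delta / 3; have eta0 : 0 < eta by rewrite !mulr_gt0// invr_gt0.
have W1 := right_unif_continuous b1 c1 eta0.
have W2 := right_unif_continuous b2 c2 eta0.
exists [set w | [/\ forall s, `|f1 s - f1 (s * w)%g| < eta,
  forall s, `|f2 s - f2 (s * w)%g| < eta & U0 w^-1%g]].
  by apply: filterS3 W1 W2 (near_invg nU0).
move=> V nV VW.
pose h x := f1 x + f2 x + delta * \1_C x.
have f10 x : 0 <= f1 x by have /andP[] := B1 x.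
have f20 x : 0 <= f2 x by have /andP[] := B2 x.
have i0 x : 0 <= delta * \1_C x :> R by rewrite mulr_ge0 ?indicE// ltW.
have h0 x : 0 <= h x by rewrite !addr_ge0.
have U1 : U0 e := nbhs_singleton nU0.
have ratio f : (forall x, 0 <= f x <= h x) ->
    (forall x, ~ (K1 `|` K2) x -> f x = 0) ->
    (forall w, V w -> forall s, `|f s - f (s * w)%g| < eta) ->
    forall x g, V (g^-1 * x)%g -> f x / h x <= f g / h g + eps.
  move=> fh fz fc x g Vgx.
  have r0 : 0 <= f g / h g + eps.
    by rewrite addr_ge0 ?(ltW eps0)// divr_ge0//; have /andP[] := fh g.
  have [Kx|/fz ->] := pselect ((K1 `|` K2) x); last by rewrite mul0r.
  have gE : (g * (g^-1 * x))%g = x by rewrite mulVKg.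
  have [w1 w2 Uw] := VW _ Vgx; have := w1 g; have := w2 g; have := fc _ Vgx g.
  rewrite gE => fd d2 d1.
  have Cx : C x by exists (x, e) => //=; rewrite mulg1.
  have Cg : C g.
    by exists (x, (g^-1 * x)^-1%g) => //=; rewrite invgM invgK mulVKg.
  have hx : delta <= h x by rewrite /h indicE mem_set// mulr1 lerDr addr_ge0.
  have hg : delta <= h g by rewrite /h indicE mem_set// mulr1 lerDr addr_ge0.
  have hx0 := lt_le_trans delta0 hx; have hg0 := lt_le_trans delta0 hg.
  have hd : h g - 2 * eta <= h x.
    rewrite /h !indicE !mem_set// !mulr1.
    by move: d1 d2; rewrite !ltr_norml => /andP[? ?] /andP[? ?]; lra.
  have fd' : f x <= f g + eta by move: fd; rewrite ltr_norml => /andP[? ?]; lra.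
  rewrite ler_pdivrMr// mulrDl; apply: (le_trans fd').
  have /andP[fg0 fgh] := fh g.
  have q0 : 0 <= f g / h g by rewrite divr_ge0// ltW.
  have q1 : f g / h g <= 1 by rewrite ler_pdivrMr// mul1r.
  have E1 : f g / h g * (h g - 2 * eta) <= f g / h g * h x by rewrite ler_wpM2l.
  have E2 : f g / h g * (h g - 2 * eta) = f g - f g / h g * (2 * eta).
    by rewrite mulrBr divfK// gt_eqF.
  have E3 : f g / h g * (2 * eta) <= 2 * eta by rewrite ler_piMl// ltW// mulr_gt0.
  have E4 : eps * delta <= eps * h x by rewrite ler_wpM2l// ltW.
  have E5 : eps * delta = 3 * eta by rewrite /eta mulrCA divff// mulr1.
  lra.
have fh1 x : 0 <= f1 x <= h x by rewrite f10 /h -addrA lerDl addr_ge0.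
have fh2 x : 0 <= f2 x <= h x by rewrite f20 /h addrAC lerDr addr_ge0.
have r1 := ratio f1 fh1 (fun x nK => z1 x (fun k => nK (or_introl k)))
  (fun w Vw => (let: And3 a _ _ := VW w Vw in a)).
have r2 := ratio f2 fh2 (fun x nK => z2 x (fun k => nK (or_intror k)))
  (fun w Vw => (let: And3 _ a _ := VW w Vw in a)).
have sub f : (forall x, 0 <= f x <= h x) ->
    (forall x g, V (g^-1 * x)%g -> f x / h x <= f g / h g + eps) ->
    forall s, covering V h s ->
    N V f <= \sum_(cg <- s) cg.1 * (f cg.2 / h cg.2 + eps).
  move=> fh fr s [s0 sh].
  have q0 g : 0 <= f g / h g + eps.
    by rewrite addr_ge0 ?(ltW eps0)// divr_ge0//; have /andP[] := fh g.
  have -> : \sum_(cg <- s) cg.1 * (f cg.2 / h cg.2 + eps) =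
      weight [seq (cg.1 * (f cg.2 / h cg.2 + eps), cg.2) | cg <- s].
    by rewrite /weight big_map.
  apply: covering_number_le; split.
    by apply/allP => _ /mapP[cg cgs ->] /=; rewrite mulr_ge0// (allP s0).
  move=> x; rewrite big_map /=.
  have /andP[fx0 fxh] := fh x.
  have fE : f x = h x * (f x / h x).
    have [hx0|hx0] := eqVneq (h x) 0; last by rewrite mulrCA divff// mulr1.
    by rewrite hx0 mul0r; apply/eqP; rewrite eq_le fx0 -hx0 fxh.
  rewrite fE; apply: (@le_trans _ _
    ((\sum_(cg <- s) cg.1 * \1_V (cg.2^-1 * x)%g) * (f x / h x))).
    by rewrite ler_wpM2r// divr_ge0.
  rewrite mulr_suml big_seq [leRHS]big_seq; apply: ler_sum => cg cgs.
  rewrite -!mulrA ler_wpM2l ?(allP s0)// mulrC indicE.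
  have [Vx|nVx] := pselect (V (cg.2^-1 * x)%g).
    by rewrite mem_set// !mulr1 fr.
  by rewrite memNset// !mulr0.
have bC := compactly_bounded_indic R cC.
have bdC := compactly_boundedZ (ltW delta0) bC.
have bs := compactly_boundedD b1 b2.
have bh : compactly_bounded h by exact: compactly_boundedD.
have e2 : 0 < 1 + 2 * eps by rewrite addr_gt0// mulr_gt0.
apply: (@le_trans _ _ ((1 + 2 * eps) * N V h)); last first.
  rewrite ler_wpM2l ?(ltW e2)//; apply: le_trans (covering_numberD nV bs bdC) _.
  by rewrite covering_numberZ// ltW.
rewrite -ler_pdivrMl//; apply: covering_number_ge => // s sh.
rewrite ler_pdivrMl//; apply: le_trans (lerD (sub _ fh1 r1 _ sh) (sub _ fh2 r2 _ sh)) _.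
rewrite -big_split /= /weight mulr_sumr big_seq [leRHS]big_seq; apply: ler_sum => cg cgs.
have [s0 _] := sh; rewrite -mulrDr mulrC ler_wpM2r ?(allP s0)//.
have q1 : f1 cg.2 / h cg.2 + f2 cg.2 / h cg.2 <= 1.
  rewrite -mulrDl; have := h0 cg.2; rewrite le_eqVlt => /orP[/eqP <-|hp].
    by rewrite invr0 mulr0.
  by rewrite ler_pdivrMr// mul1r /h lerDl.
lra.
Qed.

(** The sets [V] shrink to [1] along the filter generated by the sets below. *)
Let F1 : set_system (set G) :=
  filter_from (nbhs e) (fun W => [set V | nbhs e V /\ V `<=` W]).

Let F1_proper : ProperFilter F1.
Proof.
apply: filter_from_proper; last by move=> W nW; exists W; split.
apply: filter_from_filter; first by exists setT; exact: filterT.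
move=> W1 W2 n1 n2; exists (W1 `&` W2); first exact: filterI.
by move=> V [nV VW]; split; split=> // x /VW[].
Qed.

(** Quotients of covering numbers by a fixed one lie in a compact interval, hence
    converge along an ultrafilter of neighbourhoods shrinking to [1]; the limit
    inherits invariance and subadditivity, and becomes additive on
    continuous functions. *)
Theorem haar_functional_exists : exists I : (G -> R) -> R, haar_functional I.
Proof.
have [UF [UFu F1UF]] := ultraFilterLemma F1_proper.
have UFp : ProperFilter UF by exact: ultra_proper.
have [U0 nU0 cU0] := compact_nbhs1.
pose f0 : G -> R := \1_U0; have b0 : compactly_bounded f0 := compactly_bounded_indic R cU0.
have nearV W : nbhs e W -> \forall V \near UF, nbhs e V /\ V `<=` W.
  by move=> nW; apply: F1UF; exists W.
have nearN : \forall V \near UF, nbhs e V.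
  by apply: filterS (nearV setT filterT) => V [].
have f0_ge1 V : nbhs e V -> 1 <= N V f0.
  move=> nV; apply: le_trans (covering_number_ge_value e nV b0).
  by rewrite /f0 indicE mem_set//; exact: nbhs_singleton.
have f0_gt0 V : nbhs e V -> 0 < N V f0 by move=> /f0_ge1; exact: lt_le_trans.
pose q f V := N V f / N V f0.
have q_cvg f : compactly_bounded f -> exists l : R, q f V @[V --> UF] --> l.
  move=> bf; have [|C C0 HC] := covering_number_compare bf b0 nU0 (@ltr01 R).
    by move=> x Ux; rewrite /f0 indicE mem_set.
  have qC : \forall V \near UF, `[0, C]%classic (q f V).
    apply: filterS nearN => V nV; rewrite /= in_itv /= divr_ge0//=.
    - by rewrite ler_pdivrMr ?f0_gt0// HC.
    - exact: covering_number_ge0.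
    - exact/ltW/f0_gt0.
  have [l [_ cl]] := @segment_compact R 0 C (q f @ UF) _ qC.
  exists l => B nB; have [//|nqB] := in_ultra_setVsetC (q f @^-1` B) UFu.
  by have [y [nBy By]] := cl (~` B) B nqB nB.
pose I f := lim (q f V @[V --> UF]).
have IP f : compactly_bounded f -> q f V @[V --> UF] --> I f.
  by move=> /q_cvg[l ql]; rewrite /I (cvg_lim _ ql).
have Ile f (a : R) : compactly_bounded f ->
    (\forall V \near UF, q f V <= a) -> I f <= a.
  by move=> /IP qf; exact: cvgr_to_le qf.
have Ige f (a : R) : compactly_bounded f ->
    (\forall V \near UF, a <= q f V) -> a <= I f.
  by move=> /IP qf; exact: cvgr_to_ge qf.
exists I; split.
- move=> f bf; apply: Ige => //; apply: filterS nearN => V nV.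
  by rewrite divr_ge0 ?covering_number_ge0.
- move=> f1 f2 b1 b2 f12; rewrite -subr_ge0.
  apply: (cvgr_to_ge (cvgB (IP _ b2) (IP _ b1))).
  apply: filterS nearN => V nV; rewrite subr_ge0 ler_pM2r ?invr_gt0 ?f0_gt0//.
  exact: covering_number_mono.
- move=> f1 f2 b1 b2; have bs := compactly_boundedD b1 b2; rewrite -subr_ge0.
  apply: (cvgr_to_ge (cvgB (cvgD (IP _ b1) (IP _ b2)) (IP _ bs))).
  apply: filterS nearN => V nV.
  rewrite subr_ge0 -mulrDl ler_pM2r ?invr_gt0 ?f0_gt0//.
  exact: covering_numberD.
- move=> c f bf c0; have bc := compactly_boundedZ c0 bf.
  have h : c * q f V @[V --> UF] --> c * I f by apply: cvgMr; exact: IP.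
  apply/cvg_lim => //; apply: cvg_trans h; apply: near_eq_cvg.
  by apply: filterS nearN => V nV; rewrite /q covering_numberZ// mulrA.
- move=> h f bf; apply/cvg_lim => //; apply: cvg_trans (IP f bf).
  apply: near_eq_cvg; apply: filterS nearN => V nV.
  by rewrite /q covering_number_translate.
- move=> f1 f2 b1 b2 c1 c2; have bs := compactly_boundedD b1 b2.
  apply/eqP; rewrite eq_le; apply/andP; split.
    rewrite -subr_ge0; apply: (cvgr_to_ge (cvgB (cvgD (IP _ b1) (IP _ b2)) (IP _ bs))).
    apply: filterS nearN => V nV.
    by rewrite subr_ge0 -mulrDl ler_pM2r ?invr_gt0 ?f0_gt0//; exact: covering_numberD.
  have [C cC HC] := covering_number_near_additive b1 b2 c1 c2.
  have bC := compactly_bounded_indic R cC.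
  have step eps delta : 0 < eps -> 0 < delta ->
      I f1 + I f2 <= (1 + 2 * eps) * (I (fun x => f1 x + f2 x) + delta * I \1_C).
    move=> eps0 delta0; have [W nW HW] := HC _ _ eps0 delta0.
    rewrite -subr_ge0.
    have cv : (1 + 2 * eps) * (q (fun x => f1 x + f2 x) V + delta * q \1_C V)
        - (q f1 V + q f2 V) @[V --> UF] -->
        (1 + 2 * eps) * (I (fun x => f1 x + f2 x) + delta * I \1_C) - (I f1 + I f2).
      apply: cvgB; last by apply: cvgD; exact: IP.
      apply: cvgMr; apply: cvgD; first exact: IP.
      by apply: cvgMr; exact: IP.
    apply: (cvgr_to_ge cv); apply: filterS (nearV W nW) => V [nV VW].
    by rewrite subr_ge0 -mulrDl mulrA -mulrDl mulrA ler_pM2r ?invr_gt0 ?f0_gt0// HW.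
  have IC0 : 0 <= I \1_C.
    apply: Ige => //; apply: filterS nearN => V nV.
    by rewrite divr_ge0 ?covering_number_ge0.
  have Is0 : 0 <= I (fun x => f1 x + f2 x).
    apply: Ige => //; apply: filterS nearN => V nV.
    by rewrite divr_ge0 ?covering_number_ge0.
  set A := I (fun x => f1 x + f2 x) in step Is0 *; set B := I \1_C in step IC0 *.
  apply/ler_addgt0Pr => eps eps0.
  pose t := Num.min 1 (eps / (2 * A + 3 * B + 1)).
  have D0 : 0 < 2 * A + 3 * B + 1 by lra.
  have t0 : 0 < t by rewrite lt_min ltr01 divr_gt0.
  have t1 : t <= 1 by rewrite ge_min lexx.
  have tD : t * (2 * A + 3 * B + 1) <= eps by rewrite -ler_pdivlMr// ge_min lexx orbT.
  apply: le_trans (step t t t0 t0) _.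
  have tt : t * t * B <= t * B by rewrite ler_wpM2r// ler_piMl// ltW.
  have E1 : (1 + 2 * t) * (A + t * B) = A + t * B + 2 * (t * A) + 2 * (t * t * B) by ring.
  have E2 : t * (2 * A + 3 * B + 1) = 2 * (t * A) + 3 * (t * B) + t by ring.
  by rewrite E1; rewrite E2 in tD; lra.
- move=> f bf cf fe0; have [K [M [cK b z]]] := bf.
  have f2 : 0 < f e / 2 by rewrite divr_gt0.
  have nV0 : nbhs e [set x | f e / 2 <= f x].
    have /cvgrPdist_lt/(_ _ f2) := cf e; apply: filterS => x.
    by rewrite ltr_norml /= => /andP[_]; lra.
  have [//|C C0 HC] := covering_number_compare b0 bf nV0 f2.
  apply: (@lt_le_trans _ _ (C + 1)^-1); first by rewrite invr_gt0 ltr_wpDl.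
  apply: Ige => //; apply: filterS nearN => V nV.
  have h := HC V nV; have n0 := f0_gt0 V nV; have nf := covering_number_ge0 nV bf.
  rewrite ler_pdivlMr// ler_pdivrMl ?ltr_wpDl//; apply: (le_trans h).
  by rewrite ler_wpM2r// lerDl.
Qed.

End haar_existence.

(** * Bounded contents and their densities *)

Section density.
Context d (X : measurableType d) (R : realType) (mu : probability X R).
Implicit Types A B C : set X.

Definition prob A : R := fine (mu A).
Local Notation m := prob.

Lemma probE A : measurable A -> mu A = (m A)%:E.
Proof. by move=> mA; rewrite /prob fineK// fin_num_measure. Qed.

Lemma prob_ge0 A : 0 <= m A.
Proof. exact: fine_ge0. Qed.

Lemma prob_ae_sub A B : measurable A -> measurable B -> ae_sub mu A B -> m A <= m B.
Proof. by move=> mA mB AB; rewrite -lee_fin -!probE//; exact: measure_ae_sub. Qed.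

Lemma prob_sub A B : measurable A -> measurable B -> A `<=` B -> m A <= m B.
Proof. by move=> mA mB AB; apply: prob_ae_sub => //; exact: subset_ae_sub. Qed.

Lemma prob_ae_same A B : measurable A -> measurable B -> ae_same mu A B -> m A = m B.
Proof.
move=> mA mB AB; apply: EFin_inj; rewrite -(probE mA) -(probE mB).
exact: measure_ae_same.
Qed.

Lemma probU A B : measurable A -> measurable B -> A `&` B = set0 ->
  m (A `|` B) = m A + m B.
Proof.
move=> mA mB AB; have mAB := measurableU _ _ mA mB.
apply: EFin_inj; rewrite EFinD -(probE mA) -(probE mB) -(probE mAB).
exact: measureU.
Qed.

Lemma probDI A B : measurable A -> measurable B -> m A = m (A `\` B) + m (A `&` B).
Proof.
move=> mA mB; have mD := measurableD mA mB; have mI := measurableI _ _ mA mB.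
apply: EFin_inj; rewrite EFinD -(probE mA) -(probE mD) -(probE mI).
exact: measureDI.
Qed.

Lemma probU_le A B : measurable A -> measurable B -> m (A `|` B) <= m A + m B.
Proof.
move=> mA mB; have mU := measurableU _ _ mA mB.
rewrite -lee_fin EFinD -(probE mA) -(probE mB) -(probE mU).
exact: measureU2.
Qed.

Lemma prob_setY_I A A' B : measurable A -> measurable A' -> measurable B ->
  m (A `&` B) <= m (A' `&` B) + m (A `+` A').
Proof.
move=> mA mA' mB.
have mY : measurable (A `+` A') by apply: measurableU; exact: measurableD.
have mI : measurable (A' `&` B) by exact: measurableI.
apply: le_trans (probU_le mI mY); apply: prob_sub.
- exact: measurableI.
- exact: measurableU.
- move=> x [Ax Bx]; have [A'x|nA'x] := pselect (A' x); first by left.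
  by right; left.
Qed.

Section density_of_content.
Variable l : set X -> R.
Hypothesis l_ge0 : forall A, measurable A -> 0 <= l A.
Hypothesis lU : forall A B, measurable A -> measurable B -> A `&` B = set0 ->
  l (A `|` B) = l A + l B.
Hypothesis l_le : forall A, measurable A -> l A <= m A.

Let nu A : \bar R := if pselect (measurable A) then (l A)%:E else 0%E.

Let nuE A : measurable A -> nu A = (l A)%:E.
Proof. by move=> mA; rewrite /nu; case: pselect. Qed.

Let m_set0 : m set0 = 0. Proof. by rewrite /prob measure0. Qed.

Let l_set0 : l set0 = 0.
Proof.
by apply/eqP; rewrite eq_le l_ge0// andbT -m_set0 l_le.
Qed.

Let nu0 : nu set0 = 0%E. Proof. by rewrite nuE// l_set0. Qed.

Let nu_ge0 A : (0 <= nu A)%E.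
Proof. by rewrite /nu; case: pselect => // mA; rewrite lee_fin l_ge0. Qed.

Let bigsetU_sum (k : set X -> R) (F : (set X)^nat) n : k set0 = 0 ->
  (forall A B, measurable A -> measurable B -> A `&` B = set0 ->
    k (A `|` B) = k A + k B) ->
  (forall i, measurable (F i)) -> trivIset setT F ->
  k (\big[setU/set0]_(i < n) F i) = \sum_(i < n) k (F i).
Proof.
move=> k0 kU mF tF; elim: n => [|n IH]; first by rewrite !big_ord0.
rewrite !big_ord_recr /= kU ?IH//; first exact: bigsetU_measurable.
rewrite -bigcup_mkord -subset0 => x [[i /= ni Fix] Fnx].
have ne : i != n by rewrite neq_ltn ni.
by have /seteqP[h _] := trivIsetP.1 tF i n I I ne; exact: (h x).
Qed.

Let nu_sigma_additive : semi_sigma_additive nu.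
Proof.
move=> F mF tF mUF.
have mk n : measurable (\big[setU/set0]_(i < n) F i) by exact: bigsetU_measurable.
have sub n : \big[setU/set0]_(i < n) F i `<=` \bigcup_i F i.
  by rewrite -bigcup_mkord => x [i _ Fix]; exists i.
pose T n := m (\bigcup_i F i) - \sum_(i < n) m (F i).
have T0 : T n @[n --> \oo] --> 0.
  have /fine_cvgP[_ h] : (fun n => \sum_(0 <= i < n) mu (F i))%E @ \oo -->
      (m (\bigcup_i F i))%:E.
    by rewrite -(probE mUF); exact: measure_semi_sigma_additive.
  rewrite -(subrr (m (\bigcup_i F i))); apply: cvgB; first exact: cvg_cst.
  apply: cvg_trans h; apply: near_eq_cvg; apply: nearW => n /=.
  rewrite big_mkord (eq_bigr (fun i : 'I_n => (m (F i))%:E)) ?sumEFin//.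
  by move=> i _; exact: probE.
have lT n : 0 <= l (\bigcup_i F i) - \sum_(i < n) l (F i) <= T n.
  have mD := measurableD mUF (mk n).
  have dec (k : set X -> R) : k set0 = 0 ->
      (forall A B, measurable A -> measurable B -> A `&` B = set0 ->
        k (A `|` B) = k A + k B) ->
      k (\bigcup_i F i) - \sum_(i < n) k (F i) =
      k (\bigcup_i F i `\` \big[setU/set0]_(i < n) F i).
    move=> k0 kU; rewrite -(bigsetU_sum n k0 kU mF tF).
    rewrite -{1}(setDUK (sub n)) kU//; last by rewrite setDIK.
    by rewrite addrC addKr.
  rewrite dec// /T dec//; last exact: probU.
  by rewrite l_ge0//= l_le.
rewrite nuE//; apply/fine_cvgP; split.
  apply: nearW => n; under eq_bigr do rewrite nuE//.
  by rewrite sumEFin.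
apply/cvgrPdist_lt => e e0; have /cvgrPdist_lt/(_ _ e0) := T0.
apply: filterS => n; rewrite sub0r normrN => Te /=.
rewrite big_mkord; under eq_bigr do rewrite nuE//.
have /andP[h1 h2] := lT n; rewrite sumEFin /= ger0_norm//.
by apply: le_lt_trans Te; apply: le_trans h2 (ler_norm _).
Qed.

HB.instance Definition _ :=
  isMeasure.Build d X R nu nu0 nu_ge0 nu_sigma_additive.

Let nu_fin : fin_num_fun nu.
Proof. by move=> A mA; rewrite nuE. Qed.

HB.instance Definition _ := Measure_isFinite.Build d X R nu nu_fin.

(** Domination by the probability turns finite additivity into countable
    additivity, so that the Radon-Nikodym theorem applies. *)
Lemma density_of_content : exists a : X -> R,
  [/\ measurable_fun setT a, forall x, 0 <= a x <= 1,
      forall C s, measurable C -> (forall x, C x -> s < a x) -> s * m C <= l C &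
      forall C t, measurable C -> (forall x, C x -> a x < t) -> l C <= t * m C].
Proof.
pose nu' : {finite_measure set X -> \bar R} := nu.
have dom : nu' `<< mu.
  apply/null_content_dominatesP => A mA A0; rewrite /nu' /= nuE//.
  have := l_le mA; have := l_ge0 mA; rewrite /prob A0 /= => h1 h2.
  by congr (_%:E); apply/eqP; rewrite eq_le h1 h2.
have [f [f0 ffin fint fE]] := radon_nikodym_sigma_finite dom.
have mf : measurable_fun setT f by exact: measurable_int fint.
exists (fun x => Num.min 1 (fine (f x))); split.
- apply: measurable_minr; first exact: measurable_cst.
  by apply: measurableT_comp => //; exact: measurable_fun_fine.
- by move=> x; rewrite ge_min lexx/= le_min ler01/= fine_ge0.
- move=> C s mC sC; have [s0|s0] := leP s 0.
    by apply: (le_trans _ (l_ge0 mC)); rewrite mulr_le0_ge0// prob_ge0.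
  rewrite -lee_fin -(nuE mC) [leRHS](fE C mC) EFinM -(probE mC) -integral_cst//.
  apply: ge0_le_integral => //.
  + by move=> x _; rewrite lee_fin ltW.
  + exact: measurable_funTS.
  + move=> x /sC; rewrite lt_min => /andP[_ sf] /=.
    by rewrite -[f x]fineK// lee_fin ltW.
- move=> C t mC Ct.
  have [t1|t1] := ltP 1 t.
    by apply: (le_trans (l_le mC)); rewrite ler_peMl ?prob_ge0// ltW.
  rewrite -lee_fin -(nuE mC) [leLHS](fE C mC) EFinM -(probE mC) -integral_cst//.
  apply: ge0_le_integral => //.
  + exact: measurable_funTS.
  + move=> x /Ct; rewrite gt_min ltNge t1/= => ft.
    by rewrite -[f x]fineK// lee_fin ltW.
Qed.

End density_of_content.
End density.

(** * Functions with a uniformly continuous orbit *)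

Lemma measurable_lt_cst d (T : measurableType d) (R : realType) (u : T -> R) (r : R) :
  measurable_fun setT u -> measurable [set x | u x < r].
Proof.
move=> mu_; rewrite (_ : mkset _ = setT `&` u @^-1` `]-oo, r[%classic).
  by apply: mu_ => //; exact: measurable_itv.
by rewrite setTI; apply/seteqP; split => x /=; rewrite in_itv/=.
Qed.

Lemma transports_lt d (T : measurableType d) d' (X : measurableType d')
    (R : realType) (mu : {measure set X -> \bar R}) (s : set T -> set X)
    (f : T -> R) (h : X -> R) :
  transports mu s f h ->
  forall r, ae_same mu [set x | h x < r] (s [set t | f t < r]).
Proof.
move=> fh r; have E V (u : V -> R) : [set x | u x < r] = u @^-1` `]-oo, r[%classic.
  by apply/seteqP; split => x /=; rewrite in_itv/=.
by rewrite (E X h) (E T f); apply: fh; exact: measurable_itv.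
Qed.

Section uniformly_continuous_functions.
Context d (X : measurableType d) (R : realType) (mu : probability X R).
Context (G : topologicalGroupType) (sg : G -> set X -> set X).
Hypothesis sgP : algebra_action mu sg.
Implicit Types A B C : set X.
Local Notation m := (prob mu).
Local Notation e := (1%g : G).

Let sgm g := aa_morphism sgP g.
Let msg g A : measurable A -> measurable (sg g A).
Proof. exact: (sm_measurable (sgm g)). Qed.

Let m_sg g A : measurable A -> m (sg g A) = m A.
Proof. by move=> mA; rewrite /prob (sm_measure (sgm g)). Qed.

Let mY A B : measurable A -> measurable B -> measurable (A `+` B).
Proof. by move=> mA mB; apply: measurableU; exact: measurableD. Qed.

(** Functions on [X] whose orbit is continuous at [1] for the sup norm. *)
Definition uniformly_continuous (a : X -> R) := forall delta : R, 0 < delta ->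
  \forall h \near nbhs e, \forall x \ae mu, `|push (sg h) a x - a x| <= delta.

Lemma sg_setY g h A : measurable A ->
  m (sg g A `+` sg h A) = m (sg (g^-1 * h)%g A `+` A).
Proof.
move=> mA; have mgh := msg (g^-1 * h)%g mA; have mgA := msg g mA; have mhA := msg h mA.
rewrite -[RHS](m_sg g); last exact: mY.
apply: prob_ae_same; [exact: mY|by apply: msg; exact: mY|].
have gM : ae_same mu (sg h A) (sg g (sg (g^-1 * h)%g A)).
  by have := aa_M sgP g (g^-1 * h)%g mA; rewrite mulVKg.
have D1 := sm_D (sgm g) mgh mA; have D2 := sm_D (sgm g) mA mgh.
have U := sm_U (sgm g) (measurableD mgh mA) (measurableD mA mgh).
apply: ae_same_sym; apply: ae_same_trans U _; rewrite [X in ae_same _ _ X]setYC.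
apply: ae_sameU.
- apply: ae_same_trans D1 _; rewrite !setDE; apply: ae_sameI.
    exact: ae_same_sym.
  exact: ae_same_refl.
- apply: ae_same_trans D2 _; rewrite !setDE; apply: ae_sameI.
    exact: ae_same_refl.
  by apply: ae_sameC; exact: ae_same_sym.
Qed.

Hypothesis hausG : hausdorff_space G.
Hypothesis lcG : locally_compact [set: G].

(** Locally compact Hausdorff groups are completely regular. *)
Lemma bump_function (V : set G) : nbhs e V -> exists phi : G -> R,
  [/\ continuous phi, forall g, 0 <= phi g <= 1, phi e = 1 &
      forall g, ~ V g -> phi g = 0].
Proof.
move=> nV; have cB : closed (~` V^°) by apply: open_closedC; exact: open_interior.
have nB : ~ (~` V^°) e by apply.
have /(uniform_separatorP (R := R))[f [cf f01 f0 f1]] :=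
  @locally_compact_completely_regular G R lcG hausG e (~` V^°) cB nB.
have fb g : 0 <= f g <= 1 by have := f01 (f g) (ex_intro2 _ _ g I erefl); rewrite /= in_itv.
exists (fun g => 1 - f g); split.
- by move=> g; apply: cvgB; [exact: cvg_cst|exact: cf].
- by move=> g; have := fb g; lra.
- by have -> : f e = 0; [apply: f0; exists e|rewrite subr0].
- move=> g nVg; have -> : f g = 1; last by rewrite subrr.
  by apply: f1; exists g => // /interior_subset.
Qed.

Section averaging.
Variables (Y : set X) (mYs : measurable Y).
Variables (I : (G -> R) -> R) (IP : haar_functional I).
Variables (phi : G -> R) (cphi : continuous phi).
Hypothesis phi01 : forall g, 0 <= phi g <= 1.
Hypothesis phi_bounded : compactly_bounded phi.
Hypothesis Iphi : 0 < I phi.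

(** The matrix coefficient of the translates of [Y] against [B]. *)
Let coeff B g : R := m (sg g Y `&` B).

Let coeff_le B g : measurable B -> 0 <= coeff B g <= m B.
Proof.
move=> mB; rewrite prob_ge0/=; apply: prob_sub => //; first by apply: measurableI => //; exact: msg.
Qed.

Let coeff_continuous B : measurable B -> continuous (coeff B).
Proof.
move=> mB g; apply/cvgrPdist_lt => eps eps0.
have := near_mulVg g (aa_continuous sgP mYs eps0); apply: filterS => h.
have mgY := msg g mYs; have mhY := msg h mYs; have mgh := msg (g^-1 * h)%g mYs.
rewrite (probE mu (mY mgh mYs)) lte_fin -sg_setY// => gh.
apply: le_lt_trans gh; rewrite ler_norml; apply/andP; split.
  by have := prob_setY_I mu mhY mgY mB; rewrite setYC /coeff; lra.
by have := prob_setY_I mu mgY mhY mB; rewrite /coeff; lra.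
Qed.

Let pc B g := phi g * coeff B g.

Let pc_bounded B : measurable B -> compactly_bounded (pc B).
Proof.
move=> mB; apply: compactly_bounded_le (compactly_boundedZ (prob_ge0 mu B) phi_bounded) _.
move=> g; have /andP[c0 cB] := coeff_le g mB; have /andP[p0 _] := phi01 g.
by rewrite /pc mulr_ge0//= mulrC ler_wpM2r.
Qed.

Let pc_continuous B : measurable B -> continuous (pc B).
Proof. by move=> mB g; apply: cvgM; [exact: cphi|exact: coeff_continuous]. Qed.

(** The mean of the measures of [gY `&` B] with weight [phi g]: formally the
    integral over [B] of the convolution of [phi] with the indicator of [Y]. *)
Definition average B : R := I (pc B) / I phi.

Lemma average_ge0 B : measurable B -> 0 <= average B.
Proof.
by move=> mB; rewrite divr_ge0// ?(ltW Iphi)// (haar_ge0 IP)//; exact: pc_bounded.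
Qed.

Lemma averageU A B : measurable A -> measurable B -> A `&` B = set0 ->
  average (A `|` B) = average A + average B.
Proof.
move=> mA mB AB; rewrite /average -mulrDl -(haar_additive IP).
- congr (I _ / _); apply/funext => g; rewrite /pc -mulrDr /coeff setIUr probU//.
  + by apply: measurableI => //; exact: msg.
  + by apply: measurableI => //; exact: msg.
  + by rewrite setIACA AB setI0.
- exact: (pc_bounded mA).
- exact: (pc_bounded mB).
- exact: (pc_continuous mA).
- exact: (pc_continuous mB).
Qed.

Lemma average_le_of B (c : R) : measurable B -> 0 <= c ->
  (forall g, phi g != 0 -> coeff B g <= c) -> average B <= c.
Proof.
move=> mB c0 h; rewrite /average ler_pdivrMr// -(haarZ IP)//.
apply: (haar_le IP); [exact: pc_bounded|exact: compactly_boundedZ|move=> g].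
rewrite /pc mulrC; have /andP[p0 _] := phi01 g.
have [->|pn0] := eqVneq (phi g) 0; first by rewrite !mulr0.
by rewrite ler_wpM2r// h.
Qed.

Lemma average_le B : measurable B -> average B <= m B.
Proof.
move=> mB; apply: average_le_of => //; first exact: prob_ge0.
by move=> g _; have /andP[] := coeff_le g mB.
Qed.

Lemma average_ge_of B (c : R) : measurable B ->
  (forall g, phi g != 0 -> c <= coeff B g) -> c <= average B.
Proof.
move=> mB h; have [c0|c0] := leP c 0; first exact: le_trans c0 (average_ge0 mB).
rewrite /average ler_pdivlMr// -(haarZ IP) ?(ltW c0)//.
apply: (haar_le IP); [exact: compactly_boundedZ (ltW c0) _|exact: pc_bounded|move=> g].
rewrite /pc mulrC; have /andP[p0 _] := phi01 g.
have [->|pn0] := eqVneq (phi g) 0; first by rewrite !mul0r.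
by rewrite ler_wpM2l// h.
Qed.

(** Translating the average amounts to translating [phi]: this is where the
    invariance of the Haar functional turns the weak continuity of the action
    into continuity for the sup norm. *)
Lemma average_translate (eta : R) : 0 < eta -> \forall h \near nbhs e,
  forall B, measurable B -> `|average (sg h^-1%g B) - average B| <= eta * m B.
Proof.
move=> eta0; have [U0 nU0 cU0] := compact_nbhs1 lcG.
have [K [M [cK bK zK]]] := phi_bounded.
pose C := (U0 `*` K); pose D := K `|` [set (z.1 * z.2)%g | z in C].
have cD : compact D.
  apply: compactU => //; apply: continuous_compact; last exact: compact_setX.
  by apply: continuous_subspaceT; exact: mulg_continuous.
have bD := compactly_bounded_indic R cD.
have ID0 := haar_ge0 IP bD.
pose eps := eta * I phi / (I \1_D + 1).
have D1 : 0 < I \1_D + 1 by rewrite ltr_wpDl.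
have eps0 : 0 < eps by rewrite divr_gt0// mulr_gt0.
have /near_invg h1 := left_unif_continuous phi_bounded cphi eps0.
apply: filterS2 h1 nU0 => h hphi Uh B mB.
have msB := msg h^-1%g mB.
have shift : I (pc (sg h^-1%g B)) = I (fun g => phi (h^-1 * g)%g * coeff B g).
  pose psi g := phi (h^-1 * g)%g * coeff B g.
  have bpsi : compactly_bounded psi.
    apply: compactly_bounded_le (compactly_boundedZ (prob_ge0 mu B)
      (compactly_bounded_translate h^-1%g phi_bounded)) _.
    move=> g; have /andP[c0 cB] := coeff_le g mB; have /andP[p0 _] := phi01 (h^-1 * g)%g.
    by rewrite /psi mulr_ge0//= mulrC ler_wpM2r.
  rewrite -[RHS](haar_invariant IP h bpsi); congr (I _); apply/funext => g.
  rewrite /psi mulKg /pc; congr (_ * _); rewrite /coeff.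
  have mgY := msg g mYs; have mhgY := msg (h * g)%g mYs.
  rewrite -(m_sg h); last exact: measurableI.
  apply: prob_ae_same; [by apply: msg; exact: measurableI|exact: measurableI|].
  apply: ae_same_trans (sm_I (sgm h) mgY msB) _; apply: ae_sameI.
    exact/ae_same_sym/(aa_M sgP).
  exact: algebra_action_invK.
pose err g := eps * m B * \1_D g : R.
have em0 : 0 <= eps * m B by rewrite mulr_ge0 ?prob_ge0// ltW.
have berr : compactly_bounded err := compactly_boundedZ em0 bD.
have err_le g : `|phi (h^-1 * g)%g * coeff B g - phi g * coeff B g| <= err g.
  have /andP[c0 cB] := coeff_le g mB.
  rewrite -mulrBl normrM (ger0_norm c0) /err indicE.
  have [Dg|nDg] := pselect (D g).
    by rewrite mem_set// mulr1 ler_pM// ltW.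
  have nK : ~ K g by move=> Kg; apply: nDg; left.
  have nK' : ~ K (h^-1 * g)%g.
    move=> Kg; apply: nDg; right; exists (h, (h^-1 * g)%g) => //=.
    by rewrite mulVKg.
  by rewrite memNset// (zK _ nK) (zK _ nK') subrr normr0 mul0r mulr0.
have Ierr : I err = eps * m B * I \1_D by exact: haarZ.
have bshift : compactly_bounded (fun g => phi (h^-1 * g)%g * coeff B g).
  apply: compactly_bounded_le (compactly_boundedD (pc_bounded mB) berr) _ => g.
  have /andP[c0 cB] := coeff_le g mB; have /andP[p0 _] := phi01 (h^-1 * g)%g.
  by rewrite mulr_ge0//=; have := err_le g; rewrite /pc ler_norml => /andP[_]; lra.
have up : I (pc (sg h^-1%g B)) <= I (pc B) + I err.
  rewrite shift; apply: le_trans (haar_subadditive IP (pc_bounded mB) berr).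
  apply: (haar_le IP) => //; first exact: compactly_boundedD (pc_bounded mB) berr.
  by move=> g; have := err_le g; rewrite /pc ler_norml => /andP[_]; lra.
have lo : I (pc B) <= I (pc (sg h^-1%g B)) + I err.
  rewrite shift; apply: le_trans (haar_subadditive IP bshift berr).
  apply: (haar_le IP); [exact: pc_bounded|exact: compactly_boundedD|].
  by move=> g; have := err_le g; rewrite /pc ler_norml => /andP[+ _]; lra.
have errB : I err <= eta * m B * I phi.
  rewrite Ierr /eps.
  have -> : eta * I phi / (I \1_D + 1) * m B * I \1_D =
      eta * m B * I phi * (I \1_D / (I \1_D + 1)) by ring.
  rewrite ler_piMr ?mulr_ge0 ?prob_ge0// ?(ltW eta0)// ?(ltW Iphi)//.
  by rewrite ler_pdivrMr// mul1r lerDl.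
rewrite /average -mulrBl normrM (gtr0_norm (_ : 0 < (I phi)^-1)) ?invr_gt0//.
by rewrite ler_pdivrMr// ler_norml; apply/andP; split; lra.
Qed.

End averaging.

(** The density of the average of [Y] over a small neighbourhood of [1] is close to
    the indicator of [Y] in measure, because the translates of [Y] involved are,
    and its orbit is continuous for the sup norm by [average_translate].  The
    threshold 1/2 separates the densities near 1 from those near 0. *)
Theorem uniformly_continuous_dense (Y : set X) (eps : R) : measurable Y -> 0 < eps ->
  exists a : X -> R, [/\ measurable_fun setT a, forall x, 0 <= a x <= 1,
    uniformly_continuous a & m ([set x | 2^-1 < a x] `+` Y) < eps].
Proof.
move=> mYs eps0; have [I IP] := haar_functional_exists R lcG.
have [U0 nU0 cU0] := compact_nbhs1 lcG.
pose r := eps / 8; have r0 : 0 < r by rewrite divr_gt0.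
pose V := U0 `&` [set g | (mu (sg g Y `+` Y) < r%:E)%E].
have nV : nbhs e V by apply: filterI => //; exact: (aa_continuous sgP).
have [phi [cphi phi01 phi1 phi0]] := bump_function nV.
have bphi : compactly_bounded phi.
  exists U0, 1; split => // g nU; apply: phi0 => -[Ug _]; exact: nU.
have Iphi : 0 < I phi by apply: (haar_gt0 IP) => //; rewrite phi1.
pose l := average Y I phi.
have l_ge0 := average_ge0 mYs IP phi01 bphi Iphi.
have l_le := average_le mYs IP phi01 bphi Iphi.
have lU := averageU mYs IP cphi phi01 bphi.
have [a [ma a01 a_gt a_lt]] := density_of_content l_ge0 lU l_le.
have near_Y B g : measurable B -> phi g != 0 ->
    m (Y `&` B) - r <= m (sg g Y `&` B) <= m (Y `&` B) + r.
  move=> mB pg; have mgY := msg g mYs.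
  have [_ +] : V g by apply: contrapT => /phi0/eqP; rewrite (negbTE pg).
  rewrite /= (probE mu (mY mgY mYs)) lte_fin => gr.
  have := prob_setY_I mu mgY mYs mB; have := prob_setY_I mu mYs mgY mB.
  by rewrite setYC; lra.
exists a; split => //.
- move=> delta delta0; apply: filterS (average_translate mYs IP cphi phi01 bphi Iphi delta0).
  move=> h hl; have th := transports_push (sgm h) ma.
  pose b := push (sg h) a; have mb : measurable_fun setT b := measurable_push (sgm h) ma.
  (* A set on which two densities of almost equal measures differ by more than
     [delta] is null. *)
  have null s t B : measurable B -> t + delta < s ->
      s * m B <= t * m B + delta * m B -> \forall x \ae mu, ~ B x.
    move=> mB ts h'; apply/(measurable_null mu mB); apply: (etrans (probE mu mB)).
    have := prob_ge0 mu B; rewrite le_eqVlt => /orP[/eqP <-//|B0].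
    by move: h'; rewrite -mulrDl ler_pM2r// leNgt ts.
  (* Level sets of the translate of [a] are images of level sets of [a], up to a
     null set; the bounds on densities require genuine inclusions. *)
  have pulled B P : measurable B -> measurable P -> ae_sub mu B (sg h P) ->
      exists C, [/\ measurable C, C `<=` P, m C = m B & l C = l (sg h^-1%g B)].
    move=> mB mP BP; pose C := sg h^-1%g B `&` P.
    have msB := msg h^-1%g mB; have mC : measurable C by exact: measurableI.
    have CB : ae_same mu C (sg h^-1%g B).
      apply: ae_sub_anti; first by apply: subset_ae_sub => x [].
      have sP' : ae_sub mu (sg h^-1%g B) P.
        apply: (sm_ae_sub_inj (sgm h)) => //.
        exact: ae_sub_trans (ae_same_sub (algebra_action_invK h sgP mB)) BP.
      by move: sP'; rewrite /ae_sub; apply: filterS => x h1 h2; split=> //; exact: h1.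
    exists C; split => //; first by move=> x [].
      by rewrite (prob_ae_same mC msB CB) m_sg.
    rewrite /l /average; congr (I _ / _); apply/funext => g; congr (_ * _).
    have mgY := msg g mYs.
    apply: prob_ae_same; [exact: measurableI|exact: measurableI|].
    by apply: ae_sameI => //; exact: ae_same_refl.
  have up (s t : rat) : \forall x \ae mu,
      ratr t + delta < ratr s -> ~ (ratr s < b x /\ a x < ratr t).
    have [ts|ts] := ltP (ratr t + delta) (ratr s); last by apply: aeW.
    pose B := [set x | ratr s < b x] `&` [set x | a x < ratr t].
    have mB : measurable B by apply: measurableI; [exact: measurable_gt|exact: measurable_lt_cst].
    suff : \forall x \ae mu, ~ B x by apply: filterS => x nB _ [? ?]; apply: nB.
    apply: (null _ _ _ mB ts).
    have [|C [mC CP mCB lC]] := pulled B _ mB (measurable_gt (ratr s) ma).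
      apply: ae_sub_trans (ae_same_sub (transports_gt th (ratr s))).
      by apply: subset_ae_sub => x [].
    have E1 : ratr s * m C <= l C := a_gt C _ mC CP.
    have E2 : `|l (sg h^-1%g B) - l B| <= delta * m B := hl B mB.
    have E3 : l B <= ratr t * m B := a_lt B (ratr t) mB (fun x Bx => Bx.2).
    by rewrite mCB lC in E1; move: E2; rewrite ler_norml => /andP[_]; lra.
  have lo (s t : rat) : \forall x \ae mu,
      ratr t + delta < ratr s -> ~ (ratr s < a x /\ b x < ratr t).
    have [ts|ts] := ltP (ratr t + delta) (ratr s); last by apply: aeW.
    pose B := [set x | ratr s < a x] `&` [set x | b x < ratr t].
    have mB : measurable B by apply: measurableI; [exact: measurable_gt|exact: measurable_lt_cst].
    suff : \forall x \ae mu, ~ B x by apply: filterS => x nB _ [? ?]; apply: nB.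
    apply: (null _ _ _ mB ts).
    have [|C [mC CP mCB lC]] := pulled B _ mB (measurable_lt_cst (ratr t) ma).
      apply: ae_sub_trans (ae_same_sub (transports_lt th (ratr t))).
      by apply: subset_ae_sub => x [].
    have E1 : ratr s * m B <= l B := a_gt B _ mB (fun x Bx => Bx.1).
    have E2 : `|l (sg h^-1%g B) - l B| <= delta * m B := hl B mB.
    have E3 : l C <= ratr t * m C := a_lt C (ratr t) mC CP.
    by rewrite mCB lC in E3; move: E2; rewrite ler_norml => /andP[+ _]; lra.
  have all_up := ae_forall_countable (fun s => ae_forall_countable (up s)).
  have all_lo := ae_forall_countable (fun s => ae_forall_countable (lo s)).
  have between (u v : R) : delta < v - u ->
      exists s t : rat, [/\ ratr t + delta < ratr s, ratr s < v & u < ratr t].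
    move=> uv; have uv' : u + delta < v by lra.
    have [s] := rat_in_itvoo uv'; rewrite in_itv/= => /andP[us sv].
    have us' : u < ratr s - delta by lra.
    have [t] := rat_in_itvoo us'.
    by rewrite in_itv/= => /andP[ut ts]; exists s, t; split=> //; lra.
  apply: filterS2 all_up all_lo => x ux lx; rewrite leNgt ltr_normr.
  apply/negP => /orP[|]; rewrite ?opprB => /between[s [t [ts h1 h2]]].
    exact: (ux s t ts).
  exact: (lx s t ts).
- have mA := measurable_gt 2^-1 ma; set A := [set x | _] in mA *.
  have mAY := measurableD mA mYs; have mYA := measurableD mYs mA.
  have disj : (A `\` Y) `&` (Y `\` A) = set0.
    by rewrite -subset0 => x [[Ax _] [_ nA]].
  rewrite /setY probU//.
  have h1 : m (A `\` Y) <= 2 * r.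
    have E1 : 2^-1 * m (A `\` Y) <= l (A `\` Y).
      exact: (a_gt (A `\` Y) 2^-1 mAY (fun x Ax => Ax.1)).
    have E2 : l (A `\` Y) <= r.
      apply: average_le_of => //; first exact: ltW.
      move=> g pg; have /andP[_] := near_Y (A `\` Y) g mAY pg.
      by rewrite setDIK /prob measure0 add0r.
    lra.
  have h2 : m (Y `\` A) <= 4 * r.
    have E1 : l (Y `\` A) <= 3 / 4 * m (Y `\` A).
      apply: a_lt => // x [_ /negP]; rewrite -leNgt => ax.
      by apply: (le_lt_trans ax); lra.
    have E2 : m (Y `\` A) - r <= l (Y `\` A).
      apply: average_ge_of => // g pg; have /andP[+ _] := near_Y (Y `\` A) g mYA pg.
      by rewrite (setIidr (@subDsetl _ Y A)).
    lra.
  by rewrite /r in h1 h2; lra.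
Qed.

End uniformly_continuous_functions.

(** * The joint essential range of a family of functions *)

(** The topology of [T], for the structures that require a distinguished point. *)
Definition pointed_at (T : Type) (x0 : T) : Type := T.

HB.instance Definition _ (T : topologicalType) (x0 : T) :=
  Topological.copy (pointed_at x0) T.
HB.instance Definition _ (T : topologicalType) (x0 : T) :=
  isPointed.Build (pointed_at x0) x0.

Section essential_range.
Context d (X : measurableType d) (R : realType) (mu : probability X R).
Context (J : choiceType) (b : J -> X -> R).
Hypothesis mb : forall k, measurable_fun setT (b k).
Local Notation m := (prob mu).

Definition cylinder (s : seq J) (v : J -> R) (eps : R) : set X :=
  [set x | forall k, k \in s -> `|b k x - v k| < eps].

Lemma cylinder_cons k s v eps :
  cylinder (k :: s) v eps = [set x | `|b k x - v k| < eps] `&` cylinder s v eps.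
Proof.
apply/seteqP; split => x h.
  by split=> [|j js]; apply: h; rewrite inE ?eqxx// js orbT.
by move=> j; rewrite inE => /orP[/eqP ->|]; [exact: h.1|exact: h.2].
Qed.

Lemma measurable_cylinder s v eps : measurable (cylinder s v eps).
Proof.
elim: s => [|k s IH]; first by rewrite (_ : cylinder _ _ _ = setT)//; apply/seteqP.
rewrite cylinder_cons; apply: measurableI => //.
rewrite (_ : mkset _ = [set x | b k x < v k + eps] `&` [set x | v k - eps < b k x]).
  by apply: measurableI; [exact: measurable_lt_cst|exact: measurable_gt].
apply/seteqP; split=> x /=; rewrite ltr_distl; first by move=> /andP[? ?]; split.
by move=> [? ?]; apply/andP.
Qed.

Lemma cylinder_sub s s' v v' eps eps' : {subset s <= s'} ->
  (forall k, k \in s -> `|v' k - v k| + eps' <= eps) ->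
  cylinder s' v' eps' `<=` cylinder s v eps.
Proof.
move=> ss' h x cx k ks; apply: lt_le_trans (h k ks).
have -> : b k x - v k = (v' k - v k) + (b k x - v' k) by ring.
by apply: le_lt_trans (ler_normD _ _) _; rewrite ltrD2l; exact/cx/ss'.
Qed.

(** [v] belongs to the support of the joint distribution of the family [b]
    restricted to [E]. *)
Definition essential_value (E : set X) (v : J -> R) := forall s eps, 0 < eps ->
  0 < m (E `&` cylinder s v eps).

Let Omega := prod_topology (fun _ : J => (R : topologicalType)).

Let nbhs_proj (v : Omega) (s : seq J) (eps : R) : 0 < eps ->
  nbhs v [set w : Omega | forall k, k \in s -> `|w k - v k| < eps].
Proof.
move=> e0; elim: s => [|k s IH]; first by apply: filterS filterT => w _ j.
have /cvgrPdist_lt/(_ _ e0) : (fun w : Omega => (w k : R)) @ v --> (v k : R).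
  exact: (@proj_continuous _ (fun _ : J => (R : topologicalType)) k v).
apply: filterS2 IH => w ws wk j; rewrite inE => /orP[/eqP ->|/ws//].
by rewrite distrC.
Qed.

Let basis_proj (v : Omega) (U : set Omega) : nbhs v U -> exists (s : seq J) (eps : R), 0 < eps /\
  [set w : Omega | forall k, k \in s -> `|w k - v k| < eps] `<=` U.
Proof.
pose F : set_system Omega := [set U | exists (s : seq J) (eps : R), 0 < eps /\
  [set w : Omega | forall k, k \in s -> `|w k - v k| < eps] `<=` U].
have FF : Filter F.
  split.
  - by exists [::], 1; split.
  - move=> P Q [s1 [e1 [e10 h1]]] [s2 [e2 [e20 h2]]].
    exists (s1 ++ s2), (Num.min e1 e2); split; first by rewrite lt_min e10.
    move=> w h; split; [apply: h1|apply: h2] => k ks.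
      by have := h k; rewrite mem_cat ks lt_min => /(_ isT)/andP[].
    by have := h k; rewrite mem_cat ks orbT lt_min => /(_ isT)/andP[].
  - by move=> P Q PQ [s [e [e0 h]]]; exists s, e; split => //; exact: subset_trans PQ.
suff Fv : F --> v by move=> /Fv.
apply/cvg_sup => k V [/= _ [[W oW <-] Wv]] WV; apply: filterS WV _.
have : nbhs (v k : R) W by apply: open_nbhs_nbhs; split.
move=> /nbhs_ballP[e /= e0 eW]; exists [:: k], e; split => // w h /=.
by apply: eW; rewrite /ball /= distrC; apply: h; rewrite inE.
Qed.

Hypothesis b01 : forall k x, 0 <= b k x <= 1.

(** Compactness of the cube makes every set of positive measure carry an
    essential value. *)
Lemma essential_value_exists E : measurable E -> 0 < m E ->
  exists v, essential_value E v.
Proof.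
move=> mE E0.
pose F : set_system Omega := [set U | \forall x \ae mu, E x -> U (b ^~ x)].
have FF : ProperFilter F.
  split.
  - rewrite /F /= => N; have : \forall x \ae mu, ~ E x by apply: filterS N => x.
    move/(measurable_null mu mE) => E00; move: E0.
    by rewrite /prob E00 ltxx.
  - split.
    + by apply: aeW.
    + by move=> P Q; rewrite /F /=; apply: filterS2 => x h1 h2 Ex; split; auto.
    + by move=> P Q PQ; rewrite /F /=; apply: filterS => x h Ex; apply: PQ; auto.
have cQ := @tychonoff J (fun _ => (R : topologicalType)) (fun _ => `[0, 1]%classic)
  (fun _ => @segment_compact R 0 1).
have [|v [_ clv]] := cQ F FF.
  by apply: aeW => x _ k; rewrite /= in_itv /=.
exists v => s eps e0; rewrite lt_neqAle prob_ge0 andbT; apply/eqP => N.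
have mC := measurableI _ _ mE (measurable_cylinder s v eps).
have FW : F (~` [set w : Omega | forall k, k \in s -> `|w k - v k| < eps]).
  have : \forall x \ae mu, ~ (E `&` cylinder s v eps) x.
    apply/(measurable_null mu mC); apply: (etrans (probE mu mC)); by rewrite -N.
  by apply: filterS => x h Ex hx; apply: h.
by have [w [nW W]] := clv _ _ FW (nbhs_proj v s e0).
Qed.

Lemma essential_value01 v k : essential_value setT v -> 0 <= v k <= 1.
Proof.
move=> Kv; apply/andP; split.
- rewrite leNgt; apply/negP => v0; have e0 : 0 < - v k by rewrite oppr_gt0.
  have := Kv [:: k] _ e0; rewrite (_ : _ `&` _ = set0) /prob ?measure0 ?ltxx//.
  rewrite -subset0 => x [_ /(_ k)]; rewrite inE => /(_ (eqxx _)).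
  by have /andP[b0 _] := b01 k x; rewrite ltr_norml => /andP[_]; lra.
- rewrite leNgt; apply/negP => v0; have e0 : 0 < v k - 1 by rewrite subr_gt0.
  have := Kv [:: k] _ e0; rewrite (_ : _ `&` _ = set0) /prob ?measure0 ?ltxx//.
  rewrite -subset0 => x [_ /(_ k)]; rewrite inE => /(_ (eqxx _)).
  by have /andP[_ b1] := b01 k x; rewrite ltr_norml => /andP[+ _]; lra.
Qed.

Let Kset : set Omega := [set v | essential_value setT v].

Let compact_K : compact Kset.
Proof.
pose Q : set Omega := [set v | forall k, `[0, 1]%classic (v k)].
have cQ : compact Q := @tychonoff J (fun _ => (R : topologicalType))
  (fun _ => `[0, 1]%classic) (fun _ => @segment_compact R 0 1).
apply: (@subclosed_compact _ Kset Q) => //.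
- move=> v clv s eps e0; have e2 : 0 < eps / 2 by rewrite divr_gt0.
  have [w [Kw wv]] := clv _ (nbhs_proj v s e2).
  apply: lt_le_trans (Kw s _ e2) _; apply: prob_sub.
  + by apply: measurableI => //; exact: measurable_cylinder.
  + by apply: measurableI => //; exact: measurable_cylinder.
  + apply: setIS; apply: cylinder_sub => // k ks.
    by have := wv k ks; lra.
- by move=> v Kv k; rewrite /= in_itv /=; exact: essential_value01.
Qed.

(** The joint essential range of the family [b]: a compact space [K] with
    coordinates [c]. *)
Theorem essential_range : exists (K : ptopologicalType) (c : J -> K -> R),
  [/\ compact [set: K], forall k, continuous (c k),
    forall (w : K) U, nbhs w U -> exists (s : seq J) (eps : R), 0 < eps /\
      [set w' | forall k, k \in s -> `|c k w' - c k w| < eps] `<=` U,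
    forall w w', (forall k, c k w = c k w') -> w = w' &
    (forall w, essential_value setT (c ^~ w)) /\
    (forall v, essential_value setT v -> exists w, forall k, c k w = v k)].
Proof.
have [|v0 Kv0] := @essential_value_exists setT measurableT.
  by rewrite /prob probability_setT.
have x0 : set_type Kset := exist _ (v0 : Omega) (mem_set Kv0).
pose K : ptopologicalType := pointed_at x0.
pose c k (w : K) : R := (set_val (w : set_type Kset) : Omega) k.
have val_c : continuous (set_val : set_type Kset -> Omega) by exact: initial_continuous.
exists K, c; split.
- move=> F FF _.
  have [|v [Kv clv]] := compact_K (F := set_val @ F) _.
    have : F (set_val @^-1` Kset) by apply: filterS (@filterT _ F _) => -[w Kw] _; exact: set_mem.
    by [].
  pose w : set_type Kset := exist _ v (mem_set Kv).
  exists (w : K); split => // A B FA [_ [[V oV <-] Vw] VB].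
  have [u [[u' Au' <-] Vu]] : (set_val @` A) `&` V !=set0.
    apply: clv; last by apply: open_nbhs_nbhs; split.
    suff : F (set_val @^-1` (set_val @` A)) by [].
    by apply: (@filterS _ F _ A) => // y Ay; exists y.
  by exists u'; split => //; exact: VB.
- move=> k w; apply: (@continuous_comp _ _ _ (set_val : set_type Kset -> Omega)
    (fun v : Omega => v k)); first exact: val_c.
  exact: (@proj_continuous _ (fun _ : J => (R : topologicalType)) k).
- move=> w U [_ [[V oV <-] Vw] VU].
  have [|s [eps [e0 sV]]] := @basis_proj (set_val (w : set_type Kset)) V.
    by apply: open_nbhs_nbhs; split.
  by exists s, eps; split => // w' h; apply: VU; exact: sV.
- move=> w w' ww'; apply: val_inj; apply: functional_extensionality_dep => k.
  exact: ww'.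
- split; first by move=> [w Kw]; exact: (set_mem Kw).
  by move=> v Kv; exists (exist _ (v : Omega) (mem_set Kv) : set_type Kset) => k.
Qed.

End essential_range.

(** * The image measure on the essential range *)

Lemma exists_invSn_le (R : realType) (eps : R) : 0 < eps ->
  exists n : nat, n.+1%:R^-1 <= eps.
Proof.
move=> eps0; exists (Num.bound eps^-1).
rewrite -[leRHS]invrK lef_pV2 ?posrE ?invr_gt0// ltW//.
apply: (lt_le_trans (archi_boundP _)); first by rewrite invr_ge0 ltW.
by rewrite ler_nat.
Qed.

Section essential_supremum.
Context d (X : measurableType d) (R : realType) (mu : probability X R).
Implicit Types A B U : set X.
Local Notation m := (prob mu).

Lemma prob_le_ae_sub A B : measurable A -> measurable B ->
  (forall eps : R, 0 < eps -> m (A `\` B) <= eps) -> ae_sub mu A B.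
Proof.
move=> mA mB h; have mD := measurableD mA mB.
apply/(ae_sub_measureD mu mA mB); apply: (etrans (probE mu mD)); congr (_%:E).
apply/eqP; rewrite eq_le prob_ge0 andbT; apply/ler_addgt0Pr => eps eps0.
by rewrite add0r h.
Qed.

Lemma probD_ae A B : measurable A -> measurable B -> ae_sub mu B A ->
  m (A `\` B) = m A - m B.
Proof.
move=> mA mB BA; rewrite (probDI mu mA mB) [X in _ + X - _](_ : _ = m B) ?addrK//.
apply: prob_ae_same => //; first exact: measurableI.
by move: BA; rewrite /ae_sub /ae_same; apply: filterS => x h; split=> [[]//|Bx]; split; auto.
Qed.

Lemma prob_bigcup_le (A : (set X)^nat) (eps : R) : (forall n, measurable (A n)) ->
  0 <= eps -> (forall n, m (A n) <= eps / (2 ^ n.+1)%:R) -> m (\bigcup_n A n) <= eps.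
Proof.
move=> mA e0 h; have mU := bigcupT_measurable _ mA.
rewrite -lee_fin -(probE mu mU); apply: le_trans (epsilon_trick0 xpredT e0).
apply: (@le_trans _ _ (\sum_(n <oo) mu (A n))%E).
  exact: (@measure_sigma_subadditive _ _ _ mu (\bigcup_n A n) A mA mU (@subset_refl _ _)).
apply: lee_nneseries => // n _.
apply: (@le_trans _ _ (m (A n))%:E); last by rewrite lee_fin.
by rewrite le_eqVlt; apply/orP; left; apply/eqP/(probE mu).
Qed.

Lemma prob_le1 A : measurable A -> m A <= 1.
Proof. by move=> mA; rewrite -lee_fin -(probE mu mA); exact: probability_le1. Qed.

(** Substitute for the union of a possibly uncountable family: the union of
    countably many members whose measures approach the supremum already contains
    every member up to a null set, since a member that left it would, by
    directedness, give one of measure above the supremum. *)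
Lemma ess_sup_directed (F : set (set X)) : F !=set0 ->
  (forall A, F A -> measurable A) ->
  (forall A B, F A -> F B -> exists2 C, F C & ae_sub mu A C /\ ae_sub mu B C) ->
  exists U, [/\ measurable U, forall A, F A -> ae_sub mu A U &
    forall eps : R, 0 < eps -> exists2 A, F A & m (U `\` A) < eps].
Proof.
move=> F0 mF dirF; pose S := sup [set m A | A in F].
have hS : has_sup [set m A | A in F].
  split; first by have [A FA] := F0; exists (m A), A.
  by exists 1 => _ [A FA <-]; exact/prob_le1/mF.
have S_ub A : F A -> m A <= S by move=> FA; apply: sup_upper_bound => //; exists A.
have /choice[B BP] : forall n : nat, exists A, F A /\ S - n.+1%:R^-1 < m A.
  move=> n; have n0 : 0 < n.+1%:R^-1 :> R by rewrite invr_gt0.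
  by have [_ [A FA <-] SA] := sup_adherent n0 hS; exists A.
have FB n : F (B n) := (BP n).1; have SB n := (BP n).2; have mB n := mF _ (FB n).
pose U := \bigcup_n B n; have mU : measurable U by exact: bigcupT_measurable.
pose V n := \big[setU/set0]_(i < n.+1) B i.
have mV n : measurable (V n) by exact: bigsetU_measurable.
have FV n : exists2 C, F C & ae_sub mu (V n) C.
  elim: n => [|n [C FC VC]].
    exists (B 0%N) => //; rewrite /V big_ord_recl big_ord0 setU0.
    exact: subset_ae_sub.
  have [D FD [CD BD]] := dirF _ _ FC (FB n.+1); exists D => //.
  rewrite /V big_ord_recr /=; have VD := ae_sub_trans VC CD.
  by move: VD BD; rewrite /ae_sub; apply: filterS2 => x h1 h2 [/h1|/h2].
have US : m U <= S.
  have cv : mu (V n) @[n --> \oo] --> mu U.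
    rewrite (_ : U = \bigcup_n V n).
      apply: nondecreasing_cvg_mu => //; first exact: bigcupT_measurable.
      by apply/nondecreasing_seqP => n; rewrite subsetEset /V [X in _ `<=` X]big_ord_recr /=; left.
    apply/seteqP; split=> [x [n _ Bx]|x [n _]].
      by exists n => //; rewrite /V big_ord_recr /=; right.
    by rewrite /V -bigcup_mkord => -[i _ Bx]; exists i.
  move: cv; rewrite (probE mu mU) => /fine_cvgP[_ cv].
  apply: (cvgr_to_le cv); apply: nearW => n.
  have [C FC VC] := FV n; apply: le_trans (S_ub _ FC).
  by apply: prob_ae_sub => //; exact: mF.
exists U; split => //.
- move=> A FA; have mA := mF _ FA; apply: prob_le_ae_sub => // eps eps0.
  have [n ne] := exists_invSn_le eps0.
  apply: le_trans ne; have [C FC [AC BC]] := dirF _ _ FA (FB n); have mC := mF _ FC.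
  apply: (@le_trans _ _ (m (C `\` B n))).
    apply: prob_ae_sub; [exact: measurableD|exact: measurableD|].
    move: AC; rewrite /ae_sub; apply: filterS => x h [/h Cx nU]; split => // Bx.
    by apply: nU; exists n.
  rewrite (probD_ae mC (mB n) BC); have h1 := S_ub _ FC; have h2 := SB n.
  by rewrite lerBlDr; apply: (le_trans h1); rewrite -lerBlDl ltW.
- move=> eps eps0; have [n ne] := exists_invSn_le eps0.
  exists (B n) => //; rewrite probD_ae//; last by apply: subset_ae_sub => x Bx; exists n.
  apply: lt_le_trans ne; rewrite ltrBlDr; apply: (le_lt_trans US).
  by rewrite -ltrBlDl.
Qed.

End essential_supremum.

Section topological_model.
Context d (X : measurableType d) (R : realType) (mu : probability X R).
Context (J : choiceType) (b : J -> X -> R) (K : ptopologicalType) (c : J -> K -> R).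
Local Notation m := (prob mu).
Local Notation cyl := (cylinder b).
Hypothesis mb : forall k, measurable_fun setT (b k).
Hypothesis K_compact : compact [set: K].
Hypothesis c_continuous : forall k, continuous (c k).
Hypothesis K_basis : forall (w : K) U, nbhs w U ->
  exists (s : seq J) (eps : R), 0 < eps /\
    [set w' | forall k, k \in s -> `|c k w' - c k w| < eps] `<=` U.
Hypothesis c_essential : forall w, essential_value mu b setT (c ^~ w).
Hypothesis c_realised : forall v, essential_value mu b setT v ->
  exists w, forall k, c k w = v k.
Hypothesis value_exists : forall E, measurable E -> 0 < m E ->
  exists v, essential_value mu b E v.
Implicit Types (E A : set X) (U V W Y : set K).

Let mcyl s v eps : measurable (cyl s v eps).
Proof. exact: measurable_cylinder. Qed.

(** The carrier of [E] is the support of the distribution of the coordinates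
    restricted to [E]. *)
Definition carrier E : set K := [set w | essential_value mu b E (c ^~ w)].

Lemma essential_valueS E E' v : measurable E -> measurable E' -> ae_sub mu E E' ->
  essential_value mu b E v -> essential_value mu b E' v.
Proof.
move=> mE mE' EE' h s eps e0; apply: lt_le_trans (h s eps e0) _.
apply: prob_ae_sub; [exact: measurableI|exact: measurableI|].
by move: EE'; rewrite /ae_sub; apply: filterS => x h' [/h'].
Qed.

Lemma carrierS E E' : measurable E -> measurable E' -> ae_sub mu E E' ->
  carrier E `<=` carrier E'.
Proof. by move=> mE mE' EE' w; exact: essential_valueS. Qed.

Lemma carrierU E E' : measurable E -> measurable E' ->
  carrier (E `|` E') `<=` carrier E `|` carrier E'.
Proof.
move=> mE mE' w hw; have [|nE] := pselect (carrier E w); first by left.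
have [|nE'] := pselect (carrier E' w); first by right.
have neg F : measurable F -> ~ carrier F w -> exists s eps, 0 < eps /\
    m (F `&` cyl s (c ^~ w) eps) = 0.
  move=> mF /existsNP[s /existsNP[eps /not_implyP[e0 /negP]]].
  rewrite -leNgt => h; exists s, eps; split => //.
  by apply/eqP; rewrite eq_le h prob_ge0.
have [s1 [e1 [e10 z1]]] := neg _ mE nE; have [s2 [e2 [e20 z2]]] := neg _ mE' nE'.
exfalso; have e0 : 0 < Num.min e1 e2 by rewrite lt_min e10.
have := hw (s1 ++ s2) _ e0; apply/negP; rewrite -leNgt.
have m1 : measurable (E `&` cyl s1 (c ^~ w) e1) by exact: measurableI.
have m2 : measurable (E' `&` cyl s2 (c ^~ w) e2) by exact: measurableI.
rewrite -[leRHS](addr0 0) -{1}z1 -z2; apply: le_trans (probU_le mu m1 m2).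
apply: prob_sub; first by apply: measurableI => //; exact: measurableU.
  exact: measurableU.
move=> x [[Ex|Ex] Cx]; [left|right]; split => // k ks; have := Cx k.
  by rewrite mem_cat ks lt_min => /(_ isT)/andP[].
by rewrite mem_cat ks orbT lt_min => /(_ isT)/andP[].
Qed.

Lemma carrier_neq0 E : measurable E -> 0 < m E -> exists w, carrier E w.
Proof.
move=> mE /(value_exists mE)[v Ev].
have /c_realised[w wv] : essential_value mu b setT v.
  exact: (essential_valueS mE measurableT (subset_ae_sub _ (@subsetT _ E))).
by exists w; rewrite /carrier /= (_ : c ^~ w = v)//; apply/funext.
Qed.

Lemma carrier_eq0 E : measurable E -> (forall w, ~ carrier E w) -> m E = 0.
Proof.
move=> mE E0; apply/eqP; rewrite eq_le prob_ge0 andbT leNgt; apply/negP.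
by move=> /(carrier_neq0 mE)[w]; exact: E0.
Qed.

Lemma near_coordinates (w : K) (s : seq J) (eps : R) : 0 < eps ->
  \forall w' \near w, forall k, k \in s -> `|c k w' - c k w| < eps.
Proof.
move=> e0; elim: s => [|k s IH]; first by apply: filterS filterT => w' _ j.
have /cvgrPdist_lt/(_ _ e0) := @c_continuous k w.
apply: filterS2 IH => w' ws wk j; rewrite inE => /orP[/eqP ->|/ws//].
by rewrite distrC.
Qed.

Lemma closed_carrier E : measurable E -> closed (carrier E).
Proof.
move=> mE w clw s eps e0; have e2 : 0 < eps / 2 by rewrite divr_gt0.
have [w' [Ew' ww']] := clw _ (near_coordinates w s e2).
apply: lt_le_trans (Ew' s _ e2) _; apply: prob_sub; [exact: measurableI|exact: measurableI|].
by apply: setIS; apply: cylinder_sub => // k ks; have := ww' k ks; lra.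
Qed.

Lemma compact_carrier E : measurable E -> compact (carrier E).
Proof. by move=> mE; exact: subclosed_compact (closed_carrier mE) K_compact _. Qed.

(** The carrier of a cylinder lies in the closed cylinder on [K] of the same
    radius, so that halving the radius of a basic neighbourhood is enough. *)
Lemma cylinder_carrier (w : K) W : open W -> W w -> exists (s : seq J) (eps : R),
  0 < eps /\ carrier (cyl s (c ^~ w) eps) `<=` W.
Proof.
move=> oW Ww; have [|s [eps [e0 sW]]] := @K_basis w W.
  exact: open_nbhs_nbhs.
have e2 : 0 < eps / 2 by rewrite divr_gt0.
exists s, (eps / 2); split => // w' /(_ s _ e2) h; apply: sW => k ks.
have [x [/(_ k ks) h1 /(_ k ks) h2]] : exists x,
    (cyl s (c ^~ w) (eps / 2) `&` cyl s (c ^~ w') (eps / 2)) x.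
  apply/set0P/eqP => E; move: h; rewrite E /prob measure0 /=.
  by rewrite ltxx.
by move: h1 h2; rewrite !ltr_norml => /andP[? ?] /andP[? ?]; apply/andP; split; lra.
Qed.

Let carried W : set (set X) := [set E | measurable E /\ carrier E `<=` W].

Let open_part_exists W : exists P, [/\ measurable P,
    forall E, measurable E -> carrier E `<=` W -> ae_sub mu E P &
    forall eps : R, 0 < eps -> exists2 E, measurable E /\ carrier E `<=` W &
      m (P `\` E) < eps].
Proof.
have [||A B [mA AW] [mB BW]|P [mP PA Pe]] := @ess_sup_directed _ _ _ mu (carried W).
- exists set0; split => // w /(_ [::] _ (@ltr01 R)).
  by rewrite set0I /prob measure0 /= ltxx.
- by move=> A [].
- exists (A `|` B); last by split; apply: subset_ae_sub => x; [left|right].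
  split; first exact: measurableU.
  by move=> w /(carrierU mA mB)[/AW|/BW].
- by exists P; split=> // E mE EW; apply: PA.
Qed.

(** The largest measurable set, up to null sets, carried by [W]; for open [W]
    this plays the part of the inverse image of [W] under a map from [X]
    to [K]. *)
Definition open_part W : set X := projT1 (cid (open_part_exists W)).
Local Notation opart := open_part.

Lemma measurable_open_part W : measurable (opart W).
Proof. by rewrite /open_part; case: cid => P []. Qed.
Local Notation mop := measurable_open_part.

Lemma open_part_ub W E : measurable E -> carrier E `<=` W -> ae_sub mu E (opart W).
Proof. by rewrite /open_part; case: cid => P [/= ? h _]; exact: h. Qed.

Lemma open_part_approx W (eps : R) : 0 < eps ->
  exists E, [/\ measurable E, carrier E `<=` W & m (opart W `\` E) < eps].
Proof.
rewrite /open_part; case: cid => P [/= _ _ h] /h[E [mE EW] PE].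
by exists E.
Qed.

Lemma open_part_sub W A : measurable A ->
  (forall E, measurable E -> carrier E `<=` W -> ae_sub mu E A) ->
  ae_sub mu (opart W) A.
Proof.
move=> mA h; apply: prob_le_ae_sub => // [|eps e0]; first exact: mop.
have [E [mE EW PE]] := open_part_approx W e0; apply: le_trans (ltW PE).
apply: prob_ae_sub; [exact: measurableD (mop W) _|exact: measurableD (mop W) _|].
have := h E mE EW; rewrite /ae_sub; apply: filterS => x EA [Px nA]; split => //.
by move=> /EA.
Qed.

Lemma open_partS W W' : W `<=` W' -> ae_sub mu (opart W) (opart W').
Proof.
move=> WW'; apply: open_part_sub => [|E mE EW]; first exact: mop.
by apply: open_part_ub => //; exact: subset_trans WW'.
Qed.

(** If part of [E] were missed, that part would carry a point of some [W n], hence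
    meet a cylinder carried by [W n] in positive measure. *)
Lemma open_part_cover E (W : (set K)^nat) : measurable E -> (forall n, open (W n)) ->
  carrier E `<=` \bigcup_n W n -> ae_sub mu E (\bigcup_n opart (W n)).
Proof.
move=> mE oW EW; have mU : measurable (\bigcup_n opart (W n)).
  by apply: bigcupT_measurable => n; exact: mop.
have mD := measurableD mE mU.
apply: prob_le_ae_sub => // eps e0; rewrite (_ : m _ = 0) ?ltW//.
apply: carrier_eq0 => // w Dw.
have [|n _ Wnw] := EW w.
  by apply: carrierS Dw => //; apply: subset_ae_sub => x [].
have [s [eps' [e0' sW]]] := cylinder_carrier (oW n) Wnw.
have := Dw s eps' e0'; rewrite (_ : m _ = 0) ?ltxx//.
have mI := measurableI _ _ mD (mcyl s (c ^~ w) eps').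
have : \forall x \ae mu, ~ ((E `\` \bigcup_n opart (W n)) `&` cyl s (c ^~ w) eps') x.
  have := open_part_ub (mcyl s (c ^~ w) eps') sW; rewrite /ae_sub.
  by apply: filterS => x h [[_ nU] /h Wx]; apply: nU; exists n.
by move=> /(measurable_null mu mI) N; rewrite /prob N.
Qed.

Lemma open_part_bigcup (W : (set K)^nat) : (forall n, open (W n)) ->
  ae_sub mu (opart (\bigcup_n W n)) (\bigcup_n opart (W n)).
Proof.
move=> oW; apply: open_part_sub => [|E mE EW].
  by apply: bigcupT_measurable => n; exact: mop.
exact: open_part_cover.
Qed.

Lemma open_partT : \forall x \ae mu, opart setT x.
Proof.
have := open_part_ub measurableT (@subsetT _ (carrier setT)).
by rewrite /ae_sub; apply: filterS => x; apply.
Qed.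

(** The intersection has no carrier, and only null sets have none. *)
Lemma carried_disjoint E E' : measurable E -> measurable E' ->
  carrier E `&` carrier E' = set0 -> ae_sub mu E (~` E').
Proof.
move=> mE mE' EE'; have mI := measurableI _ _ mE mE'.
have I0 : m (E `&` E') = 0.
  apply: carrier_eq0 => // w Iw.
  suff : (carrier E `&` carrier E') w by rewrite EE'.
  by split; apply: carrierS Iw => //; apply: subset_ae_sub => x [].
have /(measurable_null mu mI) : mu (E `&` E') = 0%E.
  by apply: (etrans (probE mu mI)); rewrite I0.
by rewrite /ae_sub; apply: filterS => x h Ex E'x; apply: h.
Qed.

Lemma open_part_disjoint W E : measurable E -> W `&` carrier E = set0 ->
  ae_sub mu (opart W) (~` E).
Proof.
move=> mE WE; apply: open_part_sub => [|E' mE' E'W]; first exact: measurableC.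
apply: carried_disjoint => //; rewrite -subset0 => w [E'w Ew].
by rewrite -WE; split=> //; exact: E'W.
Qed.

Let outer_exists Y : exists P, [/\ measurable P,
    forall W, open W -> Y `<=` W -> ae_sub mu P (opart W) &
    forall eps : R, 0 < eps -> exists W, [/\ open W, Y `<=` W &
      m (opart W `\` P) < eps]].
Proof.
pose F : set (set X) := [set ~` opart W | W in [set W | open W /\ Y `<=` W]].
have [||_ _ [W [oW YW] <-] [W' [oW' YW'] <-]|P [mP PA Pe]] :=
  @ess_sup_directed _ _ _ mu F.
- by exists (~` opart setT), setT => //; split => //; exact: openT.
- by move=> _ [W _ <-]; apply: measurableC; exact: mop.
- exists (~` opart (W `&` W')).
    exists (W `&` W') => //; split; first exact: openI.
    by move=> w Yw; split; [exact: YW|exact: YW'].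
  have h1 := open_partS (@subIsetl _ W W'); have h2 := open_partS (@subIsetr _ W W').
  split; [move: h1|move: h2]; rewrite /ae_sub; apply: filterS => x h nW /h; exact: nW.
- exists (~` P); split; first exact: measurableC.
    move=> W oW YW; have : ae_sub mu (~` opart W) P by apply: PA; exists W.
    rewrite /ae_sub; apply: filterS => x h nP; apply: contrapT => nW; exact/nP/h.
  move=> eps e0; have [_ [W [oW YW] <-] PW] := Pe eps e0; exists W; split => //.
  by move: PW; rewrite !setDE !setCK setIC.
Qed.

(** The inverse image of an arbitrary set [Y], approximated from outside by the
    parts of its open neighbourhoods. *)
Definition inverse_part Y : set X := projT1 (cid (outer_exists Y)).
Local Notation tau := inverse_part.

Lemma measurable_inverse_part Y : measurable (tau Y).
Proof. by rewrite /inverse_part; case: cid => P []. Qed.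
Local Notation mtau := measurable_inverse_part.

Lemma inverse_part_lb Y W : open W -> Y `<=` W -> ae_sub mu (tau Y) (opart W).
Proof. by rewrite /inverse_part; case: cid => P [/= _ h _]; exact: h. Qed.

Lemma inverse_part_approx Y (eps : R) : 0 < eps -> exists W, [/\ open W, Y `<=` W &
  m (opart W `\` tau Y) < eps].
Proof. by rewrite /inverse_part; case: cid => P [/= _ _ h]; exact: h. Qed.

Lemma inverse_part_greatest Y A : measurable A ->
  (forall W, open W -> Y `<=` W -> ae_sub mu A (opart W)) -> ae_sub mu A (tau Y).
Proof.
move=> mA h; apply: prob_le_ae_sub => // [|eps e0]; first exact: mtau.
have [W [oW YW Wt]] := inverse_part_approx Y e0; apply: le_trans (ltW Wt).
apply: prob_ae_sub; [exact: measurableD (mtau Y)|exact: measurableD (mop W) (mtau Y)|].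
have := h W oW YW; rewrite /ae_sub; apply: filterS => x AW [Ax nt]; split => //.
exact: AW.
Qed.

Lemma inverse_part_open W : open W -> ae_same mu (tau W) (opart W).
Proof.
move=> oW; apply: ae_sub_anti; first exact: inverse_part_lb.
apply: inverse_part_greatest => [|V oV WV]; first exact: mop.
exact: open_partS.
Qed.

Lemma inverse_partS Y Y' : Y `<=` Y' -> ae_sub mu (tau Y) (tau Y').
Proof.
move=> YY'; apply: inverse_part_greatest => [|V oV WV]; first exact: mtau.
by apply: inverse_part_lb => //; exact: subset_trans WV.
Qed.

Lemma inverse_part_carrier E : measurable E -> ae_sub mu E (tau (carrier E)).
Proof.
by move=> mE; apply: inverse_part_greatest => // W oW EW; exact: open_part_ub.
Qed.

Lemma inverse_part_setU Y : \forall x \ae mu, tau Y x \/ tau (~` Y) x.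
Proof.
have mD : measurable (~` tau (~` Y)) by apply: measurableC; exact: mtau.
suff h : ae_sub mu (~` tau (~` Y)) (tau Y).
  move: h; rewrite /ae_sub; apply: filterS => x h.
  by have [|/h] := pselect (tau (~` Y) x); [right|left].
apply: inverse_part_greatest => // W oW YW.
suff h : ae_sub mu (~` opart W) (tau (~` Y)).
  move: h; rewrite /ae_sub; apply: filterS => x h nt.
  by apply: contrapT => nW; exact/nt/h.
apply: inverse_part_greatest => [|W' oW' YW']; first by apply: measurableC; exact: mop.
pose F n := if n is 0%N then W else W'.
have oF n : open (F n) by case: n.
have FT : \bigcup_n F n = setT.
  rewrite -subTset => w _; have [/YW Ww|/YW' Ww] := pselect (Y w).
    by exists 0%N.
  by exists 1%N.
have := open_part_bigcup oF; rewrite FT /ae_sub.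
by apply: filterS2 open_partT => x Tx /(_ Tx)[[|n] _ //=].
Qed.

Lemma inverse_part_bigcup (Y : (set K)^nat) :
  ae_sub mu (tau (\bigcup_n Y n)) (\bigcup_n tau (Y n)).
Proof.
have mU : measurable (\bigcup_n tau (Y n)).
  by apply: bigcupT_measurable => n; exact: mtau.
apply: prob_le_ae_sub => // [|eps e0]; first exact: mtau.
have /choice[W WP] : forall n, exists W, [/\ open W, Y n `<=` W &
    m (opart W `\` tau (Y n)) < eps / (2 ^ n.+1)%:R].
  by move=> n; apply: inverse_part_approx; rewrite divr_gt0// ltr0n expn_gt0.
have oW n : open (W n) by have [] := WP n.
have YW n : Y n `<=` W n by have [] := WP n.
have mWD n : measurable (opart (W n) `\` tau (Y n)) := measurableD (mop _) (mtau _).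
have mD := measurableD (mtau (\bigcup_n Y n)) mU.
have sub : ae_sub mu (tau (\bigcup_n Y n) `\` \bigcup_n tau (Y n))
    (\bigcup_n (opart (W n) `\` tau (Y n))).
  have h1 := @inverse_part_lb (\bigcup_n Y n) (\bigcup_n W n)
    (bigcup_open (fun n _ => oW n)) (subset_bigcup (fun n _ => YW n)).
  have h2 := open_part_bigcup oW; have := ae_sub_trans h1 h2; rewrite /ae_sub.
  apply: filterS => x h [/h[n _ Wx] nU]; exists n => //; split => // tx.
  by apply: nU; exists n.
apply: le_trans (prob_ae_sub mD (bigcupT_measurable _ mWD) sub) _.
by apply: prob_bigcup_le => //; [exact: ltW|move=> n; have [_ _ /ltW] := WP n].
Qed.

(** Since the parts of [Y] and of its complement cover [X], these are the sets
    that [inverse_part] splits exactly, as the measurable sets of Caratheodory;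
    they form a sigma-algebra that contains the open sets. *)
Let good Y := \forall x \ae mu, ~ (tau Y x /\ tau (~` Y) x).

Let good_open W : open W -> good W.
Proof.
move=> oW; have h : ae_sub mu (opart W) (~` tau (~` W)).
  apply: open_part_sub => [|E mE EW]; first by apply: measurableC; exact: mtau.
  have h1 : ae_sub mu (tau (~` W)) (opart (~` carrier E)).
    by apply: inverse_part_lb; [exact/closed_openC/closed_carrier|exact: subsetC].
  have h2 : ae_sub mu (opart (~` carrier E)) (~` E).
    by apply: open_part_disjoint => //; rewrite setICl.
  have := ae_sub_trans h1 h2; rewrite /ae_sub; apply: filterS => x h Ex /h; exact.
have := ae_same_sub (inverse_part_open oW); move: h; rewrite /good /ae_sub.
by apply: filterS2 => x h1 h2 [/h2/h1].
Qed.

Let goodC Y : good Y -> good (~` Y).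
Proof. by rewrite /good setCK; apply: filterS => x h [h1 h2]; apply: h. Qed.

Let good_bigcup (Y : (set K)^nat) : (forall n, good (Y n)) -> good (\bigcup_n Y n).
Proof.
move=> gY; have h1 := inverse_part_bigcup Y.
have h2 : \forall x \ae mu, forall n, tau (~` \bigcup_n Y n) x -> tau (~` Y n) x.
  apply: ae_foralln => n; apply: inverse_partS; apply: subsetC => w Yw.
  by exists n.
have h3 := ae_foralln gY; move: h1; rewrite /good /ae_sub.
apply: filterS3 h2 h3 => x h2 h3 h1 [/h1[n _ tn] /(h2 n) tCn].
exact: (h3 n).
Qed.

Let good_borel (Y : set (borel K)) : measurable Y -> good Y.
Proof.
apply: (@smallest_sub _ _ (@open K) good); last exact: good_open.
split => [|A gA|F gF].
- exact/good_open/open0.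
- by rewrite setTD; exact: goodC.
- exact: good_bigcup.
Qed.

Lemma inverse_partC (Y : set (borel K)) : measurable Y ->
  ae_same mu (tau (~` Y)) (~` tau Y).
Proof.
move=> /good_borel; rewrite /good /ae_same; apply: filterS2 (inverse_part_setU Y).
by move=> x [h2|h2] h1; split=> // h3; [exfalso|move=> ?]; apply: h1.
Qed.

Lemma inverse_part_bigcup_same (Y : (set K)^nat) :
  ae_same mu (tau (\bigcup_n Y n)) (\bigcup_n tau (Y n)).
Proof.
apply: ae_sub_anti; first exact: inverse_part_bigcup.
have : \forall x \ae mu, forall n, tau (Y n) x -> tau (\bigcup_n Y n) x.
  by apply: ae_foralln => n; apply: inverse_partS => w Yw; exists n.
by rewrite /ae_sub; apply: filterS => x h [n _ /h].
Qed.

Definition image_measure (Y : set (borel K)) : \bar R := mu (tau Y).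
Local Notation nu := image_measure.

Let tau0 : \forall x \ae mu, ~ tau set0 x.
Proof.
have := good_open (@open0 K); have := ae_same_sub (ae_same_sym (inverse_part_open openT)).
rewrite /good setC0 /ae_sub; apply: filterS3 open_partT => x T h h' t0.
by apply: h'; split=> //; exact: h.
Qed.

Let nu0 : nu set0 = 0%E.
Proof. exact: (measurable_null mu (mtau set0)).2 tau0. Qed.

Let nu_ge0 Y : (0 <= nu Y)%E. Proof. exact: measure_ge0. Qed.

Let nu_sigma_additive : semi_sigma_additive nu.
Proof.
move=> F mF tF mUF; pose A n := tau (F n); pose D := seqDU A.
have mA n : measurable (A n) by exact: mtau.
have mD n : measurable (D n) by exact: (seqDU_measurable mA).
have disj n i : i != n -> \forall x \ae mu, ~ (A i x /\ A n x).
  move=> ni; have Fin : F i `<=` ~` F n.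
    move=> w Fiw Fnw; have : (F i `&` F n) w by [].
    by rewrite (trivIsetP.1 tF i n I I ni).
  have := inverse_partS Fin; have := good_borel (mF n); rewrite /ae_sub /good.
  by apply: filterS2 => x h1 h2 [/h2 ? ?]; apply: h1.
have DA n : nu (F n) = mu (D n).
  suff : ae_same mu (A n) (D n) by exact: measure_ae_same (mA n) (mD n).
  have : \forall x \ae mu, forall i, i != n -> ~ (A i x /\ A n x).
    apply: ae_foralln => i; have [->|ni] := eqVneq i n; first exact: aeW.
    by apply: filterS (disj n i ni) => x h _.
  rewrite /ae_same; apply: filterS => x h; split=> [Ax|[]//].
  split => //; rewrite -bigcup_mkord => -[i /= lt_in Aix].
  have ni : i != n by rewrite neq_ltn lt_in.
  exact: (h i ni (conj Aix Ax)).
have UE : nu (\bigcup_n F n) = mu (\bigcup_n D n).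
  rewrite -seqDU_bigcup_eq; apply: measure_ae_same => //; first exact: mtau.
    exact: bigcupT_measurable.
  exact: inverse_part_bigcup_same.
rewrite UE (_ : (fun n => _) = (fun n => \sum_(0 <= i < n) mu (D i))%E).
  apply: (@measure_semi_sigma_additive _ _ _ mu) => //; first exact: trivIset_seqDU.
  exact: bigcupT_measurable.
by apply/funext => n; apply: eq_bigr => i _.
Qed.

HB.instance Definition _ :=
  isMeasure.Build _ (borel K) R nu nu0 nu_ge0 nu_sigma_additive.

Let nu_setT : nu setT = 1%E.
Proof.
rewrite /nu -(@probability_setT _ _ _ mu); apply: measure_ae_same => //; first exact: mtau.
have := ae_same_sub (ae_same_sym (inverse_part_open openT)).
by rewrite /ae_sub /ae_same; apply: filterS2 open_partT => x T h; split=> // _; exact: h.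
Qed.

HB.instance Definition _ := Measure_isProbability.Build _ (borel K) R nu nu_setT.

Definition image_probability : probability (borel K) R := nu.

Lemma inverse_part_morphism : set_morphism image_probability mu tau.
Proof.
split => [Y _|Y _//|Y mY|Y _]; first exact: mtau.
  exact: inverse_partC.
exact: inverse_part_bigcup_same.
Qed.

Let nuE Y : nu Y = (m (tau Y))%:E.
Proof. exact: (probE mu (mtau Y)). Qed.

Let m_open W : open W -> m (tau W) = m (opart W).
Proof.
move=> oW; apply: prob_ae_same; [exact: mtau|exact: mop|exact: inverse_part_open].
Qed.

Let outer_approx Y (eps : R) : 0 < eps ->
  exists W, [/\ open W, Y `<=` W & m (tau W) < m (tau Y) + eps].
Proof.
move=> e0; have [W [oW YW We]] := inverse_part_approx Y e0; exists W; split => //.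
move: We; rewrite (probD_ae (mop W) (mtau Y) (inverse_part_lb oW YW)) (m_open oW).
by rewrite ltrBlDl.
Qed.

Let inner_approx W (eps : R) : open W -> 0 < eps ->
  exists C, [/\ compact C, C `<=` W & m (tau W) < m (tau C) + eps].
Proof.
move=> oW e0; have [E [mE EW We]] := open_part_approx W e0.
exists (carrier E); split => //; first exact: compact_carrier.
have EP := open_part_ub mE EW; move: We; rewrite (probD_ae (mop W) mE EP) (m_open oW).
have := prob_ae_sub mE (mtau (carrier E)) (inverse_part_carrier mE); lra.
Qed.

Let m_tauS Y Y' : Y `<=` Y' -> m (tau Y) <= m (tau Y').
Proof. by move=> YY'; apply: prob_ae_sub; [exact: mtau|exact: mtau|exact: inverse_partS]. Qed.

(** Built in: [inverse_part] is defined by outer approximation with open sets, and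
    [open_part] by inner approximation with sets of compact carrier. *)
Lemma image_measure_regular : regular_measure image_probability.
Proof.
split => [Y mY|W oW].
- apply/eqP; rewrite eq_le; apply/andP; split.
    apply: le_ereal_inf_tmp => _ [W [oW YW] <-]; rewrite /= !nuE lee_fin.
    exact: m_tauS.
  apply/lee_addgt0Pr => eps e0; have [W [oW YW We]] := outer_approx Y e0.
  apply: (@le_trans _ _ (nu W)); first by apply: ereal_inf_lbound; exists W.
  by rewrite /= !nuE -EFinD lee_fin ltW.
- apply/eqP; rewrite eq_le; apply/andP; split; last first.
    apply: ge_ereal_sup => _ [C [cC CW] <-]; rewrite /= !nuE lee_fin.
    exact: m_tauS.
  apply/lee_addgt0Pr => eps e0; have [C [cC CW We]] := inner_approx oW e0.
  apply: (@le_trans _ _ (nu C + eps%:E)%E).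
    by rewrite /= !nuE -EFinD lee_fin ltW.
  by rewrite leeD2r//; apply: ereal_sup_ubound; exists C.
Qed.

Lemma image_measure_support : measure_support image_probability = setT.
Proof.
rewrite -subTset => w _ U oU Uw; rewrite /= nuE lte_fin (m_open oU).
have [s [eps [e0 sU]]] := cylinder_carrier oU Uw.
have := c_essential w s e0; rewrite setTI => h; apply: lt_le_trans h _.
by apply: prob_ae_sub => //; [exact: mop|exact: open_part_ub].
Qed.

(** A map of points from [X] to [K] would have coordinates [b]. *)
Lemma inverse_part_coordinate k r :
  ae_same mu (tau [set w | r < c k w]) [set x | r < b k x].
Proof.
have oW : open [set w | r < c k w].
  rewrite (_ : mkset _ = c k @^-1` `]r, +oo[%classic).
    by apply: open_comp => // w _; exact: c_continuous.
  by apply/seteqP; split => w /=; rewrite in_itv/= andbT.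
have mbk := measurable_gt r (mb k).
apply: ae_same_trans (inverse_part_open oW) _; apply: ae_sub_anti.
  apply: open_part_sub => // E mE EW.
  have mlow : measurable (E `\` [set x | r < b k x]) by exact: measurableD.
  apply: prob_le_ae_sub => // e e0; rewrite (_ : m _ = 0) ?ltW//.
  apply: carrier_eq0 => // w Dw.
  have rw : r < c k w.
    apply: EW; apply: carrierS Dw => //.
    by apply: subset_ae_sub => x [].
  have d0 : 0 < c k w - r by rewrite subr_gt0.
  have := Dw [:: k] _ d0; rewrite (_ : _ `&` _ = set0) /prob ?measure0 ?ltxx//.
  rewrite -subset0 => x [[_ /negP]]; rewrite -leNgt => br /(_ k).
  by rewrite inE => /(_ (eqxx _)); rewrite ltr_norml => /andP[+ _]; lra.
pose E n := [set x | r + n.+1%:R^-1 < b k x].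
have mEn n : measurable (E n) by exact: measurable_gt.
have -> : [set x | r < b k x] = \bigcup_n E n.
  apply/seteqP; split => [x /= rx|x [n _]].
    have d0 : 0 < (b k x - r) / 2 by rewrite divr_gt0// subr_gt0.
    have [n ne] := exists_invSn_le d0; exists n => //; rewrite /E /=; move: ne; set u := n.+1%:R^-1; lra.
  by rewrite /E /=; apply: lt_trans; rewrite ltrDl invr_gt0.
have h : \forall x \ae mu, forall n, E n x -> opart [set w | r < c k w] x.
  apply: ae_foralln => n; apply: open_part_ub => // w Ew.
  have n0 : 0 < n.+1%:R^-1 :> R by rewrite invr_gt0.
  have := Ew [:: k] _ n0 => h.
  have [x [Ex /(_ k)]] : exists x, (E n `&` cyl [:: k] (c ^~ w) n.+1%:R^-1) x.
    by apply/set0P/eqP => E0; move: h; rewrite E0 /prob measure0 ltxx.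
  rewrite inE => /(_ (eqxx _)); move: Ex; rewrite /E /= ltr_norml.
  by set u := n.+1%:R^-1 => h1 /andP[_ h2]; rewrite /=; lra.
by rewrite /ae_sub; apply: filterS h => x h [n _ /h].
Qed.

Hypothesis b_generate : forall B, measurable B -> forall eps : R, 0 < eps ->
  exists k, m ([set x | 2^-1 < b k x] `+` B) < eps.

(** [B] is a countable intersection of countable unions of its approximations, and
    these are inverse parts of open sets. *)
Lemma inverse_part_surj B : measurable B ->
  exists2 Y : set (borel K), measurable Y & ae_same mu (tau Y) B.
Proof.
move=> mB.
(* Summable in [n], so that the union over [n] exceeds [B] by at most 1/(N+1);
   tending to 0, so that the union contains [B]. *)
pose e (N n : nat) : R := Num.min (N.+1%:R^-1 / (2 ^ n.+1)%:R) n.+1%:R^-1.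
have e0 N n : 0 < e N n.
  by rewrite lt_min invr_gt0 ltr0n andbT divr_gt0// ?invr_gt0 ltr0n ?expn_gt0.
have /choice[k kP] : forall Nn : nat * nat, exists k,
    m ([set x | 2^-1 < b k x] `+` B) < e Nn.1 Nn.2.
  by move=> Nn; exact: b_generate.
pose A N n := [set x | 2^-1 < b (k (N, n)) x].
pose Y N n : set (borel K) := [set w | 2^-1 < c (k (N, n)) w].
have mA N n : measurable (A N n) by exact: measurable_gt.
have mAB N n : measurable (A N n `+` B) by apply: measurableU; exact: measurableD.
have mY N n : measurable (Y N n).
  apply: sub_sigma_algebra; rewrite (_ : Y N n = c (k (N, n)) @^-1` `]2^-1, +oo[%classic).
    by apply: open_comp => // w _; exact: c_continuous.
  by apply/seteqP; split => w /=; rewrite in_itv/= andbT.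
have tA N n : ae_same mu (tau (Y N n)) (A N n) by exact: inverse_part_coordinate.
have mUY N : measurable (\bigcup_n Y N n) by exact: bigcupT_measurable.
exists (\bigcap_N \bigcup_n Y N n).
  by apply: bigcapT_measurable.
apply: ae_same_trans (sm_bigcap inverse_part_morphism mUY) _.
have mUA N : measurable (\bigcup_n A N n) by exact: bigcupT_measurable.
apply: (@ae_same_trans _ _ _ _ _ (\bigcap_N \bigcup_n A N n)).
  have : \forall x \ae mu, forall N, tau (\bigcup_n Y N n) x <-> (\bigcup_n A N n) x.
    apply: ae_foralln => N; apply: ae_same_trans (inverse_part_bigcup_same (Y N)) _.
    by apply: ae_same_bigcup => n; exact: tA.
  by rewrite /ae_same; apply: filterS => x h; split=> hx N _; apply/h/hx.
have mI : measurable (\bigcap_N \bigcup_n A N n) by exact: bigcapT_measurable.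
apply: ae_sub_anti.
  apply: prob_le_ae_sub => // eps eps0; have [N Ne] := exists_invSn_le eps0.
  apply: le_trans Ne; pose D n := A N n `\` B.
  have mD n : measurable (D n) by exact: measurableD.
  apply: (@le_trans _ _ (m (\bigcup_n D n))).
    apply: prob_sub; [exact: measurableD|exact: bigcupT_measurable|].
    by move=> x [/(_ N I)[n _ Ax] nB]; exists n.
  apply: prob_bigcup_le => // n; apply: le_trans (prob_sub _ (mD n) (mAB N n) _) _.
    by move=> x; left.
  by apply/ltW/(lt_le_trans (kP (N, n))); rewrite ge_min lexx.
have : \forall x \ae mu, forall N, B x -> (\bigcup_n A N n) x.
  apply: ae_foralln => N; apply: prob_le_ae_sub => // eps eps0.
  have [n ne] := exists_invSn_le eps0; apply: le_trans ne.
  apply: (@le_trans _ _ (m (A N n `+` B))).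
    apply: prob_sub => //; first exact: measurableD.
    by move=> x [Bx nA]; right; split => // Ax; apply: nA; exists n.
  by apply/ltW/(lt_le_trans (kP (N, n))); rewrite ge_min lexx orbT.
by rewrite /ae_sub; apply: filterS => x h Bx N _; exact: h.
Qed.

End topological_model.

(** * Translates of a family of functions *)

(** Values realised with positive measure inherit almost everywhere inequalities. *)
Lemma essential_value_close d (X : measurableType d) (R : realType)
    (mu : probability X R) (J : choiceType) (b : J -> X -> R) k1 k2 (v : J -> R)
    (delta : R) : (forall k, measurable_fun setT (b k)) ->
  essential_value mu b setT v ->
  (\forall x \ae mu, `|b k1 x - b k2 x| <= delta) -> `|v k1 - v k2| <= delta.
Proof.
move=> mb vE kk; apply/ler_addgt0Pr => eps e0; have e2 : 0 < eps / 2 by rewrite divr_gt0.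
have := vE [:: k1; k2] _ e2; rewrite setTI => C0.
have mC : measurable (cylinder b [:: k1; k2] v (eps / 2)) by exact: measurable_cylinder.
apply: contrapT => /negP; rewrite -ltNge => far.
have : \forall x \ae mu, ~ cylinder b [:: k1; k2] v (eps / 2) x.
  apply: filterS kk => x h Cx; have := Cx k1; have := Cx k2.
  rewrite !inE !eqxx orbT => /(_ isT) h2 /(_ isT) h1; move: far.
  rewrite ltNge => /negP; apply; move: h h1 h2; rewrite ler_norml !ltr_norml.
  rewrite ler_norml => /andP[? ?] /andP[? ?] /andP[? ?].
  by apply/andP; split; lra.
move=> /(measurable_null mu mC) z; move: C0.
by rewrite /prob z ltxx.
Qed.

Section translated_coordinates.
Context d (X : measurableType d) (R : realType) (mu : probability X R).
Context (G : topologicalGroupType) (sg : G -> set X -> set X).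
Hypothesis sgP : algebra_action mu sg.
Context (I : choiceType) (a : I -> X -> R).
Hypothesis ma : forall i, measurable_fun setT (a i).
Hypothesis a01 : forall i x, 0 <= a i x <= 1.
Local Notation m := (prob mu).
Local Notation e := (1%g : G).
Local Notation J := (G * I)%type.
Implicit Types (A B E : set X) (g h : G) (k : J).

Let sgm g := aa_morphism sgP g.
Let msg g A : measurable A -> measurable (sg g A).
Proof. exact: (sm_measurable (sgm g)). Qed.

(** Adjunction between the translations by [g] and [g^-1]. *)
Lemma sg_galois g A B : measurable A -> measurable B ->
  ae_sub mu (sg g A) B -> ae_sub mu A (sg g^-1%g B).
Proof.
move=> mA mB AB; have := algebra_action_invK g^-1%g sgP mA; rewrite invgK => /ae_same_sym/ae_same_sub h.
by apply: ae_sub_trans h _; apply: (sm_ae_sub (sgm _)) => //; exact: msg.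
Qed.

Let clamp (r : R) : R := Num.max 0 (Num.min 1 r).

Let mclamp : measurable_fun setT clamp.
Proof.
apply: measurable_maxr; first exact: measurable_cst.
by apply: measurable_minr; [exact: measurable_cst|exact: measurable_id].
Qed.

Let clamp_id r : 0 <= r <= 1 -> clamp r = r.
Proof. by move=> /andP[r0 r1]; rewrite /clamp min_r// max_r. Qed.

(** Clamping only changes [push] on a null set; it makes the bounds needed for the
    compactness of the essential range hold everywhere. *)
Definition translate k (x : X) : R := clamp (push (sg k.1) (a k.2) x).

Lemma measurable_translate k : measurable_fun setT (translate k).
Proof. by apply: measurableT_comp => //; exact: (measurable_push (sgm k.1)). Qed.

Lemma translate01 k x : 0 <= translate k x <= 1.
Proof. by rewrite /translate /clamp le_max lexx/= ge_max ler01 ge_min lexx. Qed.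

Lemma transports_translate g i : transports mu (sg g) (a i) (translate (g, i)).
Proof.
have -> : a i = clamp \o a i by apply/funext => x /=; rewrite clamp_id.
have -> : translate (g, i) = clamp \o push (sg g) (a i) by [].
by apply: transports_comp => //; exact: (transports_push (sgm g)).
Qed.

Lemma transports_translate_mul h g i :
  transports mu (sg h) (translate (g, i)) (translate ((h * g)%g, i)).
Proof.
move=> B mB; have mp (u : X -> R) : measurable_fun setT u -> measurable (u @^-1` B).
  by move=> mu_; rewrite -[_ @^-1` _]setTI; exact: mu_.
apply: ae_same_trans (transports_translate (h * g)%g i mB) _.
apply: ae_same_trans (aa_M sgP h g (mp _ (ma i))) _.
apply: (sm_ae_same (sgm h)); [exact/msg/mp|exact/mp/measurable_translate|].
exact/ae_same_sym/transports_translate.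
Qed.

(** Left translation is an isometry for the sup norm, which makes the estimate at
    [1] uniform over the group. *)
Lemma translate_close i (delta : R) : uniformly_continuous mu sg (a i) -> 0 < delta ->
  \forall w \near nbhs e, forall g,
    \forall x \ae mu, `|translate ((g * w)%g, i) x - translate (g, i) x| <= delta.
Proof.
move=> ua d0; apply: filterS (ua _ d0) => w hw g.
pose u x := `|translate (w, i) x - a i x|.
pose v x := `|translate ((g * w)%g, i) x - translate (g, i) x|.
have mt := measurable_translate.
have dist_mf : measurable_fun setT (fun z : R * R => `|z.1 - z.2|).
  apply: measurableT_comp => //; apply: measurable_funB.
    exact: measurable_fst.
  exact: measurable_snd.
have uv : transports mu (sg g) u v.
  apply: (@transports_comp _ _ _ _ _ _ _ _ _ _ _ (fun z : R * R => `|z.1 - z.2|)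
    (fun x => (translate (w, i) x, a i x))
    (fun x => (translate ((g * w)%g, i) x, translate (g, i) x)) dist_mf).
  apply: (transports_pair (sgm g)) => //.
    exact: transports_translate_mul.
  exact: transports_translate.
have mu_ : measurable_fun setT u.
  apply: measurableT_comp => //; apply: measurable_funB; [exact: mt|exact: ma].
have u_le : \forall x \ae mu, ~ (delta < u x).
  have := transports_uniq (transports_translate w i) (transports_push (sgm w) (ma i)).
  by apply: filterS2 hw => x h E; apply/negP; rewrite -leNgt /u E.
have := sm_null (sgm g) (measurable_gt delta mu_) u_le.
have := transports_gt uv delta; rewrite /ae_same; apply: filterS2 => x h nh.
by rewrite leNgt; apply/negP => /h.
Qed.

Lemma sg_cylinder h s (v v' : J -> R) eps : (forall k, v' ((h * k.1)%g, k.2) = v k) ->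
  ae_same mu (sg h (cylinder translate s v eps))
    (cylinder translate [seq ((h * k.1)%g, k.2) | k <- s] v' eps).
Proof.
move=> vv'; elim: s => [|[g i] s IH].
  rewrite (_ : cylinder _ _ _ _ = setT); last by apply/seteqP.
  have := sm_setT (sgm h); rewrite /ae_same; apply: filterS => x sT.
  by split=> // _ k.
rewrite /= !cylinder_cons -/cylinder.
have mt := measurable_translate.
have mc : measurable (cylinder translate s v eps) by exact: measurable_cylinder.
pose j (r : R) := `|r - v (g, i)|.
have mj : measurable_fun setT j.
  by apply: measurableT_comp => //; apply: measurable_funB.
have mjt : measurable_fun setT (j \o translate (g, i)) by exact: measurableT_comp.
have ms : measurable [set x | `|translate (g, i) x - v (g, i)| < eps].
  exact: (measurable_lt_cst eps mjt).
apply: ae_same_trans (sm_I (sgm h) ms mc) _; apply: ae_sameI => //.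
apply: ae_same_sym; rewrite (vv' (g, i)).
exact: (transports_lt (transports_comp mj (transports_translate_mul h g i)) eps).
Qed.

Lemma essential_value_translate h E (v v' : J -> R) : measurable E ->
  (forall k, v' ((h * k.1)%g, k.2) = v k) ->
  essential_value mu translate E v -> essential_value mu translate (sg h E) v'.
Proof.
move=> mE vv' Ev s' eps e0; pose s := [seq ((h^-1 * k.1)%g, k.2) | k <- s'].
have mt := measurable_translate.
have mc u t : measurable (cylinder translate u t eps) by exact: measurable_cylinder.
have ss' : s' = [seq ((h * k.1)%g, k.2) | k <- s].
  rewrite /s -map_comp -[LHS]map_id; apply: eq_map => -[g i] /=.
  by rewrite mulVKg.
have mI := measurableI _ _ mE (mc s v).
have := Ev s eps e0; rewrite ss'; congr (_ < _).
transitivity (m (sg h (E `&` cylinder translate s v eps))).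
  by rewrite /prob (sm_measure (sgm h)).
apply: prob_ae_same; [exact: msg|by apply: measurableI => //; exact: msg|].
apply: ae_same_trans (sm_I (sgm h) mE (mc s v)) _; apply: ae_sameI.
  exact: ae_same_refl.
exact: sg_cylinder.
Qed.

End translated_coordinates.

(** * The group action on the essential range *)

Section dynamical_model.
Context d (X : measurableType d) (R : realType) (mu : probability X R).
Context (G : topologicalGroupType) (sg : G -> set X -> set X).
Hypothesis sgP : algebra_action mu sg.
Context (I : choiceType) (a : I -> X -> R).
Hypothesis ma : forall i, measurable_fun setT (a i).
Hypothesis a01 : forall i x, 0 <= a i x <= 1.
Hypothesis a_continuous : forall i, uniformly_continuous mu sg (a i).
Local Notation J := (G * I)%type.
Local Notation b := (translate sg a).
Local Notation m := (prob mu).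
Context (K : ptopologicalType) (c : J -> K -> R).
Hypothesis K_compact : compact [set: K].
Hypothesis c_continuous : forall k, continuous (c k).
Hypothesis K_basis : forall (w : K) U, nbhs w U ->
  exists (s : seq J) (eps : R), 0 < eps /\
    [set w' | forall k, k \in s -> `|c k w' - c k w| < eps] `<=` U.
Hypothesis c_inj : forall w w', (forall k, c k w = c k w') -> w = w'.
Hypothesis c_essential : forall w, essential_value mu b setT (c ^~ w).
Hypothesis c_realised : forall v, essential_value mu b setT v ->
  exists w, forall k, c k w = v k.
Implicit Types (A B E : set X) (g h : G) (k : J) (w : K) (Y W : set K).

(* Notations rather than local lemmas: the measure on [K] depends on these two
   proofs. *)
Local Notation mb := (measurable_translate sgP ma).
Local Notation value_exists := (essential_value_exists (mu := mu) mb (translate01 sg a)).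

Let sgm g := aa_morphism sgP g.
Let msg g A : measurable A -> measurable (sg g A).
Proof. exact: (sm_measurable (sgm g)). Qed.

Let act_exists g w : exists w', forall k, c k w' = c ((g^-1 * k.1)%g, k.2) w.
Proof.
apply: c_realised.
have h : forall k, c ((g^-1 * ((g * k.1)%g, k.2).1)%g, k.2) w = c k w.
  by move=> -[h i] /=; rewrite mulKg.
have := essential_value_translate sgP ma a01
  (v' := fun k => c ((g^-1 * k.1)%g, k.2) w) measurableT h (c_essential w).
apply: (essential_valueS mb) => //; first exact: msg.
by apply: subset_ae_sub.
Qed.

(** The group acts by permuting the coordinates; the permuted family is again an
    essential value because [sg g] maps cylinders to cylinders and preserves their
    measure. *)
Definition point_act g w : K := projT1 (cid (act_exists g w)).
Local Notation act := point_act.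

Lemma point_actE g w k : c k (act g w) = c ((g^-1 * k.1)%g, k.2) w.
Proof. by rewrite /point_act; case: cid => w' /=. Qed.

Lemma point_act1 w : act 1%g w = w.
Proof. by apply: c_inj => -[g i]; rewrite point_actE /= invg1 mul1g. Qed.

Lemma point_actM g h w : act (g * h)%g w = act g (act h w).
Proof. by apply: c_inj => -[f i]; rewrite !point_actE /= invgM mulgA. Qed.

Let actK g w : act g^-1%g (act g w) = w.
Proof. by rewrite -point_actM mulVg point_act1. Qed.

Let actVK g w : act g (act g^-1%g w) = w.
Proof. by rewrite -point_actM mulgV point_act1. Qed.

Lemma coordinate_close i (delta : R) : 0 < delta ->
  \forall u \near nbhs (1%g : G), forall g w, `|c ((g * u)%g, i) w - c (g, i) w| <= delta.
Proof.
move=> d0; have := translate_close sgP ma a01 (a_continuous i) d0.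
apply: filterS => u hu g w.
exact: (essential_value_close (v := c ^~ w) mb (c_essential w) (hu g)).
Qed.

(** A coordinate of [act g w] varies little with [g], uniformly in [w], by
    [coordinate_close], and continuously with [w] for fixed [g]. *)
Lemma point_act_continuous : continuous (fun z : G * K => act z.1 z.2).
Proof.
move=> [g w] U /= /K_basis[s [eps [e0 sU]]].
suff : \forall z \near (g, w), forall k, k \in s ->
    `|c k (act z.1 z.2) - c k (act g w)| < eps.
  by apply: filterS => z; exact: sU.
elim: {sU} s => [|[h i] s IH]; first by apply: filterS filterT => z _ k.
have e2 : 0 < eps / 2 by rewrite divr_gt0.
have near_g : \forall g' \near g, forall w',
    `|c ((g'^-1 * h)%g, i) w' - c ((g^-1 * h)%g, i) w'| <= eps / 2.
  pose P u := forall g w', `|c ((g * u)%g, i) w' - c (g, i) w'| <= eps / 2.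
  have cont : continuous (fun g' : G => (g^-1 * h)^-1 * (g'^-1 * h))%g.
    move=> x; apply: (@continuous_comp G G G (fun y => y^-1 * h)%g
      (fun y => (g^-1 * h)^-1 * y)%g); last exact: mulgl_continuous.
    apply: (@continuous_comp G G G (fun y => y^-1)%g (fun y => y * h)%g).
      exact: invg_continuous.
    exact: mulgr_continuous.
  have N : \forall g' \near nbhs g, P ((g^-1 * h)^-1 * (g'^-1 * h))%g.
    by apply: (cont g P); rewrite mulVg; exact: coordinate_close.
  apply: filterS N => g' Pg' w'.
  by have := Pg' (g^-1 * h)%g w'; rewrite mulVKg.
have near_w : \forall w' \near w,
    `|c ((g^-1 * h)%g, i) w' - c ((g^-1 * h)%g, i) w| < eps / 2.
  have /cvgrPdist_lt/(_ _ e2) := @c_continuous ((g^-1 * h)%g, i) w.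
  by apply: filterS => w'; rewrite distrC.
have near_gw : \forall z \near (g, w),
    `|c (h, i) (act z.1 z.2) - c (h, i) (act g w)| < eps.
  exists ([set g' | forall w', `|c ((g'^-1 * h)%g, i) w' - c ((g^-1 * h)%g, i) w'| <= eps / 2],
    [set w' | `|c ((g^-1 * h)%g, i) w' - c ((g^-1 * h)%g, i) w| < eps / 2]) => //.
  move=> [g' w'] [/= /(_ w') h1 h2]; rewrite !point_actE /=.
  move: h1 h2; rewrite ler_norml !ltr_norml => /andP[? ?] /andP[? ?].
  by apply/andP; split; lra.
apply: filterS2 near_gw IH => z h1 h2 k; rewrite inE => /orP[/eqP ->//|]; exact: h2.
Qed.

Lemma point_act_system : topological_dynamical_system act.
Proof. by split; [exact: point_act1|exact: point_actM|exact: point_act_continuous]. Qed.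

Let act_continuous g : continuous (act g).
Proof.
move=> w; apply: (@continuous_comp _ _ _ (fun w => (g, w)) (fun z : G * K => act z.1 z.2)).
  by apply: cvg_pair; [exact: cvg_cst|exact: cvg_id].
exact: point_act_continuous.
Qed.

Let open_act g W : open W -> open (act g @^-1` W).
Proof. by move=> oW; apply: open_comp => // w _; exact: act_continuous. Qed.

Let actS g W : act g @^-1` (act g^-1%g @^-1` W) = W.
Proof. by apply/seteqP; split => w /=; rewrite actK. Qed.

Let carrier_act g E w : measurable E ->
  carrier mu b c E w -> carrier mu b c (sg g E) (act g w).
Proof.
move=> mE; apply: (essential_value_translate sgP ma a01) => // -[h i].
by rewrite point_actE /= mulKg.
Qed.

Let carrier_actV g E : measurable E ->
  carrier mu b c (sg g E) `<=` act g^-1%g @^-1` carrier mu b c E.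
Proof.
move=> mE w /(carrier_act (g^-1%g) (msg g mE)); apply: (carrierS mb) => //.
  exact/msg/msg.
have := algebra_action_invK g^-1%g sgP mE; rewrite invgK => h; exact: ae_same_sub.
Qed.

Local Notation opart := (open_part mu c mb).
Local Notation tau := (inverse_part mu c mb).
Let mop W : measurable (opart W). Proof. exact: measurable_open_part. Qed.
Let mtau Y : measurable (tau Y). Proof. exact: measurable_inverse_part. Qed.

Let open_part_act g W : ae_sub mu (sg g (opart W)) (opart (act g^-1%g @^-1` W)).
Proof.
have h : ae_sub mu (opart W) (sg g^-1%g (opart (act g^-1%g @^-1` W))).
  apply: open_part_sub => [|E mE EW]; first exact: msg.
  apply: (sg_galois sgP) => //; apply: open_part_ub; first exact: msg.
  by move=> w /(carrier_actV mE)/EW.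
have := algebra_action_invK g sgP (mop (act g^-1%g @^-1` W)) => /ae_same_sub.
apply: ae_sub_trans.
by apply: (sm_ae_sub (sgm g)) => //; exact: msg.
Qed.

Let inverse_part_act_sub g Y : ae_sub mu (sg g (tau Y)) (tau (act g^-1%g @^-1` Y)).
Proof.
apply: inverse_part_greatest => [|W oW YW]; first exact: msg.
have h1 : ae_sub mu (tau Y) (opart (act g @^-1` W)).
  apply: inverse_part_lb; first exact: open_act.
  by move=> w Yw /=; apply: YW; rewrite /= actK.
have h2 := open_part_act g (act g @^-1` W).
have E : act g^-1%g @^-1` (act g @^-1` W) = W by apply/seteqP; split => w /=; rewrite actVK.
rewrite E in h2; apply: ae_sub_trans h2.
by apply: (sm_ae_sub (sgm g)).
Qed.

(** The inverse-image map intertwines the two actions; one inclusion, for all group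
    elements, gives the other. *)
Lemma inverse_part_act g Y : ae_same mu (sg g (tau Y)) (tau (act g^-1%g @^-1` Y)).
Proof.
apply: ae_sub_anti; first exact: inverse_part_act_sub.
have := inverse_part_act_sub g^-1%g (act g^-1%g @^-1` Y); rewrite invgK actS => h.
by have := sg_galois sgP (mtau _) (mtau _) h; rewrite invgK.
Qed.

Local Notation nu := (image_probability mb c_continuous K_basis c_realised value_exists).
Let tauP := inverse_part_morphism mb c_continuous K_basis c_realised value_exists.

Lemma image_probability_invariant : invariant_measure nu act.
Proof.
move=> g Y mY; apply: (@etrans _ _ (mu (tau (act g @^-1` Y)))) => //.
apply: (@etrans _ _ (mu (sg g^-1%g (tau Y)))); last exact: (sm_measure (sgm _)).
apply: measure_ae_same => //; first exact: msg.
by apply: ae_same_sym; have := inverse_part_act g^-1%g Y; rewrite invgK.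
Qed.

Let measurable_act g (Y : set (borel K)) : measurable Y ->
  measurable (act g @^-1` Y : set (borel K)).
Proof.
have mact : measurable_fun setT (act g : borel K -> borel K).
  apply: (@measurability _ _ (borel K) (borel K) setT (act g) (@open K)) => //.
  by move=> _ [U oU <-]; rewrite setTI; apply: sub_sigma_algebra; exact: open_act.
by move=> mY; rewrite -[_ @^-1` _]setTI; exact: mact.
Qed.

Let sgK g (Y : set (borel K)) : set (borel K) := act g^-1%g @^-1` Y.

(** Continuity is transported from [X] along the isometry [tau]. *)
Lemma point_act_algebra_action : algebra_action nu sgK.
Proof.
split.
- move=> g; split.
  + by move=> Y mY; exact: measurable_act.
  + by move=> Y mY; exact: image_probability_invariant.
  + by move=> Y mY; exact: ae_same_refl.
  + by move=> Y mY; exact: ae_same_refl.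
- move=> Y mY; rewrite (_ : sgK 1%g Y = Y); first exact: ae_same_refl.
  by apply/seteqP; split => w; rewrite /sgK /= invg1 point_act1.
- move=> g h Y mY; rewrite (_ : sgK (g * h)%g Y = sgK g (sgK h Y)); first exact: ae_same_refl.
  by apply/seteqP; split => w; rewrite /sgK /= invgM point_actM.
- move=> Y mY eps e0; apply: filterS (aa_continuous sgP (mtau Y) e0) => g.
  congr (_ < _)%E.
  have mgY := measurable_act g^-1%g mY.
  have mD1 : measurable (sgK g Y `\` Y) := measurableD mgY mY.
  have mD2 : measurable (Y `\` sgK g Y) := measurableD mY mgY.
  apply: (@etrans _ _ (mu (tau (sgK g Y `+` Y)))) => //.
  apply: measure_ae_same => //; first by apply: measurableU; apply: measurableD => //; exact: msg.
  apply: ae_same_sym; apply: ae_same_trans (sm_U tauP mD1 mD2) _.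
  have s1 := inverse_part_act g Y.
  apply: ae_sameU.
    apply: ae_same_trans (sm_D tauP mgY mY) _; rewrite !setDE.
    by apply: ae_sameI; [exact: ae_same_sym|exact: ae_same_refl].
  apply: ae_same_trans (sm_D tauP mY mgY) _; rewrite !setDE.
  by apply: ae_sameI; [exact: ae_same_refl|apply/ae_sameC/ae_same_sym].
Qed.

Lemma canonical_rep_push (p : R) (p1 : (1 <= p%:E)%E) g (F : LspaceType nu p1) :
  canonical_rep nu act p1 g F = push_Lp nu (sgK g) F.
Proof.
apply/esym/(push_Lp_uniq (aa_morphism point_act_algebra_action g)).
move=> B mB; have := canonical_rep_ae point_act_system image_probability_invariant g F.
rewrite /ae_same; apply: filterS => w E.
by rewrite /= E.
Qed.

Hypothesis generate : forall B, measurable B -> forall eps : R, 0 < eps ->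
  exists i, m ([set x | 2^-1 < a i x] `+` B) < eps.

Let b_generate B : measurable B -> forall eps : R, 0 < eps ->
  exists k, m ([set x | 2^-1 < b k x] `+` B) < eps.
Proof.
move=> mB eps e0; have [i ie] := generate mB e0; exists (1%g, i).
apply: le_lt_trans ie; have m1 := measurable_gt 2^-1 (mb (1%g, i)).
have m2 := measurable_gt 2^-1 (ma i).
apply: prob_ae_sub.
- by apply: measurableU; exact: measurableD.
- by apply: measurableU; exact: measurableD.
have h1 := transports_gt (transports_translate sgP ma a01 1%g i) 2^-1.
have h2 := aa_1 sgP m2; have := ae_same_trans h1 h2; rewrite /ae_same /ae_sub.
by apply: filterS => x h [[/h ? ?]|[? n]]; [left|right; split => // /h].
Qed.

(** As the family generates the measure algebra, [tau] is onto up to null sets and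
    its inverse [theta] induces the isomorphisms of the L^p-spaces. *)
Theorem dynamical_model : exists Phi : forall (p : R) (p1 : (1 <= p%:E)%E),
    LspaceType mu p1 -> LspaceType nu p1,
  [/\ forall (p : R) (p1 : (1 <= p%:E)%E), isometric_lattice_iso (Phi p p1),
    forall (p : R) (p1 : (1 <= p%:E)%E), Phi p p1 (Lcst mu p1 1) = Lcst nu p1 1,
    forall (p q : R) (p1 : (1 <= p%:E)%E) (q1 : (1 <= q%:E)%E), p <= q ->
      forall F : LspaceType mu q1, Phi p p1 (Lincl p1 F) = Lincl p1 (Phi q q1 F),
    forall (p : R) (p1 : (1 <= p%:E)%E),
      sc_isometric_lattice_rep (canonical_rep nu act p1) &
    forall (p : R) (p1 : (1 <= p%:E)%E) g (F : LspaceType mu p1),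
      Phi p p1 (push_Lp mu (sg g) F) = canonical_rep nu act p1 g (Phi p p1 F)].
Proof.
have surj := inverse_part_surj mb c_continuous K_basis c_realised value_exists b_generate.
have [theta [thetaP tauK]] := set_morphism_inverse tauP surj.
have mtheta A : measurable A -> measurable (theta A) := sm_measurable thetaP (A := A).
exists (fun p p1 => push_Lp nu theta (p1 := p1)); split.
- move=> p p1; apply: (push_Lp_iso thetaP) => Y mY; exists (tau Y) => //.
  apply: (sm_ae_same_inj tauP) => //; first exact: mtheta.
  exact: tauK.
- by move=> p p1; exact: (push_Lp_cst thetaP).
- by move=> p q p1 q1 pq F; exact: (push_Lp_Lincl p1 F thetaP pq).
- move=> p p1; have -> : canonical_rep nu act p1 = fun g => push_Lp nu (sgK g) (p1 := p1).
    by apply/funext => g; apply/funext => F; exact: canonical_rep_push.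
  exact: (algebra_action_rep p1 point_act_algebra_action).
- move=> p p1 g F; rewrite canonical_rep_push.
  apply: (push_Lp_uniq thetaP) => B mB.
  have mpre (V : LspaceType mu p1) : measurable ((V : X -> R) @^-1` B).
    by rewrite -[_ @^-1` _]setTI; exact: measurable_aeEqMfun.
  have mpreK (V : LspaceType nu p1) : measurable ((V : borel K -> R) @^-1` B : set (borel K)).
    by rewrite -[_ @^-1` _]setTI; exact: measurable_aeEqMfun.
  have aP := aa_morphism point_act_algebra_action g.
  apply: ae_same_trans (push_Lp_transports aP (push_Lp nu theta F) mB) _.
  apply: (@ae_same_trans _ _ _ _ _ (sgK g (theta ((F : X -> R) @^-1` B)))).
    apply: (sm_ae_same aP) => //; first exact: mtheta.
    exact: (push_Lp_transports thetaP F mB).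
  have mt := mtheta _ (mpre F); have mt' := mtheta _ (mpre (push_Lp mu (sg g) F)).
  apply: (sm_ae_same_inj tauP) => //; first exact: measurable_act.
  apply: ae_same_trans (ae_same_sym (inverse_part_act g _)) _.
  apply: ae_same_trans (ae_same_sym (tauK _ (mpre (push_Lp mu (sg g) F)))).
  apply: (@ae_same_trans _ _ _ _ _ (sg g ((F : X -> R) @^-1` B))).
    by apply: (sm_ae_same (sgm g)) => //; exact: tauK.
  exact: ae_same_sym (push_Lp_transports (sgm g) F mB).
Qed.

End dynamical_model.

(** * Metrizability *)

Section coordinate_metric.
Context (R : realType) (K : topologicalType) (f : nat -> K -> R).
Hypothesis f_continuous : forall n, continuous (f n).
Hypothesis f01 : forall n x, 0 <= f n x <= 1.
Hypothesis f_inj : forall x y, (forall n, f n x = f n y) -> x = y.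

Let gaps x y : set R := [set `|f n x - f n y| / n.+1%:R | n in setT].
Let dist x y : R := sup (gaps x y).

Let gap_le1 n x y : `|f n x - f n y| <= 1.
Proof. by rewrite ler_norml; have := f01 n x; have := f01 n y; lra. Qed.

Let dist_le x y r : (forall n, `|f n x - f n y| / n.+1%:R <= r) -> dist x y <= r.
Proof.
move=> h; apply: ge_sup; first by exists (`|f 0 x - f 0 y| / 1%:R), 0%N.
by move=> _ [n _ <-].
Qed.

Let le_dist n x y : `|f n x - f n y| / n.+1%:R <= dist x y.
Proof.
apply: sup_upper_bound; last by exists n.
split; first by exists (`|f 0 x - f 0 y| / 1%:R), 0%N.
exists 1 => _ [k _ <-]; rewrite ler_pdivrMr ?ltr0n// mul1r.
by apply: le_trans (gap_le1 k x y) _; rewrite ler1n.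
Qed.

(** [K] under another name, to carry the metric; the proofs are arguments because
    the axioms of a metric depend on them. *)
Definition coordinate_metric : Type := (fun _ : (forall n x, 0 <= f n x <= 1) /\
  (forall x y, (forall n, f n x = f n y) -> x = y) => K) (conj f01 f_inj).

HB.instance Definition _ := Choice.on coordinate_metric.

Let dist_xx x : dist x x = 0.
Proof.
apply/eqP; rewrite eq_le; apply/andP; split.
  by apply: dist_le => n; rewrite subrr normr0 mul0r.
by apply: le_trans (le_dist 0 x x); rewrite subrr normr0 mul0r.
Qed.

Let dist_eq0 x y : dist x y = 0 -> x = y.
Proof.
move=> d0; apply: f_inj => n; have := le_dist n x y.
rewrite d0 ler_pdivrMr ?ltr0n// mul0r normr_le0 subr_eq0.
by move/eqP.
Qed.

Let dist_sym x y : dist x y = dist y x.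
Proof. by congr sup; apply/seteqP; split => _ [n _ <-]; exists n; rewrite // distrC. Qed.

Let dist_triangle y x z : dist x z <= dist x y + dist y z.
Proof.
apply: dist_le => n; apply: le_trans (lerD (le_dist n x y) (le_dist n y z)).
by rewrite -mulrDl ler_pM2r ?invr_gt0 ?ltr0n// ler_distD.
Qed.

HB.instance Definition _ :=
  isMetric.Build R coordinate_metric dist_xx dist_eq0 dist_sym dist_triangle.

Let near_coords N (w : K) (r : R) : 0 < r ->
  \forall w' \near w, forall n, (n < N)%N -> `|f n w - f n w'| < r.
Proof.
move=> r0; elim: N => [|N IH]; first by apply: filterS filterT => w' _ n.
have /cvgrPdist_lt/(_ _ r0) := @f_continuous N w.
by apply: filterS2 IH => w' h1 h2 n; rewrite ltnS leq_eqVlt => /orP[/eqP ->|/h1].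
Qed.

Let to_metric : continuous (id : K -> coordinate_metric).
Proof.
move=> w U /nbhs_ballP[r /= r0]; rewrite ballEmdist => rU.
have r2 : 0 < r / 2 by rewrite divr_gt0.
have [N Nr] := exists_invSn_le r2.
apply: filterS (near_coords N w r2) => w' h; apply: rU => /=.
apply: (@le_lt_trans _ _ (r / 2)); last by rewrite ltr_pdivrMr// ltr_pMr// ltr1n.
apply: dist_le => n; have [nN|Nn] := ltnP n N.
  rewrite ler_pdivrMr ?ltr0n//; apply: le_trans (ltW (h n nN)) _.
  by rewrite ler_peMr ?ler1n// ltW.
apply: le_trans Nr; rewrite ler_pdivrMr ?ltr0n//; apply: le_trans (gap_le1 n w w') _.
by rewrite -ler_pdivrMl ?invr_gt0 ?ltr0n// invrK mulr1 ler_nat.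
Qed.

(** A continuous bijection from a compact space to a Hausdorff space is a
    homeomorphism. *)
Lemma coordinates_metrizable : compact [set: K] -> metrizable R K.
Proof.
move=> cK; exists coordinate_metric, id, id; split => //.
apply/continuous_closedP => A clA.
have cA : compact (A : set K) by exact: subclosed_compact cK _.
rewrite (_ : id @^-1` A = (id : K -> coordinate_metric) @` A); last first.
  by rewrite image_id.
apply: compact_closed; first exact: metric_hausdorff.
by apply: continuous_compact => //; apply: continuous_subspaceT; exact: to_metric.
Qed.

End coordinate_metric.

Section model_metrizable.
Context d (X : measurableType d) (R : realType) (mu : probability X R).
Context (G : topologicalGroupType) (sg : G -> set X -> set X).
Hypothesis sgP : algebra_action mu sg.
Context (I : choiceType) (a : I -> X -> R).
Hypothesis ma : forall i, measurable_fun setT (a i).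
Hypothesis a01 : forall i x, 0 <= a i x <= 1.
Hypothesis a_continuous : forall i, uniformly_continuous mu sg (a i).
Local Notation J := (G * I)%type.
Local Notation b := (translate sg a).
Context (K : ptopologicalType) (c : J -> K -> R).
Hypothesis K_compact : compact [set: K].
Hypothesis c_continuous : forall k, continuous (c k).
Hypothesis c_inj : forall w w', (forall k, c k w = c k w') -> w = w'.
Hypothesis c_essential : forall w, essential_value mu b setT (c ^~ w).

Let mb k : measurable_fun setT (b k).
Proof. exact: (measurable_translate sgP ma). Qed.

Let c01 k w : 0 <= c k w <= 1.
Proof. exact: (essential_value01 (translate01 sg a) k (c_essential w)). Qed.

(** The coordinates depend uniformly continuously on the group element, so those at
    finitely many points of each compact piece, one list for each precision,
    already separate the points of [K]. *)
Lemma model_metrizable : countable [set: I] -> sigma_compact G -> metrizable R K.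
Proof.
move=> /countable_injP[code /in2TT code_inj] [C [cC CT]].
have /choice[decode decodeP] : forall n, exists o : option I,
    forall i, code i = n -> o = Some i.
  move=> n; have [[i in_]|no] := pselect (exists i, code i = n).
    by exists (Some i) => j; rewrite -in_ => /code_inj ->.
  by exists None => i in_; exfalso; apply: no; exists i.
have tP : forall z : nat * nat * nat, exists t : seq G, forall i x,
    decode z.1.1 = Some i -> C z.1.2 x ->
    exists2 g, g \in t & forall w, `|c (x, i) w - c (g, i) w| <= z.2.+1%:R^-1.
  move=> [[l n] q] /=; case: (decode l) => [i|]; last by exists [::].
  have q0 : 0 < q.+1%:R^-1 :> R by rewrite invr_gt0.
  have := coordinate_close sgP ma a01 a_continuous c_essential i q0.
  move=> /(compact_translates (cC n))[t tP]; exists t => _ x [<-] /tP[g gt h].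
  by exists g => // w; have := h g w; rewrite mulVKg.
have {tP}[t tP] := choice tP.
pose f (n : nat) : K -> R :=
  if unpickle n is Some (z, j) then
    if decode z.1.1 is Some i then c (nth 1%g (t z) j, i) else cst 0
  else cst 0.
apply: (@coordinates_metrizable R K f) => //.
- move=> n; rewrite /f; case: unpickle => [[z j]|]; last exact: cst_continuous.
  by case: (decode z.1.1) => [i|]; [exact: c_continuous|exact: cst_continuous].
- move=> n w; rewrite /f; case: unpickle => [[z j]|] /=; last by rewrite lexx ler01.
  by case: (decode z.1.1) => [i|] //=; rewrite lexx ler01.
move=> w w' ff; apply: c_inj => -[h i].
have di : decode (code i) = Some i by exact: decodeP.
have [n _ Ch] : (\bigcup_n C n) h by rewrite CT.
apply/eqP; rewrite -subr_eq0 -normr_le0; apply/ler_addgt0Pr => eps e0; rewrite add0r.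
have e2 : 0 < eps / 2 by rewrite divr_gt0.
have [q qe] := exists_invSn_le e2.
have [g gt hg] := tP (code i, n, q) i h di Ch.
have E : c (g, i) w = c (g, i) w'.
  have := ff (pickle ((code i, n, q), index g (t (code i, n, q)))).
  by rewrite /f pickleK /= di nth_index.
have := le_trans (hg w) qe; have := le_trans (hg w') qe; rewrite /= E.
rewrite !ler_norml => /andP[? ?] /andP[? ?]; apply/andP; split; lra.
Qed.

End model_metrizable.

(** * The topological model *)

Section generating_family.
Context d (X : measurableType d) (R : realType) (mu : probability X R).
Context (G : topologicalGroupType) (sg : G -> set X -> set X).
Hypothesis sgP : algebra_action mu sg.
Hypothesis hausG : hausdorff_space G.
Hypothesis lcG : locally_compact [set: G].
Local Notation m := (prob mu).

Let mY A B : measurable A -> measurable B -> measurable (A `+` B : set X).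
Proof. by move=> mA mB; apply: measurableU; exact: measurableD. Qed.

Lemma prob_setY_trans (A B C : set X) : measurable A -> measurable B -> measurable C ->
  m (A `+` C) <= m (A `+` B) + m (B `+` C).
Proof.
move=> mA mB mC; apply: le_trans (probU_le mu (mY mA mB) (mY mB mC)).
apply: prob_sub; [exact: mY|by apply: measurableU; exact: mY|].
move=> x [[Ax nC]|[nA Cx]]; have [Bx|nB] := pselect (B x).
- by right; left.
- by left; left.
- by left; right.
- by right; right.
Qed.

(** Pairs a dense family of sets with a precision, so that the index set stays
    countable when the family is. *)
Lemma generating_family (T : Type) (D : T -> set X) : (forall t, measurable (D t)) ->
  (forall B, measurable B -> forall eps : R, 0 < eps -> exists t, m (D t `+` B) < eps) ->
  exists a : T * nat -> X -> R, [/\ forall i, measurable_fun setT (a i),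
    forall i x, 0 <= a i x <= 1, forall i, uniformly_continuous mu sg (a i) &
    forall B, measurable B -> forall eps : R, 0 < eps ->
      exists i, m ([set x | 2^-1 < a i x] `+` B) < eps].
Proof.
move=> mD dD.
have /choice[a aP] : forall i : T * nat, exists a : X -> R,
    [/\ measurable_fun setT a, forall x, 0 <= a x <= 1,
      uniformly_continuous mu sg a & m ([set x | 2^-1 < a x] `+` D i.1) < i.2.+1%:R^-1].
  by move=> [t n]; apply: uniformly_continuous_dense => //; rewrite invr_gt0.
exists a; split.
- by move=> i; have [] := aP i.
- by move=> i; have [] := aP i.
- by move=> i; have [] := aP i.
move=> B mB eps e0; have e2 : 0 < eps / 2 by rewrite divr_gt0.
have [t te] := dD B mB _ e2; have [n ne] := exists_invSn_le e2.
exists (t, n); have [ma _ _ an] := aP (t, n).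
apply: le_lt_trans (prob_setY_trans (measurable_gt 2^-1 ma) (mD t) mB) _.
rewrite [ltRHS]splitr; apply: ltrD te; exact: lt_le_trans an ne.
Qed.

Lemma topological_model (I : choiceType) (a : I -> X -> R) :
  (forall i, measurable_fun setT (a i)) -> (forall i x, 0 <= a i x <= 1) ->
  (forall i, uniformly_continuous mu sg (a i)) ->
  (forall B, measurable B -> forall eps : R, 0 < eps ->
    exists i, m ([set x | 2^-1 < a i x] `+` B) < eps) ->
  exists (K : ptopologicalType) (act : G -> K -> K) (nu : probability (borel K) R)
    (Phi : forall (p : R) (p1 : (1 <= p%:E)%E), LspaceType mu p1 -> LspaceType nu p1),
  [/\ [/\ compact [set: K], hausdorff_space K & topological_dynamical_system act],
    [/\ invariant_measure nu act, regular_measure nu & measure_support nu = [set: K]],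
    [/\ forall (p : R) (p1 : (1 <= p%:E)%E), isometric_lattice_iso (Phi p p1),
      forall (p : R) (p1 : (1 <= p%:E)%E), Phi p p1 (Lcst mu p1 1) = Lcst nu p1 1,
      forall (p q : R) (p1 : (1 <= p%:E)%E) (q1 : (1 <= q%:E)%E), p <= q ->
        forall F : LspaceType mu q1, Phi p p1 (Lincl p1 F) = Lincl p1 (Phi q q1 F),
      forall (p : R) (p1 : (1 <= p%:E)%E),
        sc_isometric_lattice_rep (canonical_rep nu act p1) &
      forall (p : R) (p1 : (1 <= p%:E)%E) (g : G) (F : LspaceType mu p1),
        Phi p p1 (push_Lp mu (sg g) F) = canonical_rep nu act p1 g (Phi p p1 F)] &
    countable [set: I] -> sigma_compact G -> metrizable R K].
Proof.
move=> ma a01 ua gen.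
pose mb := measurable_translate sgP ma; pose b01 := translate01 sg a.
have [K [c [cK cc basis cinj [cess creal]]]] := essential_range mu mb b01.
pose vex := essential_value_exists (mu := mu) mb b01.
pose act := point_act sgP ma a01 cess creal.
pose nu := image_probability mb cc basis creal vex.
have actP : topological_dynamical_system act.
  exact: (point_act_system sgP ma a01 ua cc basis cinj cess creal).
have [Phi PhiP] := dynamical_model sgP ma a01 ua cc basis cinj cess creal gen.
exists K, act, nu, Phi; split => //.
- split => // x y xy; apply: cinj => k.
  have := @Rhausdorff R; move=> /(_ (c k x) (c k y)); apply => A B nA nB.
  have [z [Az Bz]] := xy _ _ (cc k x A nA) (cc k y B nB).
  by exists (c k z).
- split.
  + exact: image_probability_invariant.
  + exact: image_measure_regular.
  + exact: image_measure_support.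
- exact: (model_metrizable sgP ma a01 ua cK cc cinj cess).
Qed.

End generating_family.
Theorem theorem5p14 (R : realType) (d : measure_display) (X : measurableType d)
    (mu : probability X R) (G : topologicalGroupType)
    (G_hausdorff : hausdorff_space G)
    (G_locally_compact : locally_compact [set: G])
    (p0 : R) (p01 : (1 <= p0%:E)%E)
    (rho0 : G -> LspaceType mu p01 -> LspaceType mu p01)
    (rho0_rep : sc_isometric_lattice_rep rho0) :
  exists rho : forall (p : R) (p1 : (1 <= p%:E)%E),
      G -> LspaceType mu p1 -> LspaceType mu p1,
  [/\ natural_action rho0 rho,
      forall (p : R) (p1 : (1 <= p%:E)%E), sc_isometric_lattice_rep (rho p p1)
    & exists (K : ptopologicalType) (act : G -> K -> K)
        (nu : probability (borel K) R)
        (Phi : forall (p : R) (p1 : (1 <= p%:E)%E),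
           LspaceType mu p1 -> LspaceType nu p1),
      [/\ [/\ compact [set: K], hausdorff_space K
            & topological_dynamical_system act],
          [/\ invariant_measure nu act, regular_measure nu
            & measure_support nu = [set: K]],
          [/\ forall (p : R) (p1 : (1 <= p%:E)%E),
                isometric_lattice_iso (Phi p p1),
              forall (p : R) (p1 : (1 <= p%:E)%E),
                Phi p p1 (Lcst mu p1 1) = Lcst nu p1 1,
              forall (p q : R) (p1 : (1 <= p%:E)%E) (q1 : (1 <= q%:E)%E),
                p <= q -> forall F : LspaceType mu q1,
                Phi p p1 (Lincl p1 F) = Lincl p1 (Phi q q1 F),
              forall (p : R) (p1 : (1 <= p%:E)%E),
                sc_isometric_lattice_rep (canonical_rep nu act p1)
            & forall (p : R) (p1 : (1 <= p%:E)%E) (g : G) (F : LspaceType mu p1),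
                Phi p p1 (rho p p1 g F) =
                canonical_rep nu act p1 g (Phi p p1 F)]
        & separable_measure mu -> sigma_compact G -> metrizable R K]].
Proof.
have sgP := rep_algebra_action rho0_rep.
pose sg g := indic_image (rho0 g).
have [_ _ rho0P _] := rho0_rep.
exists (fun p p1 g => push_Lp mu (sg g) (p1 := p1)); split.
- by move=> p p1 g; exact: natural_extension_push.
- by move=> p p1; exact: (algebra_action_rep p1 sgP).
pose dense (T : Type) (D : T -> set X) := (forall t, measurable (D t)) /\
  forall B, measurable B -> forall eps : R, 0 < eps ->
    exists t, prob mu (D t `+` B) < eps.
(* The index set must be fixed before [K] is built, hence the case distinction on
   separability. *)
have [I [D [[mD dD] I_countable]]] : exists (I : choiceType) (D : I -> set X),
    dense I D /\ (separable_measure mu -> countable [set: I]).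
  have [[D [mD dD]]|nsep] := pselect (separable_measure mu).
    exists nat, D; split; last by move=> _; exact: countableP.
    split => // B mB eps e0.
    have [n nB] := dD B mB eps e0; exists n; rewrite setYC.
    have mBD : measurable (B `+` D n) by apply: measurableU; exact: measurableD.
    rewrite -lte_fin; apply: le_lt_trans nB; rewrite le_eqVlt; apply/orP; left.
    by apply/eqP/esym; exact: (probE mu mBD).
  exists (set X), (fun Y => if `[< measurable Y >] then Y else set0); split => //.
  split; first by move=> Y; case: asboolP => // _; exact: measurable0.
  move=> B mB eps e0; exists B; case: asboolP => // _.
  by rewrite setYK /prob measure0.
have [a [ma a01 ua gen]] := generating_family sgP G_hausdorff G_locally_compact mD dD.
have [K [act [nu [Phi [KP nuP PhiP met]]]]] := topological_model sgP ma a01 ua gen.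
exists K, act, nu, Phi; split => // sep; apply: met.
rewrite -setXTT; apply: countableX; first exact: I_countable.
exact: countableP.
Qed.
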